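(* Let $n\ge3$, $s\in(0,1)$, let $u\in C(\mathbb{R}^n)\cap L^1_{\omega_s}(\mathbb{R}^n)$, and let $x\in\mathbb{R}^n$ be a point at which $u$ can be touched from above by a $C^2$-function. Let $A\in\mathcal{S}^n_+$. Then $$\mathcal{L}^s_Au(x)=\frac{C_{n,s}}{4(1-s)}\int_{\mathbb{S}^{n-1}}\mathcal{I}^su(x,Ae)\,d\mathcal{H}^{n-1}_e=\frac{C_{n,s}}{4(1-s)}\int_{\mathbb{S}^{n-1}}|Ae|^{2s}\,\Theta^su\Big(x,\frac{Ae}{|Ae|}\Big)\,d\mathcal{H}^{n-1}_e.$$ In particular, $$\mathcal{K}^su(x)=\frac{C_{n,s}}{4(1-s)}\inf_{A\in\mathcal{A}_2}\int_{\mathbb{S}^{n-1}}\mathcal{I}^su(x,Ae)\,d\mathcal{H}^{n-1}_e.$$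
   Context: $\mathcal{S}^n_+$ is the set of symmetric positive definite real $n\times n$ matrices. $L^1_{\omega_s}(\mathbb{R}^n)$ is the set of $u$ with $\int_{\mathbb{R}^n}\frac{|u(y)|}{1+|y|^{n+2s}}\,dy<\infty$. Let $C_{n,s}=\dfrac{4^s s\,\Gamma(\frac{n+2s}{2})}{\pi^{n/2}\Gamma(1-s)}$, $\delta u(x,y)=u(x+y)+u(x-y)-2u(x)$, and $$\mathcal{L}^s_Au(x)=\frac{C_{n,s}}2\int_{\mathbb{R}^n}\frac{\delta u(x,Ay)}{|y|^{n+2s}}\,dy,\qquad \mathcal{K}^su(x)=\inf_{A\in\mathcal{A}_2}\mathcal{L}^s_Au(x),$$ $$\Theta^su(x,e)=(1-s)\int_{-\infty}^\infty\frac{\delta u(x,re)}{|r|^{1+2s}}\,dr\ (e\in\mathbb{S}^{n-1}),\qquad\mathcal{I}^su(x,y)=(1-s)\int_{-\infty}^\infty\frac{\delta u(x,ry)}{|r|^{1+2s}}\,dr\ (y\in\mathbb{R}^n).$$ Here, with $\sigma_1(\zeta)=\sum_i\zeta_i$, $\sigma_2(\zeta)=\sum_{i<j}\zeta_i\zeta_j$, $\Gamma_2=\{\zeta\in\mathbb{R}^n:\sigma_1(\zeta)>0,\ \sigma_2(\zeta)>0\}$ and $\lambda_i(A)$ the eigenvalues of $A$ with multiplicity, $$\mathcal{A}_2=\Big\{A\in\mathcal{S}^n_+:\ \lambda_i(A)^2=\sum_{j\ne i}\zeta_j\ (i=1,\dots,n)\ \text{for some }\zeta\in\Gamma_2\text{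 with }\sigma_2(\zeta)=1\Big\}.$$ $u$ can be touched from above by a $C^2$-function at $x$ if there are an open neighborhood $N$ of $x$ and $\psi\in C^2(N)$ with $\psi(x)=u(x)$ and $\psi(y)>u(y)$ for all $y\in N\setminus\{x\}$. At such points the integrals of $\delta u$ above have integrable positive part (for a.e. direction, in the one-dimensional case), so they take values in $[-\infty,\infty)$, and the identities are understood in $[-\infty,\infty)$. *)

(* Defs.v *)
From HB Require Import structures.
From mathcomp Require Import all_boot all_order all_algebra.
From mathcomp Require Import all_classical all_reals all_analysis.

Set Implicit Arguments.
Unset Strict Implicit.
Unset Printing Implicit Defensive.

Import Order.TTheory GRing.Theory Num.Theory.
Import numFieldNormedType.Exports.

Local Open Scope classical_set_scope.
Local Open Scope ring_scope.

(* Real matrices carry the sigma-algebra generated by their coordinates, which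
   is also their Borel sigma-algebra. *)
Definition measure_matrix_display : measure_display. Proof. exact. Qed.

Section measurable_matrix.
Context {R : realType} (m n : nat).

Definition mx_coord_sets : set (set 'M[R]_(m, n)) :=
  [set A | exists i j, exists2 B : set R,
     measurable B & A = (fun M : 'M[R]_(m, n) => M i j) @^-1` B].

Let mx_set0 : <<s mx_coord_sets >> set0.
Proof. exact: sigma_algebra0. Qed.

Let mx_setC A : <<s mx_coord_sets >> A -> <<s mx_coord_sets >> (~` A).
Proof. exact: sigma_algebraC. Qed.

Let mx_bigcup (F : (set 'M[R]_(m, n))^nat) :
  (forall i, <<s mx_coord_sets >> (F i)) ->
  <<s mx_coord_sets >> (\bigcup_i F i).
Proof. exact: sigma_algebra_bigcup. Qed.

HB.instance Definition _ := @isMeasurable.Build measure_matrix_display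
  'M[R]_(m, n) <<s mx_coord_sets >> mx_set0 mx_setC mx_bigcup.

Lemma measurable_mx_coord i j :
  measurable_fun [set: 'M[R]_(m, n)] (fun M : 'M[R]_(m, n) => M i j).
Proof.
move=> _ B mB; rewrite setTI; apply: sub_sigma_algebra.
by exists i, j, B.
Qed.

Lemma measurable_fun_mx d (T : measurableType d) (f : T -> 'M[R]_(m, n)) :
  (forall i j, measurable_fun [set: T] (fun x => f x i j)) ->
  measurable_fun [set: T] f.
Proof.
move=> mf.
apply: (@measurability _ _ _ _ _ _ mx_coord_sets) => //.
by move=> _ [_ [i [j [B mB ->]]] <-]; exact: mf.
Qed.

End measurable_matrix.

Section lebesgue_cV.
Context {R : realType}.

Definition cons_cV n (p : R * 'cV[R]_n) : 'cV[R]_n.+1 := col_mx p.1%:M p.2.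

Definition uncons_cV n (v : 'cV[R]_n.+1) : R * 'cV[R]_n :=
  (v ord0 ord0, \col_i v (lift ord0 i) ord0).

Lemma cons_cVK n : cancel (@cons_cV n) (@uncons_cV n).
Proof.
move=> [t v]; rewrite /cons_cV /uncons_cV; congr pair.
  have -> : ord0 = lshift n (ord0 : 'I_1) by exact/val_inj.
  by rewrite (@col_mxEu _ 1 n 1) mxE eqxx mulr1n.
apply/colP => i; rewrite mxE.
have -> : lift ord0 i = rshift 1 i by exact/val_inj.
by rewrite (@col_mxEd _ 1 n 1).
Qed.

Lemma measurable_cons_cV n : measurable_fun [set: R * 'cV[R]_n] (@cons_cV n).
Proof.
apply: measurable_fun_mx => i j; rewrite /cons_cV.
have [k ->|k ->] := @fintype.split_ordP 1 n i.
  under eq_fun do rewrite (@col_mxEu _ 1 n 1) mxE ord1 (ord1 j) eqxx mulr1n.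
  exact: measurable_fst.
under eq_fun do rewrite (@col_mxEd _ 1 n 1).
exact: (measurableT_comp (@measurable_mx_coord R n 1 k j)).
Qed.

Lemma measurable_uncons_cV n : measurable_fun [set: 'cV[R]_n.+1] (@uncons_cV n).
Proof.
apply/measurable_fun_pairP; split; first exact: measurable_mx_coord.
apply: measurable_fun_mx => i j.
under eq_fun do rewrite /= mxE.
exact: measurable_mx_coord.
Qed.

Section step.
Variables (n : nat) (mu : {sigma_finite_measure set 'cV[R]_n -> \bar R}).

Definition lebesgue_cVS : set 'cV[R]_n.+1 -> \bar R :=
  pushforward ((@lebesgue_measure R) \x mu)%E (@cons_cV n).

Let lebesgue_cVS0 : lebesgue_cVS set0 = 0%E.
Proof.
by rewrite /lebesgue_cVS; have mf := @measurable_cons_cV n; exact: measure0.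
Qed.

Let lebesgue_cVS_ge0 A : (0 <= lebesgue_cVS A)%E.
Proof.
by rewrite /lebesgue_cVS; have mf := @measurable_cons_cV n; exact: measure_ge0.
Qed.

Let lebesgue_cVS_semi_sigma_additive : semi_sigma_additive lebesgue_cVS.
Proof.
rewrite /lebesgue_cVS; have mf := @measurable_cons_cV n.
exact: measure_semi_sigma_additive.
Qed.

HB.instance Definition _ := isMeasure.Build _ _ _ lebesgue_cVS
  lebesgue_cVS0 lebesgue_cVS_ge0 lebesgue_cVS_semi_sigma_additive.

Let lebesgue_cVS_sigma_finite : sigma_finite setT lebesgue_cVS.
Proof.
have /sigma_finiteP[F [TF ndF Foo]] := sigma_finiteT (@lebesgue_measure R).
have /sigma_finiteP[G [TG ndG Goo]] := sigma_finiteT mu.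
exists (fun i => @uncons_cV n @^-1` (F i `*` G i)).
  rewrite -preimage_bigcup [X in _ @^-1` X](_ : _ = setT) ?preimage_setT//.
  apply/seteqP; split=> // -[t v] _.
  have [i _ Fit] : (\bigcup_i F i) t by rewrite -TF.
  have [j _ Gjv] : (\bigcup_i G i) v by rewrite -TG.
  exists (maxn i j) => //; split => /=.
    by move: Fit; apply/subsetPset/ndF/leq_maxl.
  by move: Gjv; apply/subsetPset/ndG/leq_maxr.
move=> i; have [mF Fi] := Foo i; have [mG Gi] := Goo i; split.
  rewrite -[X in measurable X]setTI; apply: measurable_uncons_cV => //.
  exact: measurableX.
rewrite /lebesgue_cVS /pushforward -comp_preimage.
rewrite (_ : _ \o _ = id) ?preimage_id; last first.
  by apply/funext => p /=; exact: cons_cVK.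
by rewrite product_measure1E// lte_mul_pinfty// ge0_fin_numE.
Qed.

HB.instance Definition _ := Measure_isSigmaFinite.Build _ _ _ lebesgue_cVS
  lebesgue_cVS_sigma_finite.

End step.

Fixpoint lebesgue_cV n : {sigma_finite_measure set 'cV[R]_n -> \bar R} :=
  if n is n'.+1 then lebesgue_cVS (lebesgue_cV n') else \d_(0 : 'cV[R]_0).

End lebesgue_cV.

Section euclidean.
Context {R : realType} {n : nat}.
Implicit Types (x y v : 'cV[R]_n) (E : set 'cV[R]_n).

(* The library's norm on matrices is the sup norm. *)
Definition enorm v : R := Num.sqrt (\sum_(i < n) v i ord0 ^+ 2).

Definition usphere : set 'cV[R]_n := [set e | enorm e = 1].

(* The added 0 only matters for the empty set. *)
Definition ediam E : \bar R :=
  ereal_sup ([set 0%E] `|` [set (enorm (x - y))%:E | x in E & y in E]).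

End euclidean.

Section hausdorff.
Context {R : realType} {n : nat}.
Implicit Types (A : set 'cV[R]_n) (k : nat) (d : R).

Definition ball_volume k : \bar R :=
  lebesgue_cV k [set v : 'cV[R]_k | enorm v <= 1].

Definition hausdorff_pre k d A : \bar R :=
  ereal_inf [set (\sum_(j <oo) ball_volume k * (ediam (C j) * (2^-1)%:E) ^+ k)%E
            | C in [set C : (set 'cV[R]_n)^nat |
                A `<=` \bigcup_j C j /\ forall j, (ediam (C j) <= d%:E)%E]].

(* The k-dimensional Hausdorff measure with its usual normalization, for k > 0
   (with k = 0, the empty sets of a cover would not have cost 0). *)
Definition hausdorff k A : \bar R :=
  ereal_sup [set hausdorff_pre k d A | d in [set d : R | 0 < d]].

End hausdorff.

Section regularity.
Context {R : realType} {n : nat}.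
Implicit Types (N : set 'cV[R]_n) (f u : 'cV[R]_n -> R).

Definition partial (i : 'I_n) f : 'cV[R]_n -> R :=
  fun y => 'D_(delta_mx i ord0) f y.

Definition C1_on N f : Prop := forall y, N y ->
  {for y, continuous f} /\
  forall i, derivable f y (delta_mx i ord0) /\ {for y, continuous (partial i f)}.

Definition C2_on N f : Prop := C1_on N f /\ forall i, C1_on N (partial i f).

Definition touched_above u (x : 'cV[R]_n) : Prop :=
  exists (N : set 'cV[R]_n) (psi : 'cV[R]_n -> R),
    [/\ open N, N x, C2_on N psi, psi x = u x &
        forall y, N y -> y != x -> u y < psi y].

Definition L1_omega (s : R) u : Prop :=
  measurable_fun [set: 'cV[R]_n] u /\
  (\int[lebesgue_cV n]_y (`|u y| / (1 + enorm y `^ (n%:R + 2 * s)))%:E < +oo)%E.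

End regularity.

Section matrices.
Context {R : realType} {n : nat}.

Definition sym_posdef (A : 'M[R]_n) : Prop :=
  A^T = A /\ forall v : 'cV[R]_n, v != 0 -> 0 < (v^T *m A *m v) ord0 ord0.

Definition sigma1 (z : 'I_n -> R) : R := \sum_(i < n) z i.

Definition sigma2 (z : 'I_n -> R) : R :=
  \sum_(i < n) \sum_(j < n | (i < j)%N) z i * z j.

Definition Gamma2 : set ('I_n -> R) := [set z | 0 < sigma1 z /\ 0 < sigma2 z].

(* l lists the eigenvalues of A, with multiplicity. *)
Definition eigenvalues (A : 'M[R]_n) (l : 'I_n -> R) : Prop :=
  char_poly A = \prod_(i < n) ('X - (l i)%:P).

Definition A2 : set 'M[R]_n :=
  [set A | sym_posdef A /\ exists l z : 'I_n -> R,
     [/\ eigenvalues A l, Gamma2 z, sigma2 z = 1 &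
         forall i, l i ^+ 2 = \sum_(j < n | j != i) z j]].

End matrices.

Section operators.
Context {R : realType}.

Definition GammaE (z : R) : R :=
  \int[@lebesgue_measure R]_(t in `]0, +oo[) (t `^ (z - 1) * expR (- t)).

Definition Cns (n : nat) (s : R) : R :=
  4 `^ s * s * GammaE ((n%:R + 2 * s) / 2) /
  (pi `^ (n%:R / 2) * GammaE (1 - s)).

Context {n : nat}.
Implicit Types (u : 'cV[R]_n -> R) (s : R) (x y e : 'cV[R]_n) (A : 'M[R]_n).

Definition delta u x y : R := u (x + y) + u (x - y) - 2 * u x.

(* The integrals below are extended-real valued: when the positive part of the
   integrand is integrable and the negative part is not, the value is -oo.
   (Should neither be integrable, the library's value is -oo too.) *)
Definition Ls s A u x : \bar R :=
  ((Cns n s / 2)%:E *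
   \int[lebesgue_cV n]_y
     (delta u x (A *m y) / enorm y `^ (n%:R + 2 * s))%:E)%E.

Definition Ks s u x : \bar R := ereal_inf [set Ls s A u x | A in A2].

(* e is meant to be a unit vector. *)
Definition Thetas s u x e : \bar R :=
  ((1 - s)%:E *
   \int[@lebesgue_measure R]_r
     (delta u x (r *: e) / `|r| `^ (1 + 2 * s))%:E)%E.

Definition Is s u x y : \bar R :=
  ((1 - s)%:E *
   \int[@lebesgue_measure R]_r
     (delta u x (r *: y) / `|r| `^ (1 + 2 * s))%:E)%E.

End operators.

(* Main.v *)
Require Import Defs.
From HB Require Import structures.
From mathcomp Require Import all_boot all_order all_algebra fingroup perm.
From mathcomp Require Import all_classical all_reals all_analysis measurable_realfun.
From mathcomp Require Import ring lra.

Set Implicit Arguments.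
Unset Strict Implicit.
Unset Printing Implicit Defensive.

Import Order.TTheory GRing.Theory Num.Theory.
Import numFieldNormedType.Exports.
Local Open Scope classical_set_scope.
Local Open Scope ring_scope.


(** The formula is integration in polar coordinates, applied separately to the
   positive and the negative part of [y |-> delta u x (A y)]. Both parts are even,
   so their integrals along the rays [r e] with [r > 0] are half of those along
   whole lines, which are the integrals defining [Is s u x (A e)]; the power of
   [r] in the volume element and the kernel [|r|^-(n+2s)] combine into
   [|r|^-(1+2s)] ([polar_usphere], [integral_ray]). The two identities can be
   subtracted in the extended reals because the positive part has a finite
   integral ([posdelta_lty]): the touching function gives
   [delta u x v <= C |v|^2] for small [v] ([touched_above_delta_bound]), and the
   weighted integrability of [u] controls the tail. This also shows that the
   integral over the sphere is a difference of two integrals of which only the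
   second may be infinite ([ge0_integralB], [Ls_sphere]). The version with
   [Thetas] is the homogeneity of degree [2 s] of [Is] in its last variable
   ([IsZ]), and the last formula follows by taking infima, a nonnegative constant
   factor commuting with the infimum of a nonempty set.

   Polar coordinates are immediate for the cone measure of the sphere, that is
   [n] times the volume of the part of the punctured unit ball above a set of
   directions: exchanging the integrals over the ball and over the half-line is
   enough ([polar_coordinates]). The substance of the proof is that the cone
   measure is the Hausdorff measure of dimension [n - 1] on the sphere
   ([hausdorff_sphere]). Both inequalities are proved on small caps, in the chart
   given by the projection of the tangent hyperplane from the origin. This chart
   does not increase distances, decreases them by a factor close to one near its
   centre, and turns the cone measure into the volume up to such a factor
   ([gnom_lipschitz], [gnom_expand], [cone_volume]).

   For the upper bound on the cone measure, each set of a cover is compared with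
   its cost in the definition of the Hausdorff measure. This is the isodiametric
   inequality ([isodiametric]): among the sets of given diameter the ball has the
   largest volume. Its proof symmetrizes a set along each axis in turn, which
   preserves the volume and does not increase the diameter.

   For the upper bound on the Hausdorff measure, it suffices that in full
   dimension it is at most the volume ([hausdorff_le_lebesgue]). On small cubes it
   is at most a constant [M] times the volume. A fixed portion of a cube is filled
   by a ball, for which cost and volume agree, and the rest can be covered at the
   rate [M]; repeating this drives the constant down to one ([cube_bound_step]). *)

(** * Measurability of the vector operations *)

Section measurability.
Context {R : realType}.

Lemma measurable_cV_scale n :
  measurable_fun [set: R * 'cV[R]_n] (fun p => p.1 *: p.2).
Proof.
apply: measurable_fun_mx => i j; under eq_fun do rewrite mxE.
apply: measurable_funM => //.
exact: (measurableT_comp (@measurable_mx_coord R n 1 i j) measurable_snd).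
Qed.

Lemma measurable_cV_dilate n :
  measurable_fun [set: 'cV[R]_n * R] (fun p => p.2 *: p.1).
Proof.
exact: (measurableT_comp (@measurable_cV_scale n)
  (measurable_fun_pair measurable_snd measurable_fst)).
Qed.

Lemma measurable_cV_scalec n (c : R) :
  measurable_fun [set: 'cV[R]_n] (fun v => c *: v).
Proof.
apply: measurable_fun_mx => i j; under eq_fun do rewrite mxE.
by apply: measurable_funM => //; exact: measurable_mx_coord.
Qed.

Lemma measurable_cV_addc n (w : 'cV[R]_n) :
  measurable_fun [set: 'cV[R]_n] (fun v => v + w).
Proof.
apply: measurable_fun_mx => i j; under eq_fun do rewrite mxE.
by apply: measurable_funD => //; exact: measurable_mx_coord.
Qed.

Lemma measurable_cV_add d (T : measurableType d) n (f g : T -> 'cV[R]_n) :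
  measurable_fun [set: T] f -> measurable_fun [set: T] g ->
  measurable_fun [set: T] (fun x => f x + g x).
Proof.
move=> mf mg; apply: measurable_fun_mx => i j; under eq_fun do rewrite mxE.
by apply: measurable_funD => //;
  exact: (measurableT_comp (@measurable_mx_coord R n 1 i j)).
Qed.

Lemma measurable_cV_mulmx m n (A : 'M[R]_(m, n)) :
  measurable_fun [set: 'cV[R]_n] (fun v => A *m v).
Proof.
apply: measurable_fun_mx => i j; under eq_fun do rewrite mxE.
apply: measurable_sum => k.
by apply: measurable_funM => //; exact: measurable_mx_coord.
Qed.

Lemma measurable_enorm n : measurable_fun [set: 'cV[R]_n] (@enorm R n).
Proof.
have msqrt : measurable_fun [set: R] (@Num.sqrt R).
  by apply: continuous_measurable_fun; exact: sqrt_continuous.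
apply: (measurableT_comp msqrt).
by apply: measurable_sum => i; apply: measurable_funX; exact: measurable_mx_coord.
Qed.

End measurability.

(** * Affine changes of variables *)

Section affine_change_of_variables.
Context {R : realType}.
Local Open Scope ereal_scope.

Lemma measurable_preimage d d' (T : measurableType d) (T' : measurableType d')
  (f : T -> T') (A : set T') : measurable_fun setT f -> measurable A ->
  measurable (f @^-1` A).
Proof. by move=> mf mA; rewrite -[X in measurable X]setTI; exact: mf. Qed.

(** Both sides are measures that agree on half-open intervals. *)
Lemma lebesgue_measure_affine (c w : R) (A : set R) : (0 < c)%R -> measurable A ->
  c%:E * lebesgue_measure ((fun t => c * t + w)%R @^-1` A) = lebesgue_measure A.
Proof.
move=> c0 mA.
pose phi : measurableTypeR R -> measurableTypeR R := (fun t => c * t + w)%R.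
have mphi : measurable_fun setT phi.
  by apply: measurable_funD => //; exact: measurable_funM.
pose k : {nonneg R} := NngNum (ltW c0).
rewrite (_ : _ * _ = mscale k (pushforward (@lebesgue_measure R) phi) A)//.
apply/esym/lebesgue_measure_unique => //= _ [[a b]] _ <-.
rewrite /mscale /= /pushforward /phi.
have -> : (fun t : R => (c * t + w)%R) @^-1` `]a, b]%classic =
    `]((a - w) / c)%R, ((b - w) / c)%R]%classic :> set R.
  by apply/seteqP; split=> t /=; rewrite !in_itv/= ltr_pdivrMr// ler_pdivlMr//
    ltrBlDr lerBrDr (mulrC t).
rewrite !lebesgue_measure_itv /= !lte_fin ltr_pM2r ?invr_gt0// ltrD2r.
case: ifP => _; last by rewrite mule0.
by rewrite -!EFinD -EFinM; congr (_%:E); field; rewrite gt_eqF.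
Qed.

Lemma ge0_integral_affine (c w : R) (f : R -> \bar R) : (0 < c)%R ->
  measurable_fun setT f -> (forall t, 0 <= f t) ->
  c%:E * \int[lebesgue_measure]_t f (c * t + w)%R = \int[lebesgue_measure]_t f t.
Proof.
move=> c0 mf f0.
pose phi : measurableTypeR R -> measurableTypeR R := (fun t => c * t + w)%R.
have mphi : measurable_fun setT phi.
  by apply: measurable_funD => //; exact: measurable_funM.
have c0' : (0 <= c^-1)%R by rewrite invr_ge0 ltW.
pose k : {nonneg R} := NngNum c0'.
transitivity (c%:E * \int[pushforward (@lebesgue_measure R) phi]_t f t).
  by rewrite ge0_integral_pushforward.
rewrite (eq_measure_integral (mscale k (@lebesgue_measure R))); last first.
  move=> A mA _; transitivity ((c^-1)%:E * lebesgue_measure A); last by [].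
  by rewrite -(lebesgue_measure_affine w c0 mA) muleA -EFinM mulVf ?gt_eqF// mul1e.
by rewrite ge0_integral_mscale//= muleA -EFinM divff ?gt_eqF// mul1e.
Qed.

Lemma ge0_integral_opp (f : R -> \bar R) :
  measurable_fun setT f -> (forall t, 0 <= f t) ->
  \int[lebesgue_measure]_t f (- t)%R = \int[lebesgue_measure]_t f t.
Proof.
move=> mf f0.
have mphi : measurable_fun setT (-%R : measurableTypeR R -> measurableTypeR R).
  exact: oppr_measurable.
transitivity (\int[pushforward (@lebesgue_measure R) (-%R : measurableTypeR R -> measurableTypeR R)]_t f t); last first.
  by apply: eq_measure_integral => A mA _; exact: lebesgue_measureN.
by rewrite ge0_integral_pushforward//=.
Qed.

Lemma ge0_integral_cVS n (f : 'cV[R]_n.+1 -> \bar R) :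
  measurable_fun setT f -> (forall v, 0 <= f v) ->
  \int[lebesgue_cV n.+1]_v f v =
  \int[lebesgue_measure]_t \int[lebesgue_cV n]_v f (cons_cV (t, v)).
Proof.
move=> mf f0.
rewrite ge0_integral_pushforward//=; last exact: measurable_cons_cV.
rewrite preimage_setT fubini_tonelli1//.
by apply: measurableT_comp => //; exact: measurable_cons_cV.
Qed.

Lemma ge0_integral_cVS2 n (f : 'cV[R]_n.+1 -> \bar R) :
  measurable_fun setT f -> (forall v, 0 <= f v) ->
  \int[lebesgue_cV n.+1]_v f v =
  \int[lebesgue_cV n]_v \int[lebesgue_measure]_t f (cons_cV (t, v)).
Proof.
move=> mf f0.
rewrite ge0_integral_pushforward//=; last exact: measurable_cons_cV.
rewrite preimage_setT fubini_tonelli2//.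
by apply: measurableT_comp => //; exact: measurable_cons_cV.
Qed.

Lemma affine_cons_cV n (c : R) (w : 'cV[R]_n.+1) t v :
  (c *: cons_cV (t, v) + w = cons_cV (c * t + (uncons_cV w).1, c *: v + (uncons_cV w).2))%R.
Proof.
apply/colP => i; rewrite /cons_cV !mxE.
case: fintype.splitP => j /= ij; rewrite !mxE.
  rewrite !ord1 eqxx !mulr1n; congr (_ + w _ _)%R; apply/val_inj => /=.
  by rewrite ij ord1.
by congr (_ + w _ _)%R; apply/val_inj.
Qed.

(** Induction on the dimension: by Tonelli the first coordinate and the others
   are rescaled separately. *)
Lemma ge0_integral_cV_affine n (c : R) (w : 'cV[R]_n) (f : 'cV[R]_n -> \bar R) :
  (0 < c)%R -> measurable_fun setT f -> (forall v, 0 <= f v) ->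
  (c ^+ n)%:E * \int[lebesgue_cV n]_v f (c *: v + w)%R =
  \int[lebesgue_cV n]_v f v.
Proof.
move=> c0; elim: n w f => [|n IH] w f mf f0.
  rewrite expr0 mul1e; apply: eq_integral => v _; congr f.
  by rewrite [v]flatmx0 [w]flatmx0 scaler0 addr0.
have mfc : measurable_fun setT (fun p => f (cons_cV p)).
  by apply: measurableT_comp => //; exact: measurable_cons_cV.
rewrite ge0_integral_cVS//; last first.
  apply: measurableT_comp => //.
  apply: measurable_cV_add; [exact: measurable_cV_scalec|exact: measurable_cst].
rewrite exprS EFinM -muleA.
transitivity (c%:E * \int[lebesgue_measure]_t ((c ^+ n)%:E *
   \int[lebesgue_cV n]_v f (c *: cons_cV (t, v) + w)%R)).
  rewrite ge0_integralZl//.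
  - apply: (measurable_fun_fubini_tonelli_F (m2 := lebesgue_cV n) (fun p => f (c *: cons_cV p + w)%R)) => //.
    apply: measurableT_comp => //.
    apply: measurable_cV_add; last exact: measurable_cst.
    by apply: measurableT_comp; [exact: measurable_cV_scalec|exact: measurable_cons_cV].
  - by move=> t _; exact: integral_ge0.
  - by rewrite lee_fin exprn_ge0// ltW.
under eq_integral => t _.
  under eq_integral do rewrite affine_cons_cV.
  rewrite (IH (uncons_cV w).2 (fun v => f (cons_cV ((c * t + (uncons_cV w).1)%R, v))))//; last first.
    exact: (measurableT_comp mfc (measurable_pair1 _)).
  over.
rewrite (ge0_integral_affine (uncons_cV w).1 (f := fun t => \int[lebesgue_cV n]_x f (cons_cV (t, x))))//.
- by rewrite ge0_integral_cVS.
- exact: (measurable_fun_fubini_tonelli_F (fun p => f (cons_cV p))).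
- by move=> t; exact: integral_ge0.
Qed.

Lemma lebesgue_cV_affine n (c : R) (w : 'cV[R]_n) (A : set 'cV[R]_n) :
  (0 < c)%R -> measurable A ->
  (c ^+ n)%:E * lebesgue_cV n ((fun v => c *: v + w)%R @^-1` A) = lebesgue_cV n A.
Proof.
move=> c0 mA.
have mphi : measurable_fun [set: 'cV[R]_n] (fun v => c *: v + w)%R.
  apply: measurable_cV_add; [exact: measurable_cV_scalec|exact: measurable_cst].
rewrite -[in RHS](setIT A) -integral_indic// -[in LHS](setIT (_ @^-1` _)).
rewrite -integral_indic//; last exact: measurable_preimage.
rewrite -(ge0_integral_cV_affine w c0 (f := fun v => (\1_A v)%:E))//.
by apply/measurable_EFinP; exact: measurable_indic.
Qed.

End affine_change_of_variables.

(** * The Euclidean norm *)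

Section euclidean_norm.
Context {R : realType}.
Implicit Types (n : nat).

Definition dot n (u v : 'cV[R]_n) : R := \sum_i u i ord0 * v i ord0.

Lemma enorm_ge0 n (v : 'cV[R]_n) : 0 <= enorm v.
Proof. exact: sqrtr_ge0. Qed.

Lemma enorm_sqr n (v : 'cV[R]_n) : enorm v ^+ 2 = dot v v.
Proof.
rewrite sqr_sqrtr; last by apply: sumr_ge0 => i _; exact: sqr_ge0.
by apply: eq_bigr => i _; rewrite expr2.
Qed.

Lemma dotC n (u v : 'cV[R]_n) : dot u v = dot v u.
Proof. by apply: eq_bigr => i _; rewrite mulrC. Qed.

Lemma dotDl n (u v w : 'cV[R]_n) : dot (u + v) w = dot u w + dot v w.
Proof. by rewrite -big_split; apply: eq_bigr => i _; rewrite mxE mulrDl. Qed.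

Lemma dotZl n c (u v : 'cV[R]_n) : dot (c *: u) v = c * dot u v.
Proof. by rewrite mulr_sumr; apply: eq_bigr => i _; rewrite mxE mulrA. Qed.

Lemma dot_ge0 n (v : 'cV[R]_n) : 0 <= dot v v.
Proof. by rewrite -enorm_sqr sqr_ge0. Qed.

Lemma enorm_coord n (v : 'cV[R]_n) i : `|v i ord0| <= enorm v.
Proof.
rewrite -sqrtr_sqr ler_wsqrtr// (bigD1 i)//= lerDl.
by apply: sumr_ge0 => j _; exact: sqr_ge0.
Qed.

Lemma enorm0 n : enorm (0 : 'cV[R]_n) = 0.
Proof. by rewrite /enorm big1 ?sqrtr0// => i _; rewrite mxE expr0n. Qed.

Lemma enorm_eq0 n (v : 'cV[R]_n) : (enorm v == 0) = (v == 0).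
Proof.
apply/eqP/eqP => [v0|->]; last exact: enorm0.
by apply/colP => i; rewrite mxE; apply/normr0_eq0/le_anti; rewrite normr_ge0 -v0 enorm_coord.
Qed.

Lemma enorm_gt0 n (v : 'cV[R]_n) : (0 < enorm v) = (v != 0).
Proof. by rewrite lt_def enorm_ge0 enorm_eq0 andbT. Qed.

Lemma enormZ n c (v : 'cV[R]_n) : enorm (c *: v) = `|c| * enorm v.
Proof.
rewrite -sqrtr_sqr -sqrtrM ?sqr_ge0//; congr Num.sqrt.
by rewrite mulr_sumr; apply: eq_bigr => i _; rewrite mxE exprMn.
Qed.

Lemma enormN n (v : 'cV[R]_n) : enorm (- v) = enorm v.
Proof. by rewrite -scaleN1r enormZ normrN1 mul1r. Qed.

(** The Cauchy-Schwarz inequality, from the square of the component of [u]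
   orthogonal to [v]. *)
Lemma dot_le_enorm n (u v : 'cV[R]_n) : dot u v <= enorm u * enorm v.
Proof.
have [v0|v0] := eqVneq v 0.
  by rewrite v0 enorm0 mulr0 /dot big1// => i _; rewrite mxE mulr0.
have nv : 0 < enorm v by rewrite enorm_gt0.
have [//|d0] := leP (dot u v) 0; first by move=> /le_trans; apply; rewrite mulr_ge0 ?enorm_ge0.
rewrite -ler_sqr ?nnegrE ?mulr_ge0 ?enorm_ge0 ?(ltW d0)// exprMn !enorm_sqr.
have vv : 0 < dot v v by rewrite -enorm_sqr exprn_gt0.
have := dot_ge0 (u + (- (dot u v / dot v v)) *: v).
rewrite dotDl dotZl dotC dotDl dotZl (dotC v (u + _)) dotDl dotZl (dotC v u).
set a := dot u u; set b := dot u v; set c := dot v v.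
move=> h; rewrite -subr_ge0.
suff -> : a * c - b ^+ 2 = c * (a + - (b / c) * b + - (b / c) * (b + - (b / c) * c)).
  by apply: mulr_ge0 => //; exact: ltW.
by field; rewrite gt_eqF.
Qed.

Lemma ler_enormD n (u v : 'cV[R]_n) : enorm (u + v) <= enorm u + enorm v.
Proof.
rewrite -ler_sqr ?nnegrE ?addr_ge0 ?enorm_ge0// enorm_sqr dotDl dotC dotDl.
rewrite (dotC v (u + v)) dotDl sqrrD !enorm_sqr (dotC v u).
have := dot_le_enorm u v; lra.
Qed.

Lemma enorm_le_coord n (v : 'cV[R]_n) h : 0 <= h ->
  (forall i, `|v i ord0| <= h) -> enorm v <= Num.sqrt n%:R * h.
Proof.
move=> h0 vh; rewrite -[h]ger0_norm// -sqrtr_sqr -sqrtrM ?ler0n//.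
apply: ler_wsqrtr; rewrite mulr_natl -[n in _ *+ n]card_ord -sumr_const.
by apply: ler_sum => i _; rewrite -real_normK ?num_real// ler_sqr ?nnegrE.
Qed.

Lemma enorm_orth n (Q : 'M[R]_n) (v : 'cV[R]_n) : Q^T *m Q = 1%:M ->
  enorm (Q *m v) = enorm v.
Proof.
move=> QQ; have dE (w : 'cV[R]_n) : dot w w = (w^T *m w) ord0 ord0.
  by rewrite mxE; apply: eq_bigr => i _; rewrite mxE.
apply/eqP; rewrite -(@eqrXn2 _ 2) ?enorm_ge0// !enorm_sqr !dE trmx_mul.
by rewrite -mulmxA (mulmxA Q^T) QQ mul1mx.
Qed.

Lemma cons_cV0 n (t : R) (v : 'cV[R]_n) : cons_cV (t, v) ord0 ord0 = t.
Proof. by have := cons_cVK (t, v) => -[]. Qed.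

Lemma cons_cVS n (t : R) (v : 'cV[R]_n) i : cons_cV (t, v) (lift ord0 i) ord0 = v i ord0.
Proof. by have := cons_cVK (t, v) => -[_] /colP/(_ i); rewrite mxE. Qed.

Lemma uncons_cVK n : cancel (@uncons_cV R n) (@cons_cV R n).
Proof.
move=> v; apply/colP => i; case: (unliftP ord0 i) => [j ->|->].
  by rewrite cons_cVS mxE.
by rewrite cons_cV0.
Qed.

Lemma dot_cons n (t t' : R) (v v' : 'cV[R]_n) :
  dot (cons_cV (t, v)) (cons_cV (t', v')) = t * t' + dot v v'.
Proof.
rewrite /dot big_ord_recl !cons_cV0; congr (_ + _).
by apply: eq_bigr => i _; rewrite !cons_cVS.
Qed.

Lemma enorm_cons n (t : R) (v : 'cV[R]_n) :
  enorm (cons_cV (t, v)) ^+ 2 = t ^+ 2 + enorm v ^+ 2.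
Proof. by rewrite !enorm_sqr dot_cons expr2. Qed.

Lemma consB n (t t' : R) (v v' : 'cV[R]_n) :
  cons_cV (t, v) - cons_cV (t', v') = cons_cV (t - t', v - v').
Proof.
have := affine_cons_cV 1 (- cons_cV (t', v')) t v; rewrite scale1r => ->.
rewrite mul1r scale1r; congr cons_cV; congr pair; rewrite /uncons_cV /=.
  by rewrite mxE cons_cV0.
by congr (_ + _); apply/colP => i; rewrite [LHS]mxE [LHS]mxE cons_cVS [RHS]mxE.
Qed.

Lemma consZ n c (t : R) (v : 'cV[R]_n) :
  c *: cons_cV (t, v) = cons_cV (c * t, c *: v).
Proof.
have := affine_cons_cV c (0 : 'cV[R]_n.+1) t v; rewrite addr0 => ->.
congr cons_cV; congr pair; rewrite /uncons_cV /= ?mxE ?addr0//.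
by rewrite -[RHS]addr0; congr (_ + _); apply/colP => i; rewrite !mxE.
Qed.

End euclidean_norm.

(** * Cubes, balls and their volumes *)

Section volumes.
Context {R : realType}.
Local Open Scope ereal_scope.

Definition cube n (a : 'cV[R]_n) (h : R) : set 'cV[R]_n :=
  [set v | forall i, (a i ord0 <= v i ord0 < a i ord0 + h)%R].

Definition eball n (r : R) : set 'cV[R]_n := [set v | (enorm v <= r)%R].

Lemma measurable_coord_itv n (i : 'I_n) (J : interval R) :
  measurable [set v : 'cV[R]_n | v i ord0 \in J].
Proof. exact: (measurable_preimage (measurable_mx_coord i ord0) (measurable_itv J)). Qed.

Lemma measurable_cube n (a : 'cV[R]_n) h : measurable (cube a h).
Proof.
rewrite (_ : cube a h = \bigcap_(i in [set: 'I_n]) [set v : 'cV[R]_n | v i ord0 \in `[a i ord0, (a i ord0 + h)%R[ ]).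
  by apply: fin_bigcap_measurable => // i _; exact: measurable_coord_itv.
apply/seteqP; split=> v vi i; first by move=> _ /=; rewrite in_itv/=; exact: vi.
by have := vi i Logic.I; rewrite /= in_itv.
Qed.

Lemma measurable_enorm_le n (w : 'cV[R]_n) r : measurable [set v : 'cV[R]_n | (enorm (v + w) <= r)%R].
Proof.
rewrite (_ : [set v : 'cV[R]_n | _] = (fun v : 'cV[R]_n => enorm (v + w)) @^-1` `]-oo, r]).
  apply: measurable_preimage => //; apply: measurableT_comp; first exact: measurable_enorm.
  exact: measurable_cV_addc.
by apply/seteqP; split=> v /=; rewrite in_itv/=.
Qed.

Lemma measurable_eball n r : measurable (@eball n r).
Proof. by have := measurable_enorm_le (0 : 'cV[R]_n) r; under eq_set do rewrite addr0. Qed.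

Lemma eball0 n : @eball n 0 = [set 0%R].
Proof.
apply/seteqP; split=> v; rewrite /eball/=; last by move=> ->; rewrite enorm0.
by move=> v0; apply/eqP; rewrite -enorm_eq0 eq_le v0 enorm_ge0.
Qed.

Lemma lebesgue_cube n (a : 'cV[R]_n) h : (0 <= h)%R ->
  lebesgue_cV n (cube a h) = (h ^+ n)%:E.
Proof.
move=> h0; elim: n a => [|n IH] a.
  by rewrite /= diracE mem_set// => -[].
rewrite /= /lebesgue_cVS /pushforward.
pose J : interval R := `[a ord0 ord0, (a ord0 ord0 + h)%R[.
rewrite (_ : _ @^-1` _ = [set` J] `*` cube (uncons_cV a).2 h).
  rewrite product_measure1E//=; last exact: measurable_cube.
  rewrite IH lebesgue_measure_itv/= lte_fin ltrDl exprS EFinM.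
  case: ltP => [_|h0']; first by rewrite -EFinD addrAC subrr add0r.
  have -> : h = 0%R by apply/le_anti/andP.
  by rewrite mul0e.
apply/seteqP; split=> -[t v] /=.
  move=> vh; split; first by rewrite in_itv/=; have := vh ord0; rewrite cons_cV0.
  by move=> i /=; have := vh (lift ord0 i); rewrite cons_cVS mxE.
rewrite in_itv/= => -[th vh] i; case: (unliftP ord0 i) => [j ->|->].
  by have := vh j; rewrite cons_cVS mxE.
by rewrite cons_cV0.
Qed.

Lemma eballE n : @ball_volume R n = lebesgue_cV n (@eball n 1).
Proof. by []. Qed.

Lemma eball_sub_cube n r : (0 <= r)%R -> @eball n r `<=` cube (const_mx (- r)%R) (2 * r + 1)%R.
Proof.
move=> r0 v /= vr i; have := enorm_coord v i; rewrite mxE ler_norml => /andP[? ?].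
by move: vr; rewrite /eball/= => vr; apply/andP; split; lra.
Qed.

Lemma lebesgue_eball_lty n r : lebesgue_cV n (@eball n r) < +oo.
Proof.
have [r0|r0] := leP 0%R r.
  apply: (@le_lt_trans _ _ (lebesgue_cV n (cube (const_mx (- r)%R) (2 * r + 1)%R))).
    by apply: le_measure; rewrite ?inE; [exact: measurable_eball|exact: measurable_cube|exact: eball_sub_cube].
  by rewrite lebesgue_cube ?ltry//; lra.
rewrite (_ : eball r = set0) ?measure0//; apply/seteqP; split=> // v; rewrite /eball/= => vr.
by have := enorm_ge0 v; lra.
Qed.

Lemma cube_sub_eball n h : (0 <= h)%R ->
  cube (const_mx (- h)%R : 'cV[R]_n) (2 * h)%R `<=` eball (Num.sqrt n%:R * h)%R.
Proof.
move=> h0 v /= vh; apply: enorm_le_coord => // i; have := vh i; rewrite mxE ler_norml => /andP[? ?].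
by apply/andP; split; lra.
Qed.

Lemma ball_volume_gt0 n : 0 < @ball_volume R n.
Proof.
rewrite eballE; pose h : R := ((Num.sqrt n%:R + 1)^-1)%R.
have s0 := sqrtr_ge0 (n%:R : R).
have h0 : (0 < h)%R by rewrite invr_gt0; lra.
apply: (@lt_le_trans _ _ (lebesgue_cV n (cube (const_mx (- h)%R : 'cV[R]_n) (2 * h)%R))).
  by rewrite lebesgue_cube ?lte_fin ?exprn_gt0//; lra.
apply: le_measure; rewrite ?inE; [exact: measurable_cube|exact: measurable_eball|].
move=> v /(cube_sub_eball (ltW h0)); rewrite /eball/= => /le_trans; apply.
by rewrite ler_pdivrMr; lra.
Qed.

Lemma ball_volume_fin n : @ball_volume R n \is a fin_num.
Proof. by rewrite ge0_fin_numE ?lebesgue_eball_lty// ltW// ball_volume_gt0. Qed.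

Lemma lebesgue_eball n r : (0 < r)%R ->
  lebesgue_cV n (@eball n r) = (r ^+ n)%:E * @ball_volume R n.
Proof.
move=> r0; rewrite -(lebesgue_cV_affine 0 r0); last exact: measurable_eball.
congr (_ * lebesgue_cV n _); apply/seteqP; split=> v;
  rewrite /eball/= addr0 enormZ gtr0_norm//.
  by rewrite -ler_pdivlMl// mulVf ?gt_eqF.
by rewrite -ler_pdivlMl// mulVf ?gt_eqF.
Qed.

Lemma ge0_integral_cV_shift n (w : 'cV[R]_n) (f : 'cV[R]_n -> \bar R) :
  measurable_fun setT f -> (forall v, 0 <= f v) ->
  \int[lebesgue_cV n]_v f (v + w)%R = \int[lebesgue_cV n]_v f v.
Proof.
move=> mf f0; rewrite -(ge0_integral_cV_affine w ltr01 mf f0) expr1n mul1e.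
by apply: eq_integral => v _; rewrite scale1r.
Qed.

Lemma lebesgue_cV_shift n (w : 'cV[R]_n) (A : set 'cV[R]_n) : measurable A ->
  lebesgue_cV n [set v | A (v + w)%R] = lebesgue_cV n A.
Proof.
move=> mA; rewrite -(lebesgue_cV_affine w ltr01 mA) expr1n mul1e.
by congr (lebesgue_cV n _); apply/seteqP; split=> v /=; rewrite scale1r.
Qed.

End volumes.

(** * Linear changes of variables *)

Section linear_maps.
Context {R : realType}.
Local Open Scope ereal_scope.

Lemma integral_indicT d (T : measurableType d) (mu : {measure set T -> \bar R}) (A : set T) :
  measurable A -> \int[mu]_x (\1_A x)%:E = mu A.
Proof. by move=> mA; rewrite integral_indic// setIT. Qed.

(** Both sides compute the double integral of [E (L x)] times [B (y - L x)]: the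
   inner integral over [y] is the volume of [B], while translating [x] by
   [L^-1 y] and then [y] by [L x] exchanges the roles of the two sets. Taking
   the unit ball for [B] gives the effect of [L] on volumes without determinants. *)
Lemma lebesgue_cV_linear n (L : 'M[R]_n) (E B : set 'cV[R]_n) :
  L \in unitmx -> measurable E -> measurable B ->
  lebesgue_cV n [set v | E (L *m v)] * lebesgue_cV n B =
  lebesgue_cV n [set v | B (- (L *m v))%R] * lebesgue_cV n E.
Proof.
move=> uL mE mB.
have mL := measurable_cV_mulmx L.
pose F (p : 'cV[R]_n * 'cV[R]_n) : \bar R :=
  (\1_E (L *m p.1) * \1_B (p.2 - L *m p.1)%R)%:E.
have mLN : measurable_fun setT (fun v : 'cV[R]_n => (- (L *m v))%R).
  apply: measurable_fun_mx => i j; under eq_fun do rewrite mxE.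
  by apply: measurable_funN; exact: (measurableT_comp (measurable_mx_coord i j)).
have mF : measurable_fun setT F.
  apply/measurable_EFinP; apply: measurable_funM.
    apply: measurableT_comp; first exact: measurable_indic.
    by apply: measurableT_comp.
  apply: measurableT_comp; first exact: measurable_indic.
  apply: measurable_cV_add; first exact: measurable_snd.
  exact: (measurableT_comp mLN measurable_fst).
have F0 p : 0 <= F p by rewrite lee_fin mulr_ge0.
have := fubini_tonelli (m1 := lebesgue_cV n) (m2 := lebesgue_cV n) F mF F0.
have -> : \int[lebesgue_cV n]_x \int[lebesgue_cV n]_y F (x, y) =
    lebesgue_cV n [set v | E (L *m v)] * lebesgue_cV n B.
  under eq_integral => x _.
    under eq_integral do rewrite /F /= EFinM.
    rewrite ge0_integralZl//; last first.
    - apply/measurable_EFinP; apply: measurableT_comp; first exact: measurable_indic.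
      exact: measurable_cV_addc.
    rewrite (ge0_integral_cV_shift _ (f := fun v => (\1_B v)%:E))//; last first.
      by apply/measurable_EFinP; exact: measurable_indic.
    rewrite integral_indicT//.
    over.
  rewrite ge0_integralZr//; last first.
    by apply/measurable_EFinP; apply: measurableT_comp; first exact: measurable_indic.
  congr (_ * _); rewrite -integral_indicT//.
  exact: measurable_preimage.
have -> : \int[lebesgue_cV n]_y \int[lebesgue_cV n]_x F (x, y) =
    \int[lebesgue_cV n]_y \int[lebesgue_cV n]_x
      (\1_E (L *m x + y) * \1_B (- (L *m x)))%:E.
  apply: eq_integral => y _.
  rewrite -(ge0_integral_cV_shift (invmx L *m y) (f := fun x => F (x, y)))//; last first.
    exact: (measurableT_comp mF (measurable_pair2 y)).
  apply: eq_integral => x _; rewrite /F /= mulmxDr mulmxA mulmxV// mul1mx.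
  by rewrite opprD addrCA subrr addr0.
pose G (p : 'cV[R]_n * 'cV[R]_n) : \bar R :=
  (\1_E (L *m p.1 + p.2)%R * \1_B (- (L *m p.1))%R)%:E.
have mG : measurable_fun setT G.
  apply/measurable_EFinP; apply: measurable_funM.
    apply: measurableT_comp; first exact: measurable_indic.
    apply: measurable_cV_add; last exact: measurable_snd.
    exact: (measurableT_comp mL measurable_fst).
  apply: measurableT_comp; first exact: measurable_indic.
  exact: (measurableT_comp mLN measurable_fst).
rewrite -(fubini_tonelli (m1 := lebesgue_cV n) (m2 := lebesgue_cV n) G)//; last first.
  by move=> p; rewrite lee_fin mulr_ge0.
move=> ->; under eq_integral => x _.
  under eq_integral do rewrite /G /= mulrC EFinM.
  rewrite ge0_integralZl//; last first.
    apply/measurable_EFinP; apply: measurableT_comp; first exact: measurable_indic.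
    apply: measurable_cV_add => //; exact: measurable_cst.
  under eq_integral do rewrite addrC.
  rewrite (ge0_integral_cV_shift _ (f := fun v => (\1_E v)%:E))//; last first.
    by apply/measurable_EFinP; exact: measurable_indic.
  rewrite integral_indicT//.
  over.
rewrite ge0_integralZr//; last first.
  by apply/measurable_EFinP; apply: measurableT_comp; first exact: measurable_indic.
congr (_ * _); rewrite -integral_indicT//.
exact: measurable_preimage.
Qed.

(** The unit ball is its own image, which fixes the factor in
   [lebesgue_cV_linear] to be one. *)
Lemma lebesgue_cV_orth n (Q : 'M[R]_n) (E : set 'cV[R]_n) :
  Q^T *m Q = 1%:M -> measurable E ->
  lebesgue_cV n [set v | E (Q *m v)] = lebesgue_cV n E.
Proof.
move=> QQ mE.
have uQ : Q \in unitmx by case/mulmx1_unit: QQ.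
have := lebesgue_cV_linear uQ mE (measurable_eball (n := n) 1).
rewrite (_ : [set v | eball 1 (- (Q *m v))%R] = eball 1); last first.
  by apply/seteqP; split=> v; rewrite /eball/= enormN enorm_orth.
rewrite -eballE muleC => h; apply/le_anti/andP; split;
  by rewrite -(lee_pmul2l (ball_volume_fin n) (ball_volume_gt0 n)) h.
Qed.

(** The factor is the volume of the preimage of the unit ball, relative to that
   of the ball itself; it is the inverse of the absolute determinant. *)
Lemma lebesgue_cV_linear_scale n (L : 'M[R]_n) : L \in unitmx ->
  exists2 a : R, (0 <= a)%R & forall E, measurable E ->
   lebesgue_cV n [set v | E (L *m v)] = a%:E * lebesgue_cV n E.
Proof.
move=> uL; pose S := [set v : 'cV[R]_n | eball 1 (- (L *m v))%R].
have [M M0 SM] : exists2 M : R, (0 <= M)%R & S `<=` eball M.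
  pose K := (\sum_i \sum_j `|invmx L i j|)%R.
  have K0 : (0 <= K)%R by apply: sumr_ge0 => i _; exact: sumr_ge0.
  exists (Num.sqrt n%:R * K)%R; first by rewrite mulr_ge0// sqrtr_ge0.
  move=> v; rewrite /S /eball /= enormN => Lv1; apply: enorm_le_coord => // i.
  rewrite -[v](mulKmx uL) mxE (le_trans (ler_norm_sum _ _ _))//.
  rewrite [leRHS](bigD1 i)//=; apply: ler_wpDr; first by apply: sumr_ge0 => ? _; exact: sumr_ge0.
  apply: ler_sum => j _; rewrite normrM -[leRHS]mulr1 ler_wpM2l//.
  exact: le_trans (enorm_coord _ _) Lv1.
have mS : measurable S.
  rewrite /S (_ : [set v | _] = (fun v => L *m v) @^-1` (eball 1)); last first.
    by apply/seteqP; split=> v; rewrite /eball/= enormN.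
  by apply: measurable_preimage; [exact: measurable_cV_mulmx|exact: measurable_eball].
have Sfin : lebesgue_cV n S \is a fin_num.
  rewrite ge0_fin_numE//; apply: le_lt_trans (lebesgue_eball_lty n M).
  by apply: le_measure; rewrite ?inE//; exact: measurable_eball.
exists (fine (lebesgue_cV n S) / fine (ball_volume n))%R.
  by rewrite divr_ge0// fine_ge0// ltW// ball_volume_gt0.
move=> E mE; have := lebesgue_cV_linear uL mE (measurable_eball (n := n) 1).
rewrite -eballE -/S => h.
have b0 : (0 < fine (@ball_volume R n))%R by rewrite fine_gt0// ball_volume_gt0 ltey_eq ball_volume_fin.
rewrite mulrC EFinM -muleA (fineK Sfin) -h muleCA -[X in _ = _ * (_ * X)]fineK ?ball_volume_fin//.
by rewrite -EFinM mulVf ?gt_eqF// mule1.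
Qed.

End linear_maps.

(** * The isodiametric inequality *)

Section isodiametric.
Context {R : realType}.

(** The convex hulls of [A] and [B] are intervals that satisfy the same
   hypothesis, and [(sup A - inf B) + (sup B - inf A)] is the sum of their lengths. *)
Lemma lebesgue_separated_sets (A B : set R) (D : R) :
  measurable A -> measurable B -> A !=set0 -> B !=set0 ->
  (forall a b, A a -> B b -> `|a - b| <= D) ->
  (lebesgue_measure A + lebesgue_measure B <= (2 * D)%:E)%E.
Proof.
move=> mA mB [a0 Aa0] [b0 Bb0] AB.
have ABl a b : A a -> B b -> a <= b + D.
  by move=> Aa Bb; have := AB _ _ Aa Bb; rewrite ler_norml => /andP[? ?]; lra.
have ABr a b : A a -> B b -> b - D <= a.
  by move=> Aa Bb; have := AB _ _ Aa Bb; rewrite ler_norml => /andP[? ?]; lra.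
have supA : has_sup A by split; [exists a0|exists (b0 + D) => a Aa; exact: ABl].
have infA : has_inf A by split; [exists a0|exists (b0 - D) => a Aa; exact: ABr].
have supB : has_sup B by split; [exists b0|exists (a0 + D) => b Bb; rewrite -lerBlDr; exact: ABr].
have infB : has_inf B by split; [exists b0|exists (a0 - D) => b Bb; rewrite lerBlDr; exact: ABl].
have le_itv (C : set R) : measurable C -> has_sup C -> has_inf C -> C !=set0 ->
    (lebesgue_measure C <= (sup C - inf C)%:E)%E.
  move=> mC sC iC [c Cc].
  have ic t : C t -> inf C <= t by move=> Ct; apply: ge_inf => //; exact: iC.2.
  have cs t : C t -> t <= sup C by move=> Ct; apply: ub_le_sup => //; exact: sC.2.
  apply: (@le_trans _ _ (lebesgue_measure `[inf C, sup C]%classic)).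
    by apply: le_measure; rewrite ?inE// => t Ct; rewrite /= in_itv/= ic// cs.
  rewrite lebesgue_measure_itv/=; case: ifP => _ //.
  by rewrite lee_fin subr_ge0 (le_trans (ic _ Cc))// cs.
apply: (le_trans (leeD (le_itv A mA supA infA _) (le_itv B mB supB infB _))); [by exists a0|by exists b0|].
rewrite -EFinD lee_fin.
have h1 : sup A - D <= inf B.
  apply: lb_le_inf; first by exists b0.
  move=> b Bb; rewrite lerBlDr; apply: ge_sup; first by exists a0.
  by move=> a Aa; exact: ABl.
have h2 : sup B - D <= inf A.
  apply: lb_le_inf; first by exists a0.
  move=> a Aa; rewrite lerBlDr; apply: ge_sup; first by exists b0.
  by move=> b Bb; rewrite -lerBlDr; exact: ABr.
lra.
Qed.

Definition upd n (i : 'I_n) (t : R) (w : 'cV[R]_n) : 'cV[R]_n :=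
  \col_k (if k == i then t else w k ord0).

Definition sect n (i : 'I_n) (E : set 'cV[R]_n) (w : 'cV[R]_n) : set R :=
  [set t | E (upd i t w)].

(** The Steiner symmetral of [E] along the [i]-th axis: each section of [E] by a
   line parallel to that axis is replaced by the centred open interval of the
   same length. *)
Definition steiner n (i : 'I_n) (E : set 'cV[R]_n) : set 'cV[R]_n :=
  [set w : 'cV[R]_n | ((2 * `|w i ord0|)%:E < lebesgue_measure (sect i E w))%E].

Lemma measurable_sect n (i : 'I_n) (E : set 'cV[R]_n) (w : 'cV[R]_n) : measurable E -> measurable (sect i E w).
Proof.
move=> mE; have mu : measurable_fun [set: R] (fun t => upd i t w).
  apply: measurable_fun_mx => k j; under eq_fun do rewrite mxE.
  by case: (k == i); [exact: measurable_id|exact: measurable_cst].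
exact: (measurable_preimage mu mE).
Qed.

Lemma dot_upd n (i : 'I_n) t t' (x y : 'cV[R]_n) :
  enorm (upd i t x - upd i t' y) ^+ 2 =
  (t - t') ^+ 2 + \sum_(k < n | k != i) (x k ord0 - y k ord0) ^+ 2.
Proof.
rewrite enorm_sqr /dot (bigD1 i)//= !mxE eqxx expr2; congr (_ + _).
by apply: eq_bigr => k /negPf ki; rewrite !mxE ki expr2.
Qed.

Lemma upd_id n (i : 'I_n) (x : 'cV[R]_n) : upd i (x i ord0) x = x.
Proof. by apply/colP => k; rewrite mxE; case: eqP => [->|]. Qed.

(** On two parallel lines, [lebesgue_separated_sets] bounds the sum of the
   lengths of the sections of [E] by twice their largest distance along the axis;
   for centred intervals this sum is twice the largest distance. *)
Lemma steiner_diam n (i : 'I_n) (E : set 'cV[R]_n) d : 0 <= d -> measurable E ->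
  (forall x y, E x -> E y -> enorm (x - y) <= d) ->
  forall x y, steiner i E x -> steiner i E y -> enorm (x - y) <= d.
Proof.
move=> d0 mE Ed x y; rewrite /steiner /= => xA yB.
have mA := measurable_sect i x mE; have mB := measurable_sect i y mE.
have nonempty (w : 'cV[R]_n) : ((2 * `|w i ord0|)%:E < lebesgue_measure (sect i E w))%E ->
    sect i E w !=set0.
  move=> h; apply/set0P/eqP => h0; move: h; rewrite h0 measure0 lte_fin ltNge.
  by rewrite mulr_ge0.
have [[a Aa] [b Bb]] := (nonempty _ xA, nonempty _ yB).
pose r := \sum_(k < n | k != i) (x k ord0 - y k ord0) ^+ 2.
have ABd s t : sect i E x s -> sect i E y t -> (s - t) ^+ 2 + r <= d ^+ 2.
  by move=> As Bt; rewrite -dot_upd ler_sqr ?nnegrE ?enorm_ge0//; exact: Ed.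
have rd : 0 <= d ^+ 2 - r.
  by have := ABd _ _ Aa Bb; have := sqr_ge0 (a - b); lra.
have ABabs s t : sect i E x s -> sect i E y t -> `|s - t| <= Num.sqrt (d ^+ 2 - r).
  by move=> As Bt; rewrite -sqrtr_sqr; apply: ler_wsqrtr; have := ABd _ _ As Bt; lra.
have h := lebesgue_separated_sets mA mB (nonempty _ xA) (nonempty _ yB) ABabs.
have := lt_le_trans (lteD xA yB) h; rewrite lte_fin => h'.
rewrite -ler_sqr ?nnegrE ?enorm_ge0// -(upd_id i x) -(upd_id i y) dot_upd -/r.
rewrite -lerBrDr -(sqr_sqrtr rd) -real_normK ?num_real// ler_sqr ?nnegrE ?sqrtr_ge0//.
by have := ler_normB (x i ord0) (y i ord0); lra.
Qed.

Definition flip n (K : pred 'I_n) (v : 'cV[R]_n) : 'cV[R]_n :=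
  \col_k (if K k then - v k ord0 else v k ord0).

(** Sections of [E] over reflected points coincide when [E] is symmetric in the
   other coordinates, so the symmetries obtained along previous axes survive. *)
Lemma steiner_flip n (i : 'I_n) (E : set 'cV[R]_n) (K : pred 'I_n) :
  (forall K' : pred 'I_n, (forall k, K' k -> K k && (k != i)) -> forall v, E v -> E (flip K' v)) ->
  forall v, steiner i E v -> steiner i E (flip K v).
Proof.
move=> EK v; rewrite /steiner /= mxE.
have -> : `|if K i then - v i ord0 else v i ord0| = `|v i ord0|.
  by case: ifP; rewrite ?normrN.
suff -> : sect i E v = sect i E (flip K v) by [].
have fl t w : upd i t (flip K w) = flip (fun k => K k && (k != i)) (upd i t w).
  by apply/colP => k; rewrite !mxE; case: eqP => /=; rewrite ?andbT ?andbF.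
apply/seteqP; split=> t; rewrite /sect /=.
  by move=> Et; rewrite fl; apply: EK.
rewrite fl => /(EK (fun k => K k && (k != i))) => /(_ (fun _ h => h)).
rewrite (_ : flip _ (flip _ _) = upd i t v)//.
by apply/colP => k; rewrite /flip !mxE /=; case: (K k && (k != i)); rewrite ?opprK.
Qed.

(** Tonelli's theorem compares the two sets section by section. *)
Lemma steiner0_measure n (E : set 'cV[R]_n.+1) : measurable E ->
  measurable (steiner ord0 E) /\
  lebesgue_cV n.+1 (steiner ord0 E) = lebesgue_cV n.+1 E.
Proof.
move=> mE.
have updc t s (v : 'cV[R]_n) : upd ord0 t (cons_cV (s, v)) = cons_cV (t, v).
  apply/colP => k; case: (unliftP ord0 k) => [j ->|->].
    by rewrite mxE !cons_cVS.
  by rewrite mxE eqxx cons_cV0.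
pose m (v : 'cV[R]_n) := lebesgue_measure [set t | E (cons_cV (t, v))].
have mEc : measurable_fun setT (fun p : R * 'cV[R]_n => (\1_E (cons_cV p) : R)%:E).
  apply/measurable_EFinP; apply: measurableT_comp; first exact: measurable_indic.
  exact: measurable_cons_cV.
have secE (F : set 'cV[R]_n.+1) v :
    [set t | F (cons_cV (t, v))] = sect ord0 F (cons_cV (0, v)).
  by apply/seteqP; split=> t; rewrite /sect/= updc.
have msc v : measurable [set t | E (cons_cV (t, v))].
  by rewrite secE; exact: measurable_sect.
have mE1 v : (m v = \int[lebesgue_measure]_t (\1_E (cons_cV (t, v)))%:E)%E.
  exact: (esym (integral_indicT (@lebesgue_measure R) (msc v))).
have mm : measurable_fun setT m.
  rewrite (_ : m = fun v => \int[lebesgue_measure]_t (\1_E (cons_cV (t, v)))%:E)%E; last exact/funext.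
  by apply: (measurable_fun_fubini_tonelli_G (m1 := @lebesgue_measure R) (fun p : R * 'cV[R]_n => (\1_E (cons_cV p) : R)%:E)).
have sE t v : steiner ord0 E (cons_cV (t, v)) = ((2 * `|t|)%:E < m v)%E.
  rewrite /steiner /= cons_cV0 /sect; congr (is_true (_ < lebesgue_measure _)%E).
  by apply/seteqP; split=> s /=; rewrite updc.
have mS : measurable (steiner ord0 E).
  rewrite (_ : steiner _ _ = @uncons_cV R n @^-1` [set p | ((2 * `|p.1|)%:E < m p.2)%E]).
    apply: measurable_preimage; first exact: measurable_uncons_cV.
    rewrite -[X in measurable X]setTI.
    apply: measurable_lte => //.
      apply/measurable_EFinP; apply: measurable_funM => //.
      exact: measurableT_comp.
    exact: (measurableT_comp mm measurable_snd).
  apply/funext => w; rewrite -[w in LHS]uncons_cVK /preimage /mkset.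
  by case: (uncons_cV w) => t v; rewrite sE.
split => //.
rewrite -[LHS]integral_indicT// -[RHS]integral_indicT//.
rewrite !ge0_integral_cVS2//; [|by apply/measurable_EFinP; exact: measurable_indic
  |by apply/measurable_EFinP; exact: measurable_indic].
apply: eq_integral => v _; rewrite -mE1.
have -> : (\int[lebesgue_measure]_t (\1_(steiner ord0 E) (cons_cV (t, v)))%:E =
   lebesgue_measure [set t : R | (2 * `|t|)%:E < m v])%E.
  rewrite (_ : [set t : R | _] = [set t | steiner ord0 E (cons_cV (t, v))]); last first.
    by apply/seteqP; split=> t /=; rewrite sE.
  rewrite -integral_indicT; last by rewrite secE; exact: measurable_sect.
  exact: eq_integral.
have : (0 <= m v)%E by exact: measure_ge0.
case: (m v) => [r| |]//; rewrite ?lee_fin => r0.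
  rewrite (_ : [set t | _] = `](- (r / 2)), (r / 2)[%classic).
    rewrite lebesgue_measure_itv/= lte_fin; case: ltP => h.
      by rewrite -EFinD; congr EFin; lra.
    by congr EFin; lra.
  by apply/seteqP; split=> t /=; rewrite lte_fin in_itv/= -ltr_norml => ?; lra.
rewrite (_ : [set t | _] = setT); last by apply/seteqP; split=> t //= _; rewrite ltry.
by rewrite -set_itvNyy lebesgue_measure_itv.
Qed.

Lemma lebesgue_cV_perm n (s : {perm 'I_n}) (E : set 'cV[R]_n) : measurable E ->
  lebesgue_cV n [set v | E (row_perm s v)] = lebesgue_cV n E.
Proof.
move=> mE; rewrite -(@lebesgue_cV_orth _ _ (perm_mx s) E)//.
  by congr (lebesgue_cV n _); apply/seteqP; split=> v /=; rewrite row_permE.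
by rewrite tr_perm_mx -perm_mxM mulVg perm_mx1.
Qed.

(** Exchanging the [i]-th coordinate with the first one is an isometry. *)
Lemma steiner_measure n (i : 'I_n) (E : set 'cV[R]_n) : measurable E ->
  measurable (steiner i E) /\ lebesgue_cV n (steiner i E) = lebesgue_cV n E.
Proof.
case: n i E => [[]//|n] i E mE; pose s := tperm ord0 i.
have mrp : measurable_fun [set: 'cV[R]_n.+1] (fun v : 'cV[R]_n.+1 => row_perm s v).
  by under eq_fun do rewrite row_permE; exact: measurable_cV_mulmx.
pose F : set 'cV[R]_n.+1 := [set v | E (row_perm s v)].
have mF : measurable F by exact: (measurable_preimage mrp mE).
have [mS0 vS0] := steiner0_measure mF.
have SE : steiner i E = [set v | steiner ord0 F (row_perm s v)].
  apply/seteqP; split=> v; rewrite /steiner /= mxE tpermL;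
  (suff -> : sect i E v = sect ord0 F (row_perm s v) by []);
  apply/seteqP; split=> t; rewrite /sect /F/=;
  (suff -> : row_perm s (upd ord0 t (row_perm s v)) = upd i t v by []);
  apply/colP => k; rewrite !mxE -permM tperm2 perm1;
  by rewrite (canF_eq (tpermK _ _)) tpermL.
rewrite SE; split; first exact: (measurable_preimage mrp mS0).
by rewrite lebesgue_cV_perm// vS0 /F lebesgue_cV_perm.
Qed.

(** Symmetrizing successively along all the axes makes a set invariant under
   [v |-> - v] without increasing its diameter [d]; such a set lies in the ball
   of radius [d / 2] around the origin. *)
Lemma isodiametric n (E : set 'cV[R]_n) d : 0 < d -> measurable E ->
  (forall x y, E x -> E y -> enorm (x - y) <= d) ->
  (lebesgue_cV n E <= ball_volume n * ((d / 2) ^+ n)%:E)%E.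
Proof.
move=> d0 mE Ed.
have steps k : (k <= n)%N -> exists F, [/\ measurable F,
    lebesgue_cV n F = lebesgue_cV n E,
    (forall x y, F x -> F y -> enorm (x - y) <= d) &
    forall (K : pred 'I_n), (forall i, K i -> (i < k)%N) ->
      forall v, F v -> F (flip K v)].
  elim: k => [_|k IH kn].
    exists E; split=> // K K0 v Ev.
    suff -> : flip K v = v by [].
    by apply/colP => i; rewrite mxE; case: ifP => // /K0.
  have [F [mF vF Fd Fflip]] := IH (ltnW kn).
  pose i := Ordinal kn.
  have [mS vS] := steiner_measure i mF.
  exists (steiner i F); split=> //.
  - by rewrite vS.
  - exact: (steiner_diam (ltW d0) mF Fd).
  - move=> K Kk; apply: steiner_flip => K' K'K; apply: Fflip => j /K'K/andP[/Kk].
    by rewrite ltnS leq_eqVlt => /predU1P[ji /negP[]|//]; apply/eqP/val_inj.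
have [F [mF vF Fd Fflip]] := steps n (leqnn n).
have FB : F `<=` eball (d / 2).
  move=> v Fv; have := Fd _ _ Fv (Fflip xpredT (fun i _ => ltn_ord i) v Fv).
  have -> : flip xpredT v = - v by apply/colP => i; rewrite !mxE.
  rewrite opprK -mulr2n -scaler_nat enormZ normr_nat /eball/=; lra.
rewrite -vF muleC -lebesgue_eball; last by rewrite divr_gt0.
by apply: le_measure; rewrite ?inE//; exact: measurable_eball.
Qed.

End isodiametric.

(** * The Hausdorff measure as an outer measure *)

Section cover_infimum.
Local Open Scope ereal_scope.
Context {R : realType} {T : pointedType}.
Implicit Types (c : set T -> \bar R) (X : set T).

(** The outer measure generated by an arbitrary gauge; it is the usual extension
   of a set function, for the discrete sigma-algebra. *)
Definition cover_inf c X : \bar R :=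
  ereal_inf [set \sum_(j <oo) c (C j) | C in [set C : (set T)^nat | X `<=` \bigcup_j C j]].

Let U : measurableType _ := g_sigma_algebraType [set: set T].

Lemma cover_infE c : cover_inf c = @mu_ext _ U R c.
Proof.
apply/funext => X; congr (ereal_inf _); apply/seteqP; split=> _ [C XC <-]; exists C => //.
  by split=> // i; exact: sub_sigma_algebra.
by case: XC.
Qed.

Lemma cover_inf0 c : c set0 = 0 -> (forall X, 0 <= c X) -> cover_inf c set0 = 0.
Proof. by move=> c0 cge0; rewrite cover_infE; exact: (@mu_ext0 _ U R c). Qed.

Lemma cover_inf_ge0 c X : (forall X, 0 <= c X) -> 0 <= cover_inf c X.
Proof. by move=> cge0; rewrite cover_infE; exact: (@mu_ext_ge0 _ U R c). Qed.

Lemma le_cover_inf c : {homo cover_inf c : A B / A `<=` B >-> A <= B}.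
Proof. by rewrite cover_infE; exact: (@le_mu_ext _ U R c). Qed.

Lemma cover_inf_sigma_subadditive c : (forall X, 0 <= c X) -> sigma_subadditive (cover_inf c).
Proof. by move=> cge0; rewrite cover_infE; exact: (@mu_ext_sigma_subadditive _ U R c). Qed.

End cover_infimum.

Section outer_measure_facts.
Local Open Scope ereal_scope.
Context {R : realType} {T : Type} (mu : {outer_measure set T -> \bar R}).

Lemma outer_measure_finType (I : finType) (X : set T) (A : I -> set T) :
  X `<=` \bigcup_i A i -> mu X <= \sum_i mu (A i).
Proof.
move=> XA; apply: (@le_trans _ _ (mu (\big[setU/set0]_i A i))).
  by apply: le_outer_measure; apply: subset_trans XA _ => t [i _ Ait];
  by rewrite -bigcup_seq; exists i => //=; exact: mem_index_enum.
elim/big_ind2 : _ => [|B x C y Bx Cy|//]; first by rewrite outer_measure0.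
exact: le_trans (outer_measureU2 _ _ _) (leeD Bx Cy).
Qed.

End outer_measure_facts.

Section hausdorff_outer.
Local Open Scope ereal_scope.
Context {R : realType} {n : nat}.
Implicit Types (A : set 'cV[R]_n) (k : nat) (d : R).

Lemma ediam_ge0 A : 0 <= ediam A.
Proof. by apply: ereal_sup_ubound; left. Qed.

Lemma ediam0 : ediam (set0 : set 'cV[R]_n) = 0.
Proof.
apply/eqP; rewrite eq_le ediam_ge0 andbT; apply: ge_ereal_sup => x [->//|[y]//].
Qed.

Lemma ediam_le A d : (0 <= d)%R ->
  (ediam A <= d%:E) <-> (forall x y, A x -> A y -> (enorm (x - y) <= d)%R).
Proof.
move=> d0; split=> [Ad x y Ax Ay|Ad].
  rewrite -lee_fin; apply: le_trans Ad; apply: ereal_sup_ubound; right.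
  by exists x => //; exists y.
by apply: ge_ereal_sup => _ [->|[x Ax [y Ay <-]]]; rewrite lee_fin//; exact: Ad.
Qed.

Definition hterm k A : \bar R := @ball_volume R k * (ediam A * (2^-1)%:E) ^+ k.

(** An infinite cost excludes the sets of large diameter, which makes
   [hausdorff_pre] an instance of [cover_inf]. *)
Definition hcost k d A : \bar R := if ediam A <= d%:E then hterm k A else +oo.

Lemma hterm_ge0 k A : 0 <= hterm k A.
Proof.
rewrite /hterm mule_ge0 ?(ltW (ball_volume_gt0 _))// expe_ge0// mule_ge0 ?ediam_ge0//.
Qed.

Lemma hcost_ge0 k d A : 0 <= hcost k d A.
Proof. by rewrite /hcost; case: ifP => // _; exact: hterm_ge0. Qed.

Lemma hcost0 k d : (0 <= d)%R -> hcost k.+1 d set0 = 0.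
Proof. by move=> d0; rewrite /hcost ediam0 lee_fin d0 /hterm ediam0 mul0e expeS mul0e mule0. Qed.

Lemma hausdorff_preE k d : hausdorff_pre k d = cover_inf (hcost k d).
Proof.
apply/funext => A; apply/eqP; rewrite eq_le; apply/andP; split.
  apply: le_ereal_inf_tmp => _ [C AC <-].
  have [[j Cj]|Cd] := pselect (exists j, ~~ (ediam (C j) <= d%:E)).
    rewrite (@eseries_pinfty _ _ xpredT j) ?leey//; last by rewrite /hcost (negbTE Cj).
    by move=> i _; rewrite -ltNye (lt_le_trans _ (hcost_ge0 _ _ _)).
  have {}Cd j : ediam (C j) <= d%:E by apply/negPn/negP => h; apply: Cd; exists j.
  apply: ereal_inf_lbound; exists C => //.
  by apply: eq_eseriesr => j _; rewrite /hcost Cd.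
apply: le_ereal_inf_tmp => _ [C [AC Cd] <-]; apply: ereal_inf_lbound; exists C => //.
by apply: eq_eseriesr => j _; rewrite /hcost Cd.
Qed.

End hausdorff_outer.

Section hausdorff_measure.
Local Open Scope ereal_scope.
Context {R : realType} {n : nat}.
Implicit Types (A : set 'cV[R]_n) (k : nat) (d : {posnum R}).

Definition hpre k d : set 'cV[R]_n -> \bar R := hausdorff_pre k.+1 d%:num.

HB.instance Definition _ k d := isOuterMeasure.Build R 'cV[R]_n (hpre k d)
  (eq_ind_r (fun m => m set0 = 0) (cover_inf0 (hcost0 k (ge0 d)) (hcost_ge0 k.+1 _)) (hausdorff_preE k.+1 d%:num))
  (eq_ind_r (fun m => forall X, 0 <= m X) (fun X => cover_inf_ge0 X (hcost_ge0 k.+1 _)) (hausdorff_preE k.+1 d%:num))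
  (eq_ind_r (fun m => {homo m : A B / A `<=` B >-> A <= B}) (@le_cover_inf _ _ _) (hausdorff_preE k.+1 d%:num))
  (eq_ind_r sigma_subadditive (cover_inf_sigma_subadditive (hcost_ge0 k.+1 _)) (hausdorff_preE k.+1 d%:num)).

Lemma hpre_le_hausdorff k d A : hpre k d A <= hausdorff k.+1 A.
Proof. by apply: ereal_sup_ubound; exists d%:num => //=. Qed.

Lemma hausdorff_le k A x : (forall d, hpre k d A <= x) -> hausdorff k.+1 A <= x.
Proof.
by move=> h; apply: ge_ereal_sup => _ [d /= d0 <-]; exact: (h (PosNum d0)).
Qed.

Let hausdorff0 k : hausdorff k.+1 (set0 : set 'cV[R]_n) = 0.
Proof.
apply/eqP; rewrite eq_le; apply/andP; split.
  by apply: hausdorff_le => d; rewrite outer_measure0.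
exact: le_trans (outer_measure_ge0 _ _) (hpre_le_hausdorff k (PosNum ltr01) set0).
Qed.

Let hausdorff_ge0 k A : 0 <= hausdorff k.+1 A.
Proof.
exact: le_trans (outer_measure_ge0 _ _) (hpre_le_hausdorff k (PosNum ltr01) A).
Qed.

Let le_hausdorff k : {homo (@hausdorff R n k.+1) : A B / A `<=` B >-> A <= B}.
Proof.
move=> A B AB; apply: hausdorff_le => d.
by apply: le_trans (hpre_le_hausdorff k d B); exact: le_outer_measure.
Qed.

Let hausdorff_sigma_subadditive k : sigma_subadditive (@hausdorff R n k.+1).
Proof.
move=> F; apply: hausdorff_le => d.
apply: (le_trans (outer_measure_sigma_subadditive _ _)).
apply: lee_nneseries => i _; last exact: hpre_le_hausdorff.
by move=> _; exact: outer_measure_ge0.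
Qed.

HB.instance Definition _ k := isOuterMeasure.Build R 'cV[R]_n (@hausdorff R n k.+1)
  (hausdorff0 k) (hausdorff_ge0 k) (@le_hausdorff k) (@hausdorff_sigma_subadditive k).

Lemma hpre_diam k d A r : (0 <= r <= d%:num)%R ->
  (forall x y, A x -> A y -> (enorm (x - y) <= r)%R) ->
  hpre k d A <= ball_volume k.+1 * ((r / 2) ^+ k.+1)%:E.
Proof.
move=> /andP[r0 rd] Ar; pose C (j : nat) : set 'cV[R]_n := if j is 0%N then A else set0.
have CA j : ediam (C j) <= r%:E by apply/(ediam_le _ r0); case: j => [|j].
apply: (@le_trans _ _ (\sum_(j <oo) hterm k.+1 (C j))).
  apply: ereal_inf_lbound; exists C => //; split=> [x Ax|j]; first by exists 0%N.
  exact: le_trans (CA j) _.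
rewrite nneseries_recl//; last by move=> *; exact: hterm_ge0.
rewrite eseries_cond/= eseries0 ?adde0//; last first.
  by move=> -[|j]//= _ _; rewrite /hterm ediam0 mul0e expeS mul0e mule0.
rewrite /hterm lee_wpmul2l ?(ltW (ball_volume_gt0 _))//.
have /fineK <- : ediam A \is a fin_num.
  by rewrite ge0_fin_numE ?ediam_ge0// (le_lt_trans (CA 0%N))// ltry.
rewrite -EFinM -EFin_expe lee_fin lerXn2r ?nnegrE ?mulr_ge0 ?fine_ge0 ?ediam_ge0 ?invr_ge0//.
rewrite ler_wpM2r ?invr_ge0// -lee_fin fineK ?(CA 0%N)//.
by rewrite ge0_fin_numE ?ediam_ge0// (le_lt_trans (CA 0%N))// ltry.
Qed.

End hausdorff_measure.

(** * Hausdorff measure and volume in full dimension *)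

Section tiling.
Context {R : realType} {n : nat}.
Implicit Types (a : 'cV[R]_n) (h : R) (N : nat).

Definition subcube a h N (f : {ffun 'I_n -> 'I_N.+1}) : set 'cV[R]_n :=
  cube (a + (h / N.+1%:R) *: \col_i (f i)%:R) (h / N.+1%:R).

Lemma cube_tile a h N : 0 < h ->
  cube a h `<=` \bigcup_(f in [set: {ffun 'I_n -> 'I_N.+1}]) subcube a h f.
Proof.
move=> h0 v av; have N0 : 0 < h / N.+1%:R by rewrite divr_gt0// ltr0n.
pose q i := (v i ord0 - a i ord0) / (h / N.+1%:R).
have qN i : 0 <= q i < N.+1%:R.
  have /andP[av1 av2] := av i; rewrite divr_ge0 ?subr_ge0 ?(ltW N0)//=.
  by rewrite ltr_pdivrMr// mulrCA divff ?pnatr_eq0// mulr1 ltrBlDl.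
have trN i : (Num.truncn (q i) < N.+1)%N.
  have /andP[q0 qN'] := qN i; have /andP[tq _] := truncn_itv q0.
  by rewrite -(ltr_nat R); exact: le_lt_trans qN'.
exists [ffun i => Ordinal (trN i)] => // i; rewrite !mxE ffunE /=.
have /andP[q0 _] := qN i; have /andP[tq qt] := truncn_itv q0.
have -> : v i ord0 = a i ord0 + h / N.+1%:R * q i.
  by rewrite mulrCA divff ?gt_eqF// mulr1 addrC subrK.
rewrite lerD2l ler_pM2l// tq -addrA ltrD2l -[X in _ < _ + X]mulr1 -mulrDr ltr_pM2l//.
by rewrite natr1.
Qed.

(** All the hyperplane layers of a grid have the same number of cells. *)
Lemma card_ffun_fix N (i : 'I_n) (j : 'I_N.+1) :
  (#|[set f : {ffun 'I_n -> 'I_N.+1} | f i == j]%SET| * N.+1 = N.+1 ^ n)%N.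
Proof.
have E (j1 j2 : 'I_N.+1) : (#|[set f : {ffun 'I_n -> 'I_N.+1} | f i == j1]%SET| <=
    #|[set f : {ffun 'I_n -> 'I_N.+1} | f i == j2]%SET|)%N.
  pose g (f : {ffun 'I_n -> 'I_N.+1}) := [ffun l => if l == i then j2 else f l].
  rewrite -(@card_in_imset _ _ g).
    by apply: subset_leq_card; apply/fintype.subsetP => f /imsetP[f' _ ->]; rewrite !inE ffunE eqxx.
  move=> f1 f2; rewrite !inE => /eqP f1i /eqP f2i /ffunP f12; apply/ffunP => l.
  by have := f12 l; rewrite !ffunE; case: eqP => [->|//]; rewrite f1i f2i.
transitivity (\sum_(j' : 'I_N.+1) #|[set f : {ffun 'I_n -> 'I_N.+1} | f i == j']%SET|)%N.
  rewrite (eq_bigr (fun=> #|[set f : {ffun 'I_n -> 'I_N.+1} | f i == j]%SET|)); last first.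
    by move=> j' _; apply/eqP; rewrite eqn_leq !E.
  by rewrite sum_nat_const card_ord mulnC.
rewrite -[in RHS](card_ord N.+1) -[n in RHS]card_ord -card_ffun -sum1_card.
rewrite (partition_big (fun f : {ffun 'I_n -> 'I_N.+1} => f i) xpredT)//=.
by apply: eq_bigr => j' _; rewrite -sum1_card; apply: eq_bigl => f; rewrite !inE.
Qed.

End tiling.

Section cube_covers.
Local Open Scope ereal_scope.
Context {R : realType} {k : nat}.
Notation V := 'cV[R]_k.+1.
Implicit Types (A : set V) (e : {posnum R}).

Definition small_cube e A := exists a h, [/\ (0 <= h)%R, (h <= e%:num)%R & A = cube a h].

Definition cube_cost e A : \bar R :=
  if `[< small_cube e A >] then lebesgue_cV k.+1 A else +oo.

(** An outer approximation of the volume by cubes of side at most [e]; for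
   small [e], such cubes are admissible in the covers that define [hausdorff_pre]. *)
Definition cube_outer e : set V -> \bar R := cover_inf (cube_cost e).

Lemma cube_cost_ge0 e A : 0 <= cube_cost e A.
Proof. by rewrite /cube_cost; case: ifP. Qed.

Lemma cube_cost0 e : cube_cost e set0 = 0.
Proof.
rewrite /cube_cost ifT ?measure0//; apply/asboolP; exists 0%R, 0%R; split => //.
by apply/seteqP; split=> // v /(_ ord0); rewrite mxE; lra.
Qed.

HB.instance Definition _ e := isOuterMeasure.Build R V (cube_outer e)
  (cover_inf0 (cube_cost0 e) (cube_cost_ge0 e))
  (fun X => cover_inf_ge0 X (cube_cost_ge0 e))
  (@le_cover_inf _ _ (cube_cost e))
  (cover_inf_sigma_subadditive (cube_cost_ge0 e)).

Lemma cover_inf_le_cost (c : set V -> \bar R) A : c set0 = 0 -> (forall X, 0 <= c X) ->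
  cover_inf c A <= c A.
Proof.
move=> c0 cge0; pose C (j : nat) : set V := if j is 0%N then A else set0.
apply: (@le_trans _ _ (\sum_(j <oo) c (C j))).
  by apply: ereal_inf_lbound; exists C => // x Ax; exists 0%N.
rewrite nneseries_recl// eseries_cond/= eseries0 ?adde0//.
by move=> -[|j].
Qed.

Lemma cube_outer_cube e a h : (0 <= h)%R -> (h <= e%:num)%R ->
  cube_outer e (cube a h) <= (h ^+ k.+1)%:E.
Proof.
move=> h0 he; rewrite -(lebesgue_cube a h0).
apply: le_trans (cover_inf_le_cost _ (cube_cost0 e) (cube_cost_ge0 e)) _.
by rewrite /cube_cost ifT//; apply/asboolP; exists a, h.
Qed.

Lemma lebesgue_le_cube_outer e A : measurable A -> lebesgue_cV k.+1 A <= cube_outer e A.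
Proof.
move=> mA; apply: le_ereal_inf_tmp => _ [C AC <-].
have [[j Cj]|Cs] := pselect (exists j, ~ small_cube e (C j)).
  rewrite (@eseries_pinfty _ _ xpredT j) ?leey//.
    by move=> i _; rewrite -ltNye (lt_le_trans _ (cube_cost_ge0 _ _)).
  by rewrite /cube_cost ifF//; apply/asboolP.
have {}Cs j : small_cube e (C j) by apply: contrapT => h; apply: Cs; exists j.
have mC j : measurable (C j) by have [a [h [_ _ ->]]] := Cs j; exact: measurable_cube.
apply: (le_trans (measure_sigma_subadditive (lebesgue_cV k.+1) mC mA AC)).
apply: lee_nneseries => // j _; rewrite /cube_cost ifT//.
exact/asboolP.
Qed.

Lemma cube_outer_split e a h N (F : set V) : (0 < h)%R -> (h / N.+1%:R <= e%:num)%R ->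
  cube_outer e (cube a h `&` F) <=
  (#|[set f : {ffun 'I_k.+1 -> 'I_N.+1} | `[< subcube a h f `&` F !=set0 >] ]%SET|%:R
    * (h / N.+1%:R) ^+ k.+1)%:E.
Proof.
move=> h0 he.
apply: (@le_trans _ _ (\sum_(f : {ffun 'I_k.+1 -> 'I_N.+1}) cube_outer e (subcube a h f `&` F))).
  apply: outer_measure_finType => v [/(cube_tile N h0)[f _ fv] Fv].
  by exists f.
rewrite (bigID (fun f : {ffun 'I_k.+1 -> 'I_N.+1} => `[< subcube a h f `&` F !=set0 >]))/=.
rewrite [X in _ + X]big1 ?adde0; last first.
  move=> f /asboolPn fF; rewrite (_ : _ `&` _ = set0) ?outer_measure0//.
  by apply/seteqP; split=> // v vf; apply: fF; exists v.
apply: (@le_trans _ _ (\sum_(f : {ffun 'I_k.+1 -> 'I_N.+1} | `[< subcube a h f `&` F !=set0 >]) ((h / N.+1%:R) ^+ k.+1)%:E)).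
  apply: lee_sum => f _.
  apply: le_trans (cube_outer_cube (a + (h / N.+1%:R) *: \col_i (f i)%:R)%R _ he); last by rewrite divr_ge0// ltW.
  by apply: le_outer_measure => v [].
rewrite sumEFin lee_fin sumr_const [leRHS]mulr_natl.
by rewrite (eq_card (B := mem [set f : {ffun 'I_k.+1 -> 'I_N.+1} | `[< subcube a h f `&` F !=set0 >] ]%SET))// => f; rewrite !inE.
Qed.

Lemma cube_outer_cube_le e a h : (0 <= h)%R -> cube_outer e (cube a h) <= (h ^+ k.+1)%:E.
Proof.
rewrite le_eqVlt => /predU1P[<-|h0]; first exact: cube_outer_cube.
pose N := Num.truncn (h / e%:num).
have he : (h / N.+1%:R <= e%:num)%R.
  have h1 : (0 <= h / e%:num)%R by rewrite divr_ge0// ltW.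
  have /andP[_ h2] := truncn_itv h1.
  by rewrite ler_pdivrMr ?ltr0n// mulrC -ler_pdivrMr// ltW.
rewrite -(setIT (cube a h)); apply: (le_trans (cube_outer_split _ _ h0 he)).
rewrite lee_fin (@le_trans _ _ ((N.+1 ^ k.+1)%:R * (h / N.+1%:R) ^+ k.+1)%R)//.
  rewrite ler_wpM2r ?exprn_ge0 ?divr_ge0 ?(ltW h0)// ler_nat.
  by rewrite (leq_trans (max_card _))// card_ffun !card_ord.
by rewrite natrX -exprMn mulrCA divff ?mulr1 ?pnatr_eq0.
Qed.

(** In a fine grid of a cube, only one layer of cells can meet both the half-space
   and its complement, so counting the cells that meet either side exceeds the
   volume of the cube by an arbitrarily small amount. *)
Lemma cube_outer_halfspace e (i : 'I_k.+1) (c : R) :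
  (cube_outer e).-caratheodory [set v : V | (v i ord0 < c)%R].
Proof.
set F := [set v | _].
have cubeF a h : (0 <= h)%R -> (h <= e%:num)%R ->
    cube_outer e (cube a h `&` F) + cube_outer e (cube a h `&` ~` F) <= (h ^+ k.+1)%:E.
  rewrite le_eqVlt => /predU1P[<- _|h0 he].
    have c0 : cube a 0 = set0 by apply/seteqP; split=> // v /(_ ord0); lra.
    by rewrite c0 !set0I !outer_measure0 adde0 expr0n.
  apply/lee_addgt0Pr => r r0.
  pose N := Num.truncn (h ^+ k.+1 / r).
  have heN : (h / N.+1%:R <= e%:num)%R.
    apply: le_trans he; rewrite ler_pdivrMr ?ltr0n// ler_peMr ?(ltW h0)//.
    by rewrite ler1n.
  apply: (le_trans (leeD (cube_outer_split a F h0 heN) (cube_outer_split a (~` F) h0 heN))).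
  rewrite -EFinD lee_fin -mulrDl -natrD -cardsUI.
  set t := (h / N.+1%:R)%R; have t0 : (0 < t)%R by rewrite divr_gt0// ltr0n.
  set S := (_ :&: _)%SET.
  have Scard : (#|S| * N.+1 <= N.+1 ^ k.+1)%N.
    have [->|[f0 f0S]] := set_0Vmem S; first by rewrite cards0.
    rewrite -(card_ffun_fix i (f0 i)) leq_mul2r; apply/orP; right.
    apply: subset_leq_card; apply/fintype.subsetP => f.
    have eqf f' : f' \in S -> (a i ord0 + t * (f' i)%:R < c < a i ord0 + t * ((f' i).+1)%:R)%R.
      rewrite !inE => /andP[/asboolP[v [vf vF]] /asboolP[w [wf wF]]].
      have := vf i; have := wf i; rewrite !mxE -/t -natr1 => /andP[? ?] /andP[? ?].
      move: vF wF; rewrite /F/= => ? /negP; rewrite -leNgt => ?.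
      by apply/andP; split; lra.
    move=> fS; rewrite inE -val_eqE/= eqn_leq.
    have /andP[f1 f2] := eqf _ fS; have /andP[f3 f4] := eqf _ f0S.
    have f5 := lt_trans f1 f4; have f6 := lt_trans f3 f2.
    by move: f5 f6; rewrite !ltrD2l !ltr_pM2l// !ltr_nat !ltnS => -> ->.
  rewrite natrD mulrDl lerD//.
    apply: (@le_trans _ _ ((N.+1 ^ k.+1)%:R * t ^+ k.+1)%R).
      rewrite ler_wpM2r ?exprn_ge0 ?(ltW t0)// ler_nat.
      by rewrite (leq_trans (max_card _))// card_ffun !card_ord.
    by rewrite natrX -exprMn /t mulrCA divff ?mulr1 ?pnatr_eq0.
  apply: (@le_trans _ _ (h ^+ k.+1 / N.+1%:R)%R).
    rewrite ler_pdivlMr ?ltr0n// mulrAC -natrM.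
    have -> : (h ^+ k.+1 = (N.+1 ^ k.+1)%:R * t ^+ k.+1)%R.
      by rewrite natrX -exprMn /t mulrCA divff ?mulr1 ?pnatr_eq0.
    by rewrite ler_wpM2r ?exprn_ge0 ?(ltW t0)// ler_nat.
  have h1 : (0 <= h ^+ k.+1 / r)%R by rewrite divr_ge0 ?exprn_ge0// ltW.
  have /andP[_ h2] := truncn_itv h1.
  by rewrite ler_pdivrMr ?ltr0n// mulrC -ler_pdivrMr// ltW.
apply: le_caratheodory_measurable => X.
apply: le_ereal_inf_tmp => _ [C XC <-].
apply: (@le_trans _ _ (\sum_(j <oo) (cube_outer e (C j `&` F) + cube_outer e (C j `&` ~` F)))).
  rewrite nneseriesD; [|by move=> *; exact: outer_measure_ge0|by move=> *; exact: outer_measure_ge0].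
  apply: leeD.
    apply: (le_trans _ (outer_measure_sigma_subadditive (cube_outer e) (fun j => C j `&` F))).
    by apply: le_outer_measure; rewrite -setI_bigcupl; exact: setSI.
  apply: (le_trans _ (outer_measure_sigma_subadditive (cube_outer e) (fun j => C j `&` ~` F))).
  by apply: le_outer_measure; rewrite -setI_bigcupl; exact: setSI.
apply: lee_nneseries => [j _ _|j _]; first by rewrite adde_ge0// outer_measure_ge0.
rewrite /cube_cost; case: ifPn => [/asboolP[a [h [h0 he ->]]]|_]; last exact: leey.
by rewrite lebesgue_cube//; exact: cubeF.
Qed.

(** Half-spaces generate the measurable sets. *)
Lemma measurable_caratheodory e A : measurable A -> (cube_outer e).-caratheodory A.
Proof.
move=> mA.
have mid : measurable_fun [set: caratheodory_type (cube_outer e)] (id : caratheodory_type (cube_outer e) -> V).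
  apply: measurable_fun_mx => i j; rewrite (ord1 j).
  apply: (measurability _ (RGenInftyO.measurableE R)) => _ [_ [c ->] <-].
  rewrite setTI (_ : _ @^-1` _ = [set v : V | (v i ord0 < c)%R]).
    exact: cube_outer_halfspace.
  by apply/seteqP; split=> v /=; rewrite in_itv.
by have := mid measurableT A mA; rewrite setTI.
Qed.

(** Outer measures by small cubes agree with the volume: both are additive on a
   large cube, coincide on it, and one dominates the other. *)
Lemma cube_outerE e A a h : (0 <= h)%R -> A `<=` cube a h -> measurable A ->
  cube_outer e A = lebesgue_cV k.+1 A.
Proof.
move=> h0 AQ mA; apply/eqP; rewrite eq_le lebesgue_le_cube_outer// andbT.
have mQ : measurable (cube a h) by exact: measurable_cube.
have mQA : measurable (cube a h `\` A) by exact: measurableD.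
have := cube_outer_cube_le e a h0; rewrite -(lebesgue_cube a h0).
rewrite (measurable_caratheodory e mA) -setDE (setIidr AQ).
have {2}-> : cube a h = A `|` (cube a h `\` A) by rewrite setDUK.
rewrite measureU//; last by rewrite setDIK.
move=> H; have Qfin : lebesgue_cV k.+1 (cube a h `\` A) \is a fin_num.
  rewrite ge0_fin_numE// (@le_lt_trans _ _ (lebesgue_cV k.+1 (cube a h)))//.
    by apply: le_measure; rewrite ?inE//; exact: subDsetl.
  by rewrite lebesgue_cube// ltry.
have := le_trans (leeD2l _ (lebesgue_le_cube_outer e mQA)) H.
by rewrite leeD2rE.
Qed.

End cube_covers.

Section hausdorff_le_lebesgue.
Local Open Scope ereal_scope.
Context {R : realType} {k : nat}.
Notation V := 'cV[R]_k.+1.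
Implicit Types (A : set V) (d e : {posnum R}).

Definition cube_bound d e (M : R) := forall (a : V) h, (0 <= h)%R -> (h <= e%:num)%R ->
  hpre k d (cube a h) <= (M * h ^+ k.+1)%:E.

Lemma cube_diam (a : V) h x y : (0 <= h)%R -> cube a h x -> cube a h y ->
  (enorm (x - y) <= Num.sqrt k.+1%:R * h)%R.
Proof.
move=> h0 ax ay; apply: enorm_le_coord => // i; rewrite !mxE ler_norml.
by have /andP[? ?] := ax i; have /andP[? ?] := ay i; apply/andP; split; lra.
Qed.

(** A bound on small cubes extends to all measurable sets because volume can be
   computed with covers by small cubes. *)
Lemma cube_bound_measurable d e M : (0 < M)%R -> cube_bound d e M ->
  forall A (a : V) h, (0 <= h)%R -> A `<=` cube a h -> measurable A ->
  hpre k d A <= M%:E * lebesgue_cV k.+1 A.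
Proof.
move=> M0 SM A a h h0 AQ mA; rewrite -(cube_outerE e h0 AQ mA).
rewrite -lee_pdivrMl//; apply: le_ereal_inf_tmp => _ [C AC <-].
rewrite lee_pdivrMl// -nneseriesZl; last by move=> *; exact: cube_cost_ge0.
apply: (@le_trans _ _ (hpre k d (\bigcup_j C j))); first exact: le_outer_measure.
apply: (le_trans (outer_measure_sigma_subadditive _ _)).
apply: lee_nneseries => [j _ _|j _]; first exact: outer_measure_ge0.
rewrite /cube_cost; case: ifPn => [/asboolP[b [l [l0 le ->]]]|_].
  by rewrite lebesgue_cube// -EFinM; exact: SM.
by rewrite gt0_muley ?lte_fin// leey.
Qed.

(** The part of the volume of a cube of side [h] taken by the concentric ball of
   radius [h / 4]. *)
Let ball_ratio : R := (fine (@ball_volume R k.+1) / 4 ^+ k.+1)%R.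

Let ball_ratio_gt0 : (0 < ball_ratio)%R.
Proof.
by rewrite divr_gt0 ?exprn_gt0// fine_gt0// ball_volume_gt0 ltey_eq ball_volume_fin.
Qed.

Let ball_vol h : (0 < h)%R -> lebesgue_cV k.+1 (@eball R k.+1 (h / 4)) = (ball_ratio * h ^+ k.+1)%:E.
Proof.
move=> h0; rewrite lebesgue_eball ?divr_gt0// -(fineK (ball_volume_fin _)) -EFinM.
by congr EFin; rewrite /ball_ratio expr_div_n; ring.
Qed.

Let cball (a : V) h : set V := [set v | (enorm (v - (a + const_mx (h / 2))) <= h / 4)%R].

Let cball_sub (a : V) h : (0 < h)%R -> cball a h `<=` cube a h.
Proof.
move=> h0 v vB i; have := enorm_coord (v - (a + const_mx (h / 2)))%R i.
move=> /le_trans/(_ vB); rewrite !mxE ler_norml => /andP[? ?]; apply/andP; split; lra.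
Qed.

Let mcball (a : V) h : measurable (cball a h).
Proof. exact: measurable_enorm_le. Qed.

Let cball_vol (a : V) h : (0 < h)%R -> lebesgue_cV k.+1 (cball a h) = (ball_ratio * h ^+ k.+1)%:E.
Proof.
move=> h0; rewrite -(ball_vol h0).
exact: (lebesgue_cV_shift (- (a + const_mx (h / 2)))%R (measurable_eball (h / 4))).
Qed.

Let ball_ratio_le1 : (ball_ratio <= 1)%R.
Proof.
have : lebesgue_cV k.+1 (cball 0 1) <= lebesgue_cV k.+1 (cube 0 1).
  apply: le_measure; rewrite ?inE; [exact: mcball|exact: measurable_cube|].
  exact: cball_sub.
by rewrite lebesgue_cube// cball_vol// expr1n mulr1 lee_fin.
Qed.

(** The cost of a ball is its volume. Covering the concentric ball by itself and
   the rest of the cube at the rate [M] improves [M] to a convex combination of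
   [1] and [M]. *)
Lemma cube_bound_step d e M : (Num.sqrt k.+1%:R * e%:num <= d%:num)%R -> (0 < M)%R ->
  cube_bound d e M -> cube_bound d e (ball_ratio + M * (1 - ball_ratio)).
Proof.
move=> ed M0 SM a h; rewrite le_eqVlt => /predU1P[<- _|h0 he].
  by have := SM a 0%R (lexx _) (ge0 e); rewrite exprS mul0r !mulr0 => H; exact: H.
have s1 : (1 <= Num.sqrt k.+1%:R :> R)%R by rewrite -[leLHS]sqrtr1 ler_wsqrtr// ler1n.
have hd : (h <= d%:num)%R.
  by apply: (le_trans he); apply: (le_trans _ ed); rewrite -[leLHS]mul1r ler_wpM2r.
rewrite -(setDUK (cball_sub (a := a) h0)).
apply: (le_trans (outer_measureU2 _ _ _)).
have Bdiam x y : cball a h x -> cball a h y -> (enorm (x - y) <= h / 2)%R.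
  rewrite /cball/= => xB yB; set z := (a + _)%R in xB yB.
  rewrite (_ : x - y = (x - z) - (y - z))%R; last by rewrite opprB addrA subrK.
  by apply: (le_trans (ler_enormD _ _)); rewrite enormN; lra.
have h2d : (0 <= h / 2 <= d%:num)%R by apply/andP; split; lra.
have := hpre_diam k (d := d) h2d Bdiam; rewrite -mulrA -invfM.
rewrite (_ : 2 * 2 = 4 :> R)%R; last by ring.
rewrite muleC -lebesgue_eball ?divr_gt0// ball_vol// => HB.
have mD : measurable (cube a h `\` cball a h).
  by apply: measurableD; [exact: measurable_cube|exact: mcball].
have HD := cube_bound_measurable M0 SM (ltW h0) (@subDsetl _ (cube a h) (cball a h)) mD.
apply: le_trans (leeD HB HD) _.
have Qfin : lebesgue_cV k.+1 (cube a h) < +oo by rewrite lebesgue_cube ?ltry// ltW.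
rewrite (_ : lebesgue_cV k.+1 (_ `\` _) =
    lebesgue_cV k.+1 (cube a h) - lebesgue_cV k.+1 (cube a h `&` cball a h)); last first.
  by apply: measureD; [exact: measurable_cube|exact: mcball|exact: Qfin].
rewrite (setIidr (cball_sub h0)) cball_vol// lebesgue_cube ?(ltW h0)//.
by rewrite -EFinB -EFinM -EFinD lee_fin; lra.
Qed.

(** Iterating [cube_bound_step] from the crude bound by the diameter of the cube,
   the excess over [1] decreases geometrically. *)
Lemma cube_bound1 d e : (Num.sqrt k.+1%:R * e%:num <= d%:num)%R -> cube_bound d e 1.
Proof.
move=> ed; pose M0 : R := (fine (@ball_volume R k.+1) * (Num.sqrt k.+1%:R / 2) ^+ k.+1)%R.
have M00 : (0 <= M0)%R.
  by rewrite mulr_ge0 ?fine_ge0 ?(ltW (ball_volume_gt0 _))// exprn_ge0// divr_ge0// sqrtr_ge0.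
have SM0 : cube_bound d e (1 + M0).
  move=> a h h0 he.
  have dh : (0 <= Num.sqrt k.+1%:R * h <= d%:num)%R.
    rewrite mulr_ge0 ?sqrtr_ge0//=; apply: le_trans ed; rewrite ler_wpM2l ?sqrtr_ge0//.
  apply: le_trans (hpre_diam k dh (fun x y => @cube_diam a h x y h0)) _.
  rewrite -(fineK (ball_volume_fin _)) -EFinM lee_fin mulrDl mul1r ler_wpDl ?exprn_ge0//.
  by rewrite /M0 -[leRHS]mulrA -exprMn mulrAC.
have SMj j : cube_bound d e (1 + M0 * (1 - ball_ratio) ^+ j).
  elim: j => [|j IH]; first by rewrite expr0 mulr1.
  have := cube_bound_step ed _ IH.
  rewrite (_ : ball_ratio + (1 + M0 * (1 - ball_ratio) ^+ j) * (1 - ball_ratio) = 1 + M0 * (1 - ball_ratio) ^+ j.+1)%R.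
    by apply; rewrite ltr_wpDr// mulr_ge0// exprn_ge0// subr_ge0.
  by rewrite exprS; ring.
move=> a h h0 he; apply/lee_addgt0Pr => r r0.
have cv : (fun j => M0 * (1 - ball_ratio) ^+ j * h ^+ k.+1)%R @ \oo --> (0 : R)%R.
  rewrite -[X in _ --> X](mul0r (h ^+ k.+1)%R); apply: cvgMl.
  rewrite -[X in _ --> X](mulr0 M0); apply: cvgMr.
  by apply: cvg_expr; rewrite ger0_norm ?subr_ge0// ltrBlDr ltrDl.
have /cvgrPdist_le/(_ r r0)[j _ /(_ j (leqnn j))] := cv.
rewrite /= sub0r normrN => Hj.
apply: (le_trans (SMj j a h h0 he)); rewrite -EFinD lee_fin !mulrDl lerD2l.
exact: le_trans (ler_norm _) Hj.
Qed.

(** The constant of [cube_bound1] does not depend on the scale [d], so the bound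
   passes to the supremum over all scales. *)
Lemma hausdorff_le_lebesgue A (a : V) h : (0 <= h)%R -> A `<=` cube a h ->
  measurable A -> hausdorff k.+1 A <= lebesgue_cV k.+1 A.
Proof.
move=> h0 AQ mA; apply: hausdorff_le => d.
have s0 : (0 < Num.sqrt k.+1%:R :> R)%R by rewrite sqrtr_gt0 ltr0n.
have e0 : (0 < d%:num / Num.sqrt k.+1%:R)%R by rewrite divr_gt0.
have ed : (Num.sqrt k.+1%:R * (PosNum e0)%:num <= d%:num)%R.
  by rewrite /= mulrCA divff ?mulr1// gt_eqF.
by have := cube_bound_measurable ltr01 (cube_bound1 ed) h0 AQ mA; rewrite mul1e.
Qed.

End hausdorff_le_lebesgue.

(** * Integrals of powers *)

Section radial_integrals.
Context {R : realType}.
Local Open Scope ereal_scope.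

Lemma measurable_powR_fun (c q : R) (D : set R) :
  measurable_fun D (fun t : R => (c * t `^ q)%:E).
Proof.
apply/measurable_EFinP; apply: measurable_funM => //.
by apply: measurable_funTS; exact: measurable_powR.
Qed.

Lemma integral_powR_itv (a b q : R) : (0 < a)%R -> (a <= b)%R ->
  \int[lebesgue_measure]_(t in `[a, b]) (q * t `^ (q - 1))%:E =
  (b `^ q - a `^ q)%:E.
Proof.
move=> a0; rewrite le_eqVlt => /predU1P[<-|ab].
  by rewrite set_itv1 integral_set1 subrr.
have pos x : x \in `[a, b] -> (0 < x)%R by rewrite in_itv/= => /andP[/(lt_le_trans a0)].
have pos' x : x \in `]a, b[ -> (0 < x)%R by rewrite in_itv/= => /andP[/(lt_trans a0)].
have cpow (r x : R) : (0 < x)%R -> {for x, continuous (fun t => t `^ r)%R}.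
  move=> x0; apply: differentiable_continuous; apply/derivable1_diffP.
  by apply: derivable_powR; rewrite in_itv/= x0.
rewrite (@continuous_FTC2 _ _ (fun t => t `^ q)%R)//.
- apply: continuous_in_subspaceT => x; rewrite inE/= => /pos x0.
  by apply: cvgMr; exact: cpow.
- split.
  + by move=> x /pos' x0; apply: derivable_powR; rewrite in_itv/= x0.
  + by apply: cvg_at_right_filter; exact: cpow.
  + by apply: cvg_at_left_filter; apply: cpow; exact: lt_trans ab.
- by move=> x /pos' x0; rewrite powR_derive1// in_itv/= x0.
Qed.

(** Monotone convergence along dyadic intervals, on which the integrals of powers
   form geometric sequences. *)
Lemma integral_geometric (J : (set R)^nat) (f : R -> \bar R) (K r : R) :
  (0 <= r < 1)%R -> (forall j, measurable (J j)) ->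
  nondecreasing_seq J -> measurable_fun (\bigcup_j J j) f ->
  (forall t, (\bigcup_j J j) t -> 0 <= f t) ->
  (forall j, \int[lebesgue_measure]_(t in J j) f t = (K * (1 - r ^+ j))%:E) ->
  \int[lebesgue_measure]_(t in \bigcup_j J j) f t = K%:E.
Proof.
move=> /andP[r0 r1] mJ ndJ mf f0 Jf.
have mU : measurable (\bigcup_j J j) by exact: bigcupT_measurable.
have cv : \int[lebesgue_measure]_(x in J i) f x @[i --> \oo] -->
    \int[lebesgue_measure]_(x in \bigcup_i J i) f x.
  apply: ge0_nondecreasing_set_cvg_integral => //.
  - by move=> i; apply: measurable_funS mf => //; exact: bigcup_sup.
  - by move=> i x Jx; apply: f0; exists i.
have : \int[lebesgue_measure]_(x in J i) f x @[i --> \oo] --> K%:E.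
  under eq_fun do rewrite Jf.
  apply: cvg_EFin; first exact: nearW.
  rewrite -[X in _ --> X]mulr1; apply: cvgMr; rewrite -[X in _ --> X]subr0.
  by apply: cvgB; [exact: cvg_cst|apply: cvg_expr; rewrite ger0_norm].
by apply: cvg_unique cv.
Qed.

Lemma powR2_exp (q : R) (j : nat) : ((2 ^+ j) `^ q = (2 `^ q) ^+ j)%R.
Proof.
by rewrite -(powR_mulrn j (ler0n R 2)) -(powR_mulrn j (powR_ge0 2 q)) -!powRrM mulrC.
Qed.

Lemma powR2N_lt1 (p : R) : (0 < p)%R -> (0 <= 2 `^ (- p) < 1)%R.
Proof.
move=> p0; rewrite powR_ge0/= powRN invf_lt1 ?powR_gt0//.
rewrite -[ltLHS](powRr0 2); rewrite /powR pnatr_eq0/= ltr_expR ltr_pM2r//.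
by rewrite ln_gt0// ltr1n.
Qed.

Lemma expr2_ge (x : R) : exists j : nat, (x <= 2 ^+ j)%R.
Proof.
exists (Num.truncn `|x|).+1; apply: (le_trans (ler_norm x)).
have /andP[_ /ltW h] := truncn_itv (normr_ge0 x); apply: (le_trans h).
by rewrite -natrX ler_nat ltnW// ltn_expl.
Qed.

Lemma integral_powR_head (T q : R) : (0 < T)%R -> (0 < q)%R ->
  \int[lebesgue_measure]_(t in `]0%R, T]) (q * t `^ (q - 1))%:E = (T `^ q)%:E.
Proof.
move=> T0 q0; pose J (j : nat) : set R := `[(T / 2 ^+ j)%R, T]%classic.
have Tj0 j : (0 < T / 2 ^+ j)%R by rewrite divr_gt0// exprn_gt0.
have -> : `]0%R, T]%classic = \bigcup_j J j.
  apply/seteqP; split=> t /=.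
    rewrite in_itv/= => /andP[t0 tT]; have [j hj] := expr2_ge (T / t).
    by exists j => //; rewrite /J/= in_itv/= tT andbT ler_pdivrMr ?exprn_gt0// mulrC -ler_pdivrMr.
  move=> [j _]; rewrite /J/= !in_itv/= => /andP[h ->].
  by rewrite (lt_le_trans (Tj0 j) h).
apply: (@integral_geometric _ _ _ (2 `^ (- q))%R (powR2N_lt1 q0)).
- by move=> j; exact: measurable_itv.
- move=> i j ij; apply/subsetPset => t; rewrite /J/= !in_itv/= => /andP[h ->].
  by rewrite (le_trans _ h)// ler_pM2l// lef_pV2 ?posrE ?exprn_gt0// ler_weXn2l// ler1n.
- exact: measurable_powR_fun.
- by move=> t _; rewrite lee_fin mulr_ge0 ?powR_ge0// ltW.
- move=> j; rewrite integral_powR_itv//; last first.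
    by rewrite ler_pdivrMr ?exprn_gt0// ler_peMr ?(ltW T0)// exprn_ege1// ler1n.
  congr EFin; rewrite powRM ?(ltW T0) ?invr_ge0 ?exprn_ge0//.
  rewrite -powR_inv1 ?exprn_ge0// -powRrM mulN1r powR2_exp; ring.
Qed.

Lemma integral_powR_tail (a p : R) : (0 < a)%R -> (0 < p)%R ->
  \int[lebesgue_measure]_(t in `[a, +oo[) (p * t `^ (- p - 1))%:E = (a `^ (- p))%:E.
Proof.
move=> a0 p0; pose J (j : nat) : set R := `[a, (a * 2 ^+ j)%R]%classic.
have f0 t : 0 <= (p * t `^ (- p - 1))%:E by rewrite lee_fin mulr_ge0 ?powR_ge0// ltW.
have -> : `[a, +oo[%classic = \bigcup_j J j.
  apply/seteqP; split=> t /=; rewrite in_itv/= ?andbT.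
    move=> ta; have [j hj] := expr2_ge (t / a); exists j => //.
    by rewrite /J/= in_itv/= ta/= mulrC -ler_pdivrMr.
  by move=> [j _]; rewrite /J/= in_itv/= => /andP[].
apply: (@integral_geometric _ _ _ (2 `^ (- p))%R (powR2N_lt1 p0)).
- by move=> j; exact: measurable_itv.
- move=> i j ij; apply/subsetPset => t; rewrite /J/= !in_itv/= => /andP[-> h]/=.
  by rewrite (le_trans h)// ler_pM2l// ler_weXn2l// ler1n.
- exact: measurable_powR_fun.
- by move=> t _; exact: f0.
- move=> j; have aj : (a <= a * 2 ^+ j)%R.
    by rewrite ler_peMr ?(ltW a0)// exprn_ege1// ler1n.
  have := integral_powR_itv (- p) a0 aj.
  under eq_integral do rewrite mulNr EFinN.
  rewrite integral_ge0N//; move=> /(congr1 (fun z => - z)); rewrite oppeK => ->.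
  rewrite -EFinN; congr EFin.
  rewrite powRM ?(ltW a0) ?exprn_ge0// powR2_exp; ring.
Qed.

End radial_integrals.

(** * Polar coordinates *)

Section sphere_measure.
Context {R : realType} {m : nat}.
Local Open Scope ereal_scope.
Notation n := m.+1.
Notation V := 'cV[R]_n.

Definition unitv (v : V) : V := (enorm v)^-1 *: v.

Definition pball : set V := [set v | (0 < enorm v <= 1)%R].

Lemma measurable_unitv : measurable_fun [set: V] unitv.
Proof.
apply: measurable_fun_mx => i j; under eq_fun do rewrite mxE.
apply: measurable_funM; last exact: measurable_mx_coord.
under eq_fun do rewrite -powR_inv1 ?enorm_ge0//.
by apply: (measurableT_comp (measurable_powR (-1))); exact: measurable_enorm.
Qed.

Lemma measurable_pball : measurable pball.
Proof.
rewrite (_ : pball = (@enorm R n) @^-1` `]0%R, 1%R]).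
  by apply: measurable_preimage => //; exact: measurable_enorm.
by apply/seteqP; split=> v; rewrite /pball /= in_itv.
Qed.

Definition cone_measure : set V -> \bar R :=
  pushforward (mrestr (lebesgue_cV n) measurable_pball) unitv.

Let cone0 : cone_measure set0 = 0.
Proof. by rewrite /cone_measure; have mf := measurable_unitv; exact: measure0. Qed.

Let cone_ge0 A : 0 <= cone_measure A.
Proof. by rewrite /cone_measure; have mf := measurable_unitv; exact: measure_ge0. Qed.

Let cone_additive : semi_sigma_additive cone_measure.
Proof.
rewrite /cone_measure; have mf := measurable_unitv.
exact: measure_semi_sigma_additive.
Qed.

HB.instance Definition _ := isMeasure.Build _ _ _ cone_measure
  cone0 cone_ge0 cone_additive.

(** The normalized cone measure; it equals the surface measure on the sphere by
   [hausdorff_sphere]. *)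
Definition sphere_measure : set V -> \bar R := mscale (NngNum (ler0n R n)) cone_measure.

HB.instance Definition _ := Measure.on sphere_measure.

Lemma sphere_measureE E :
  sphere_measure E = n%:R%:E * lebesgue_cV n [set v | pball v /\ E (unitv v)].
Proof.
rewrite /sphere_measure /mscale/= /cone_measure /pushforward /mrestr.
by congr (_ * lebesgue_cV n _); apply/seteqP; split=> v /= [].
Qed.

Lemma enorm_unitv v : (0 < enorm v)%R -> enorm (unitv v) = 1%R.
Proof. by move=> v0; rewrite enormZ ger0_norm ?invr_ge0 ?ltW// mulVf ?gt_eqF. Qed.

Lemma enorm_unitvK v : (0 < enorm v)%R -> (enorm v *: unitv v = v)%R.
Proof. by move=> v0; rewrite /unitv scalerA mulfV ?gt_eqF// scale1r. Qed.

Lemma measurable_usphere : measurable (@usphere R n).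
Proof.
rewrite (_ : usphere = (@enorm R n) @^-1` [set 1%R]).
  by apply: measurable_preimage => //; exact: measurable_enorm.
by apply/seteqP; split.
Qed.

Lemma integral_indicD d (T : measurableType d) (mu : {measure set T -> \bar R})
   (D : set T) (f : T -> \bar R) :
  \int[mu]_(x in D) f x = \int[mu]_x ((\1_D x)%:E * f x).
Proof.
rewrite integral_mkcond; apply: eq_integral => x _; rewrite patchE indicE.
by case: (x \in D); rewrite ?mul1e ?mul0e.
Qed.

Lemma ge0_integral_sphere (G : V -> \bar R) : measurable_fun setT G ->
  (forall v, 0 <= G v) ->
  \int[sphere_measure]_e G e = n%:R%:E * \int[lebesgue_cV n]_(v in pball) G (unitv v).
Proof.
move=> mG G0.
transitivity (n%:R%:E * \int[cone_measure]_e G e).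
  by apply: ge0_integral_mscale => // x _; exact: G0.
apply: (congr1 (fun z => n%:R%:E * z)).
transitivity (\int[mrestr (lebesgue_cV n) measurable_pball]_v G (unitv v)).
  apply: (ge0_integral_pushforward measurable_unitv) => //.
transitivity (\int[mrestr (lebesgue_cV n) measurable_pball]_(v in setT `\` ~` pball) G (unitv v)).
  apply: ge0_negligible_integral.
  - apply: measurableC; exact: measurable_pball.
  - exact: measurableT.
  - exact: (measurableT_comp mG measurable_unitv).
  - by move=> v _; exact: G0.
  - transitivity (lebesgue_cV n (~` pball `&` pball)); first by [].
    by rewrite setICl measure0.
rewrite setTD setCK; apply: eq_measure_integral => A mA AP.
transitivity (lebesgue_cV n (A `&` pball)); first by [].
by congr (lebesgue_cV n _); exact: setIidl.
Qed.

Lemma lebesgue_cV0 : lebesgue_cV n [set (0 : V)%R] = 0.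
Proof.
have m0 : measurable [set (0 : V)%R].
  rewrite -eball0; exact: measurable_eball.
apply/eqP; rewrite eq_le measure_ge0 andbT; apply/lee_addgt0Pr => e e0.
rewrite add0e; pose h := Num.min e 1%R.
have h0 : (0 < h)%R by rewrite lt_min e0 ltr01.
apply: (@le_trans _ _ (lebesgue_cV n (cube (0 : V)%R h))).
  apply: le_measure; rewrite ?inE//; first exact: measurable_cube.
  by move=> v ->  i; rewrite !mxE lexx add0r.
rewrite lebesgue_cube ?(ltW h0)// lee_fin.
have he : (h <= e)%R by rewrite ge_min lexx.
apply: le_trans he; rewrite exprS ler_piMr ?(ltW h0)// exprn_ile1 ?(ltW h0)//.
by rewrite ge_min lexx orbT.
Qed.

Lemma sphere_measure_usphere (E : set V) : measurable E -> E `<=` ~` usphere ->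
  sphere_measure E = 0.
Proof.
move=> mE ES; rewrite sphere_measureE (_ : [set v | _] = set0) ?measure0 ?mule0//.
apply/seteqP; split=> // v [/andP[v0 _] /ES]; apply.
exact: enorm_unitv.
Qed.

Lemma sphere_measure_lty : sphere_measure setT < +oo.
Proof.
rewrite sphere_measureE lte_mul_pinfty// ?lee_fin//.
apply: le_lt_trans (lebesgue_eball_lty n 1).
apply: le_measure; rewrite ?inE; [|exact: measurable_eball|by move=> v [/andP[]]].
rewrite (_ : [set v | _] = pball); first exact: measurable_pball.
by apply/seteqP; split=> v // -[].
Qed.

(** Writing the radial integral in the variable [t = r / |v|] for each point [v]
   of the punctured unit ball and exchanging the order of integration turns the
   right-hand side into the integral of [f z] against
   [n |z|^n \int_{t >= |z|} t^(-n-1) dt = 1]. *)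
Lemma polar_coordinates (f : V -> \bar R) : measurable_fun setT f ->
  (forall v, 0 <= f v) ->
  \int[lebesgue_cV n]_v f v = \int[sphere_measure]_e
    \int[lebesgue_measure]_(r in `]0%R, +oo[) ((r ^+ m)%:E * f (r *: e)).
Proof.
move=> mf f0.
pose pos := `]0%R, +oo[%classic : set R.
have posE t : (t \in pos) = (0 < t)%R.
  by apply/idP/idP; rewrite inE /pos/= in_itv/= andbT.
pose rf (p : V * R) : \bar R := (\1_pos p.2 * p.2 ^+ m)%:E * f (p.2 *: p.1)%R.
have mscl := @measurable_cV_dilate R n.
have mind (D : set R) : measurable D -> measurable_fun setT (fun p : V * R => \1_D p.2 : R).
  by move=> mD; apply: (measurableT_comp _ measurable_snd); exact: measurable_indic.
have mrf : measurable_fun setT rf.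
  apply: emeasurable_funM; last exact: measurableT_comp.
  apply/measurable_EFinP; apply: measurable_funM; first by apply: mind; exact: measurable_itv.
  by apply: measurable_funX; exact: measurable_snd.
have rf0 p : 0 <= rf p.
  rewrite mule_ge0// lee_fin indicE; case: (boolP (p.2 \in pos)); rewrite ?mul0r// mul1r.
  by rewrite posE => /ltW p0; exact: exprn_ge0.
transitivity (\int[sphere_measure]_e \int[lebesgue_measure]_r rf (e, r)); last first.
  apply: eq_integral => e _; rewrite [RHS]integral_indicD.
  by apply: eq_integral => r _; rewrite /rf /= EFinM muleA.
rewrite ge0_integral_sphere; last 2 first.
  exact: (measurable_fun_fubini_tonelli_F (m2 := @lebesgue_measure R) rf).
  by move=> v; apply: integral_ge0 => r _; exact: rf0.
have ind0 T (D : set T) x : (0 <= \1_D x :> R)%R by [].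
(* The radial variable is [t |v|]; hence the factor [|v|^n]. *)
pose K (p : V * R) : \bar R :=
  (\1_pball p.1 * (\1_pos p.2 * (p.2 ^+ m * enorm p.1 ^+ n)))%:E * f (p.2 *: p.1)%R.
have pos_exp t j : (0 <= \1_pos t * t ^+ j :> R)%R.
  rewrite indicE; case: (boolP (t \in pos)); rewrite ?mul0r// mul1r posE.
  by move=> /ltW t0; exact: exprn_ge0.
have K0 p : 0 <= K p.
  by rewrite mule_ge0// lee_fin mulr_ge0// mulrA mulr_ge0 ?exprn_ge0 ?enorm_ge0.
have men : measurable_fun setT (fun p : V * R => enorm p.1).
  by apply: (measurableT_comp _ measurable_fst); exact: measurable_enorm.
have mK : measurable_fun setT K.
  apply: emeasurable_funM; last exact: measurableT_comp.
  apply/measurable_EFinP; apply: measurable_funM.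
    apply: (measurableT_comp _ measurable_fst); apply: measurable_indic.
    exact: measurable_pball.
  apply: measurable_funM; first by apply: mind; exact: measurable_itv.
  apply: measurable_funM; apply: measurable_funX => //; exact: measurable_snd.
transitivity (n%:R%:E * \int[lebesgue_cV n]_v \int[lebesgue_measure]_t K (v, t)); last first.
  apply: (congr1 (fun z => n%:R%:E * z)); rewrite [RHS]integral_indicD.
  apply: eq_integral => v _.
  have mKv : measurable_fun setT (fun t : R => (\1_pos t * (t ^+ m * enorm v ^+ n))%:E * f (t *: v)).
    apply: emeasurable_funM.
      apply/measurable_EFinP; apply: measurable_funM; first by apply: measurable_indic; exact: measurable_itv.
      by apply: measurable_funM => //; exact: exprn_measurable.
    exact: (measurableT_comp mf (measurableT_comp mscl (measurable_pair1 v))).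
  have Kv0 t : 0 <= (\1_pos t * (t ^+ m * enorm v ^+ n))%:E * f (t *: v).
    by rewrite mule_ge0// lee_fin mulrA mulr_ge0 ?exprn_ge0 ?enorm_ge0.
  transitivity ((\1_pball v)%:E * \int[lebesgue_measure]_t
      ((\1_pos t * (t ^+ m * enorm v ^+ n))%:E * f (t *: v))).
    rewrite -ge0_integralZl//; apply: eq_integral => t _.
    by rewrite /K /= [in LHS]EFinM -muleA.
  rewrite indicE; case: (boolP (v \in pball)) => [|_]; last by rewrite !mul0e.
  rewrite inE => -[/andP[v0 _]]; rewrite !mul1e.
  have mrfv : measurable_fun setT (fun r => rf (unitv v, r)).
    exact: (measurableT_comp mrf (measurable_pair1 _)).
  rewrite -(ge0_integral_affine 0 v0 mrfv)//.
  rewrite -ge0_integralZl//; last 2 first.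
    by apply: (measurableT_comp mrfv); apply: measurable_funD => //; exact: measurable_funM.
    by rewrite lee_fin ltW.
  apply: eq_integral => t _; rewrite /rf /= addr0.
  have -> : ((enorm v * t) *: unitv v = t *: v)%R by rewrite mulrC -scalerA enorm_unitvK.
  rewrite [RHS]muleA -EFinM; congr (_%:E * _).
  have -> : \1_pos (enorm v * t)%R = \1_pos t :> R.
    by rewrite !indicE !posE pmulr_rgt0.
  by rewrite exprMn [in LHS]exprS; ring.
rewrite (fubini_tonelli (m1 := lebesgue_cV n) (m2 := @lebesgue_measure R) K mK K0).
pose b (p : V * R) := (0 < enorm p.1)%R && (enorm p.1 <= p.2)%R.
have mb : measurable_fun setT b.
  apply: measurable_and; first exact: measurable_fun_ltr.
  by apply: measurable_fun_ler => //; exact: measurable_snd.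
pose D : set (V * R) := b @^-1` [set true].
have mD : measurable D by exact: (measurable_preimage mb).
have DE p : (\1_D p : R) = (b p)%:R.
  rewrite indicE; congr (nat_of_bool _)%:R; apply/idP/idP; first by rewrite inE.
  by move=> bp; rewrite inE.
have tpow (t : R) : (0 < t)%R -> (t `^ (- n%:R - 1) = (t ^+ n * t)^-1)%R.
  by move=> t0; rewrite -opprD powRN natr1 powR_mulrn ?(ltW t0)// [in LHS]exprSr.
(* The substitution [z = t v] turns the condition [|v| <= 1] into [|z| <= t]. *)
pose L (p : V * R) : \bar R :=
  (\1_D p * (enorm p.1 ^+ n * p.2 `^ (- n%:R - 1)))%:E * f p.1.
have L0 p : 0 <= L p.
  by rewrite mule_ge0// lee_fin mulr_ge0// mulr_ge0 ?powR_ge0// exprn_ge0// enorm_ge0.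
have mL : measurable_fun setT L.
  apply: emeasurable_funM; last exact: (measurableT_comp mf measurable_fst).
  apply/measurable_EFinP; apply: measurable_funM; first exact: measurable_indic.
  apply: measurable_funM; first exact: measurable_funX.
  exact: (measurableT_comp (measurable_powR (- n%:R - 1)) measurable_snd).
transitivity (n%:R%:E * \int[lebesgue_measure]_t \int[lebesgue_cV n]_z L (z, t)); last first.
  apply: (congr1 (fun z => n%:R%:E * z)); apply: eq_integral => t _.
  have [t0|t0] := ltP 0%R t; last first.
    rewrite !integral0_eq// => z _.
      by rewrite /K /= [\1_pos _]indicE posE ltNge t0/= mul0r mulr0 mul0e.
    rewrite /L DE /b /=; case: ltP => z0; last by rewrite mul0r mul0e.
    by rewrite leNgt (le_lt_trans t0)// mul0r mul0e.
  have mLt : measurable_fun setT (fun z => L (z, t)).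
    exact: (measurableT_comp mL (measurable_pair2 t)).
  rewrite -(ge0_integral_cV_affine 0%R t0 mLt)//.
  rewrite -ge0_integralZl//; last 2 first.
  - apply: (measurableT_comp mLt); apply: measurable_cV_add => //.
    exact: measurable_cV_scalec.
  - by rewrite lee_fin exprn_ge0// ltW.
  apply: eq_integral => v _; rewrite /L /K /= addr0 [LHS]muleA -EFinM.
  congr (_%:E * _); rewrite DE /b /= enormZ (gtr0_norm t0).
  rewrite [\1_pos _]indicE posE t0 mul1r -[X in (_ <= X)%R]mulr1 ler_pM2l// pmulr_rgt0//.
  rewrite indicE (_ : v \in pball = (0 < enorm v <= 1)%R); last first.
    by apply/idP/idP; rewrite inE.
  rewrite mulrCA; congr (_ * _)%R.
  rewrite exprMn tpow// !exprS; have tm0 : (t ^+ m != 0)%R by rewrite expf_neq0// gt_eqF.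
  by field; rewrite tm0 gt_eqF.
rewrite -(fubini_tonelli (m1 := lebesgue_cV n) (m2 := @lebesgue_measure R) L mL L0).
rewrite -ge0_integralZl; last 4 first.
- exact: measurableT.
- exact: (measurable_fun_fubini_tonelli_F (m2 := @lebesgue_measure R) L).
- by move=> z _; exact: integral_ge0.
- by rewrite lee_fin.
have m0 : measurable [set (0 : V)%R].
  rewrite -eball0; exact: measurable_eball.
have mf2 : measurable_fun setT (fun z => n%:R%:E * \int[lebesgue_measure]_t L (z, t)).
  apply: emeasurable_funM; first exact: measurable_cst.
  exact: (measurable_fun_fubini_tonelli_F (m2 := @lebesgue_measure R) L).
rewrite [LHS](ge0_negligible_integral m0)//; last exact: lebesgue_cV0.
rewrite [RHS](ge0_negligible_integral m0)//; last 2 first.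
- by move=> z _; rewrite mule_ge0// integral_ge0.
- exact: lebesgue_cV0.
apply: eq_integral => z; rewrite inE => -[_ /eqP z0].
have zpos : (0 < enorm z)%R by rewrite enorm_gt0.
have n0 : (0 < n%:R :> R)%R by rewrite ltr0n.
have := integral_powR_tail zpos n0; rewrite integral_indicD => tail.
rewrite -ge0_integralZl//; last first.
  exact: (measurableT_comp mL (measurable_pair1 z)).
transitivity ((enorm z ^+ n)%:E * f z * \int[lebesgue_measure]_t
   ((\1_(`[enorm z, +oo[%classic : set R) t)%:E * (n%:R * t `^ (- n%:R - 1))%:E)).
  rewrite tail powRN powR_mulrn ?(ltW zpos)// muleAC -EFinM divff ?mul1e//.
  by rewrite expf_neq0// gt_eqF.
rewrite -ge0_integralZl; last 4 first.
- exact: measurableT.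
- apply: emeasurable_funM; last exact: measurable_powR_fun.
  by apply/measurable_EFinP; apply: measurable_indic; exact: measurable_itv.
- by move=> t _; rewrite mule_ge0// lee_fin// mulr_ge0// powR_ge0.
- by rewrite mule_ge0// lee_fin exprn_ge0 ?enorm_ge0.
apply: eq_integral => t _; rewrite /L DE /b /= zpos /=.
rewrite indicE (_ : t \in _ = (enorm z <= t)%R); last first.
  by apply/idP/idP; rewrite inE/= in_itv/= andbT.
rewrite -EFinM muleAC -EFinM [RHS]muleA -EFinM; congr (_%:E * _); ring.
Qed.

End sphere_measure.

(** * Lipschitz maps and the central projection *)

Section lipschitz_images.
Local Open Scope ereal_scope.
Context {R : realType} {p q : nat}.

Lemma hpre_lipschitz k (d : {posnum R}) (f : 'cV[R]_p -> 'cV[R]_q) (A : set 'cV[R]_p) :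
  (forall x y, (enorm (f x - f y) <= enorm (x - y))%R) ->
  hpre k d (f @` A) <= hpre k d A.
Proof.
move=> fL; have dfC C : ediam (f @` C) <= ediam C.
  apply: ge_ereal_sup => _ [->|[_ [x Cx <-] [_ [y Cy <-] <-]]]; first exact: ediam_ge0.
  apply: (@le_trans _ _ (enorm (x - y))%:E); first by rewrite lee_fin.
  by apply: ereal_sup_ubound; right; exists x => //; exists y.
apply: le_ereal_inf_tmp => _ [C [AC Cd] <-].
apply: (@le_trans _ _ (\sum_(j <oo) hterm k.+1 (f @` C j))).
  apply: ereal_inf_lbound; exists (fun j => f @` C j) => //; split.
    by move=> _ [x /AC [j _ Cjx] <-]; exists j => //; exists x.
  by move=> j; exact: le_trans (dfC _) (Cd j).
apply: lee_nneseries => [j _ _|j _]; first exact: hterm_ge0.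
apply: lee_wpmul2l; first by rewrite ltW// ball_volume_gt0.
have h (x y : \bar R) : 0 <= x -> x <= y -> x ^+ k.+1 <= y ^+ k.+1.
  move=> x0 xy; elim: k.+1 => [//|i IH]; rewrite !expeS.
  by apply: lee_pmul => //; exact: expe_ge0.
apply: h; first by rewrite mule_ge0 ?ediam_ge0.
by rewrite lee_wpmul2r.
Qed.

Lemma hausdorff_lipschitz k (f : 'cV[R]_p -> 'cV[R]_q) (A : set 'cV[R]_p) :
  (forall x y, (enorm (f x - f y) <= enorm (x - y))%R) ->
  hausdorff k.+1 (f @` A) <= hausdorff k.+1 A.
Proof.
move=> fL; apply: hausdorff_le => d.
exact: le_trans (hpre_lipschitz _ _ _ fL) (hpre_le_hausdorff _ _ _).
Qed.

End lipschitz_images.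

Section central_projection.
Context {R : realType} {m : nat}.
Notation n := m.+1.
Notation V := 'cV[R]_n.
Notation W := 'cV[R]_m.

Lemma enormB_sqr i (u v : 'cV[R]_i) :
  enorm (u - v) ^+ 2 = enorm u ^+ 2 + enorm v ^+ 2 - 2 * dot u v.
Proof.
rewrite !enorm_sqr -scaleN1r dotDl dotZl (dotC u) (dotC v) !dotDl !dotZl (dotC v u); ring.
Qed.

(** The unit ball is convex, and normalization is the projection onto it. The
   explicit identity below has nonnegative terms by Cauchy-Schwarz. *)
Lemma unitv_lipschitz (u v : V) : 1 <= enorm u -> 1 <= enorm v ->
  enorm (unitv u - unitv v) <= enorm (u - v).
Proof.
move=> u1 v1; have u0 : 0 < enorm u by lra. have v0 : 0 < enorm v by lra.
rewrite -ler_sqr ?nnegrE ?enorm_ge0// !enormB_sqr !enorm_unitv//.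
rewrite /unitv dotZl dotC dotZl dotC.
have := dot_le_enorm u v; set a := enorm u; set b := enorm v; set d := dot u v => dab.
rewrite (_ : a^-1 * (b^-1 * d) = d / (a * b)); last by rewrite invfM; ring.
have ab0 : 0 < a * b by rewrite mulr_gt0.
have c1 : d / (a * b) <= 1 by rewrite ler_pdivrMr// mul1r.
have ab1 : 1 <= a * b by rewrite mulr_ege1.
rewrite -subr_ge0 {1}(_ : d = a * b * (d / (a * b))); last first.
  by rewrite mulrC divfK// gt_eqF.
set c := d / (a * b) in c1 *.
rewrite (_ : _ - _ = (a - b) ^+ 2 + 2 * ((a * b - 1) * (1 - c))); last by ring.
by rewrite addr_ge0 ?sqr_ge0// mulr_ge0// mulr_ge0 ?subr_ge0.
Qed.

Lemma unitvZ (c : R) (v : V) : 0 < c -> unitv (c *: v) = unitv v.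
Proof.
by move=> c0; rewrite /unitv enormZ gtr0_norm// invfM scalerA mulrAC mulVf ?gt_eqF// mul1r.
Qed.

Lemma unitv_id (v : V) : enorm v = 1 -> unitv v = v.
Proof. by move=> v1; rewrite /unitv v1 invr1 scale1r. Qed.

(** The inverse of the gnomonic projection: the tangent hyperplane at the first
   basis vector is projected to the sphere from the origin. *)
Definition gnom (y : W) : V := unitv (cons_cV (1, y)).

Lemma enorm_lift_ge1 (y : W) : 1 <= enorm (cons_cV (1, y)).
Proof.
rewrite -[leLHS]ger0_norm// -[leRHS]ger0_norm ?enorm_ge0// -ler_sqr ?nnegrE//.
by rewrite !ger0_norm ?enorm_ge0// enorm_cons expr1n lerDl sqr_ge0.
Qed.

Lemma gnom_lipschitz (y z : W) : enorm (gnom y - gnom z) <= enorm (y - z).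
Proof.
apply: le_trans (unitv_lipschitz (enorm_lift_ge1 y) (enorm_lift_ge1 z)) _.
rewrite consB subrr -ler_sqr ?nnegrE ?enorm_ge0// enorm_cons expr0n/= add0r//.
Qed.

Lemma measurable_gnom : measurable_fun [set: W] gnom.
Proof.
apply: (measurableT_comp (@measurable_unitv R m)).
have h : measurable_fun [set: W] (fun y : W => ((1 : R), y)).
  exact: measurable_fun_pair.
exact: (measurableT_comp (@measurable_cons_cV R m) h).
Qed.

Lemma gnomE (y : W) : gnom y = cons_cV ((enorm (cons_cV (1, y)))^-1, (enorm (cons_cV (1, y)))^-1 *: y).
Proof. by rewrite /gnom /unitv consZ mulr1. Qed.

Lemma enorm_cons_le1 (t : R) (w : W) : `|t| <= enorm (cons_cV (t, w)).
Proof. by have := enorm_coord (cons_cV (t, w)) ord0; rewrite cons_cV0. Qed.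

Lemma enorm_cons_le2 (t : R) (w : W) : enorm w <= enorm (cons_cV (t, w)).
Proof.
by rewrite -ler_sqr ?nnegrE ?enorm_ge0// enorm_cons lerDr sqr_ge0.
Qed.

Definition e0 : V := cons_cV (1, 0).

(** Up to the factors [|(1, y)|] and [|(1, z)|], the vectors [(1, y)] and [(1, z)]
   are the unit vectors [gnom y] and [gnom z]; these factors are the inverses of
   the first coordinates of points close to [e0], so they are at most
   [1 / (1 - rho)]. *)
Lemma gnom_expand (rho : R) (y z : W) : 0 <= rho < 1 ->
  enorm (gnom y - e0) <= rho -> enorm (gnom z - e0) <= rho ->
  enorm (y - z) <= enorm (gnom y - gnom z) / (1 - rho) ^+ 2.
Proof.
move=> /andP[r0 r1]; rewrite !gnomE /e0 !consB !subr0.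
set l := enorm (cons_cV (1, y)); set l' := enorm (cons_cV (1, z)) => hy hz.
have l1 : 1 <= l := enorm_lift_ge1 y; have l'1 : 1 <= l' := enorm_lift_ge1 z.
have l0 : 0 < l by lra. have l'0 : 0 < l' by lra.
have q0 : 0 < 1 - rho by lra.
set D := enorm (cons_cV _).
have D1 : `|l^-1 - l'^-1| <= D := enorm_cons_le1 _ _.
have D2 : enorm (l^-1 *: y - l'^-1 *: z) <= D := enorm_cons_le2 _ _.
have a1 : 1 - rho <= l^-1.
  by have := le_trans (enorm_cons_le1 _ _) hy; rewrite ler_norml => /andP[? ?]; lra.
have a'1 : 1 - rho <= l'^-1.
  by have := le_trans (enorm_cons_le1 _ _) hz; rewrite ler_norml => /andP[? ?]; lra.
have w' : enorm (l'^-1 *: z) <= rho := le_trans (enorm_cons_le2 _ _) hz.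
have lq : l <= (1 - rho)^-1 by rewrite -[l]invrK lef_pV2 ?posrE ?invr_gt0.
have l'q : l' <= (1 - rho)^-1 by rewrite -[l']invrK lef_pV2 ?posrE ?invr_gt0.
have D0 : 0 <= D := enorm_ge0 _.
have -> : y - z = l *: (l^-1 *: y - l'^-1 *: z) + (l * l' * (l'^-1 - l^-1)) *: (l'^-1 *: z).
  rewrite scalerBr !scalerA mulfV ?gt_eqF// scale1r -addrA; congr (_ + _).
  rewrite -scaleNr -scalerDl -[LHS]scaleN1r.
  congr (_ *: _); field; rewrite !gt_eqF//.
apply: (le_trans (ler_enormD _ _)).
rewrite enormZ [enorm (_ *: (l'^-1 *: z))]enormZ.
have i0 : 0 < (1 - rho)^-1 by rewrite invr_gt0.
apply: (@le_trans _ _ ((1 - rho)^-1 * D + ((1 - rho)^-1 * (1 - rho)^-1 * D) * rho)).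
  apply: lerD; first by rewrite gtr0_norm// ler_pM ?enorm_ge0// ltW.
  apply: ler_pM; [exact: normr_ge0|exact: enorm_ge0| |exact: w'].
  rewrite normrM gtr0_norm ?mulr_gt0//; apply: ler_pM => //; first by rewrite mulr_ge0// ltW.
    by apply: ler_pM => //; exact: ltW.
  by rewrite distrC.
rewrite le_eqVlt; apply/orP; left; apply/eqP; field; exact: lt0r_neq0.
Qed.

Local Open Scope ereal_scope.

Definition cone (T : R) (Y : set W) : set V :=
  [set v : V | (0 < v ord0 ord0 <= T)%R /\ Y ((v ord0 ord0)^-1 *: (uncons_cV v).2)%R].

Lemma measurable_cone T Y : measurable Y -> measurable (cone T Y).
Proof.
move=> mY.
have mY' : measurable_fun setT (fun v : V => ((v ord0 ord0) `^ (-1) *: (uncons_cV v).2)%R).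
  have h : measurable_fun setT (fun v : V => (((v ord0 ord0) `^ (-1))%R, (uncons_cV v).2)).
    apply: measurable_fun_pair.
      exact: (measurableT_comp (measurable_powR (-1)) (measurable_mx_coord _ _)).
    exact: (measurableT_comp measurable_snd (@measurable_uncons_cV R m)).
  exact: (measurableT_comp (@measurable_cV_scale R m) h).
rewrite (_ : cone T Y = [set v : V | v ord0 ord0 \in `]0%R, T]] `&`
    (fun v : V => ((v ord0 ord0) `^ (-1) *: (uncons_cV v).2)%R) @^-1` Y).
  by apply: measurableI; [exact: measurable_coord_itv|exact: measurable_preimage].
apply/seteqP; split=> v; rewrite /cone/= in_itv/= => -[/andP[v0 vT]];
  by rewrite powR_inv1 ?(ltW v0)// v0 vT.
Qed.

(** The slice of the cone at height [t] is [t Y], whose volume is [t^m] times that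
   of [Y]. *)
Lemma cone_volume T Y : (0 < T)%R -> measurable Y ->
  n%:R%:E * lebesgue_cV n (cone T Y) = (T ^+ n)%:E * lebesgue_cV m Y.
Proof.
move=> T0 mY; have mC := measurable_cone T mY.
rewrite -integral_indicT// ge0_integral_cVS//; last first.
  by apply/measurable_EFinP; exact: measurable_indic.
transitivity (n%:R%:E * \int[lebesgue_measure]_(t in `]0%R, T])
    ((t ^+ m)%:E * lebesgue_cV m Y)).
  apply: (congr1 (fun z => n%:R%:E * z)); rewrite [RHS]integral_indicD.
  apply: eq_integral => t _.
  transitivity (\int[lebesgue_cV m]_w ((\1_(`]0%R, T]%classic : set R) t)%:E *
     (\1_[set w : W | Y (t^-1 *: w)%R] w)%:E)).
    apply: eq_integral => w _; rewrite -EFinM !indicE -natrM mulnb.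
    have coneE : cone T Y (cons_cV (t, w)) = ((0 < t <= T)%R /\ Y (t^-1 *: w)%R).
      by rewrite /cone /mkset cons_cV0 cons_cVK.
    congr (nat_of_bool _)%:R%:E; apply/idP/andP.
      by rewrite !inE coneE /= in_itv.
    by rewrite !inE coneE /= in_itv.
  have mYt : measurable [set w : W | Y (t^-1 *: w)%R].
    exact: (measurable_preimage (measurable_cV_scalec t^-1) mY).
  rewrite ge0_integralZl//; last by apply/measurable_EFinP; exact: measurable_indic.
  rewrite integral_indicT// indicE; case: (boolP (t \in _)) => [|_]; last by rewrite !mul0e.
  rewrite inE/= in_itv/= => /andP[t0 _]; rewrite !mul1e.
  have ti0 : (0 < t^-1)%R by rewrite invr_gt0.
  rewrite -(lebesgue_cV_affine 0 ti0 mY) muleA -EFinM -exprMn mulfV ?gt_eqF// expr1n mul1e.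
  by congr (lebesgue_cV m _); apply/seteqP; split=> w /=; rewrite addr0.
have n0 : (0 < n%:R :> R)%R by rewrite ltr0n.
rewrite ge0_integralZr//; last 2 first.
- by apply: measurable_funTS; apply/measurable_EFinP; exact: exprn_measurable.
- by move=> t /=; rewrite in_itv/= => /andP[/ltW t0 _]; rewrite lee_fin exprn_ge0.
rewrite muleA; congr (_ * _); rewrite -(powR_mulrn n (ltW T0)) -(integral_powR_head T0 n0).
rewrite -ge0_integralZl//; last 2 first.
- by apply: measurable_funTS; apply/measurable_EFinP; exact: exprn_measurable.
- by move=> t /=; rewrite in_itv/= => /andP[/ltW t0 _]; rewrite lee_fin exprn_ge0.
apply: eq_integral => t; rewrite inE/= in_itv/= => /andP[t0 _].
by rewrite -EFinM -natr1 addrK powR_mulrn// ltW.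
Qed.

End central_projection.

(** * Comparison of the two measures on caps *)

Section reflections.
Context {R : realType} {m : nat}.
Notation n := m.+1.
Notation V := 'cV[R]_n.

Lemma trmx_mul_dot (u v : V) : u^T *m v = (dot u v)%:M.
Proof.
by rewrite [LHS]mx11_scalar mxE; congr (_%:M); apply: eq_bigr => i _; rewrite mxE.
Qed.

(** The reflection in the bisecting hyperplane of [e0] and [p]. *)
Lemma exists_reflection (p : V) : enorm p = 1 ->
  exists Q : 'M[R]_n, [/\ Q^T *m Q = 1%:M, Q *m e0 = p & Q *m p = e0].
Proof.
move=> p1; have [->|pe] := eqVneq p e0.
  by exists 1%:M; rewrite trmx1 !mul1mx.
pose w : V := p - e0; pose D := dot w w; pose a := 2 / D.
have e01 : enorm (e0 : V) = 1.
  apply/eqP; rewrite -(@eqrXn2 _ 2) ?enorm_ge0// /e0 enorm_cons enorm0 expr0n addr0 expr1n//.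
have D0 : D != 0 by rewrite /D -enorm_sqr expf_eq0/= enorm_eq0 subr_eq0.
have DE : D = 2 - 2 * dot p e0.
  by rewrite /D -enorm_sqr enormB_sqr p1 e01; ring.
pose Q : 'M[R]_n := 1%:M - a *: (w *m w^T).
have QE v : Q *m v = v - (a * dot w v) *: w.
  rewrite mulmxBl mul1mx -scalemxAl -mulmxA trmx_mul_dot mul_mx_scalar scalerA//.
have QT : Q^T = Q by rewrite /Q linearB /= linearZ /= trmx1 trmx_mul trmxK.
have dwp : a * dot w p = 1.
  have wp : dot w p = 1 - dot p e0.
    by rewrite /w -scaleN1r dotDl dotZl -enorm_sqr p1 (dotC e0) expr1n mulN1r.
  have D2 : 2 - 2 * dot p e0 != 0 by rewrite -DE.
  by rewrite wp /a DE; field.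
have Qp : Q *m p = e0 by rewrite QE dwp scale1r opprB addrCA subrr addr0.
have QQ : Q *m Q = 1%:M.
  pose P := w *m w^T.
  have PP : P *m P = D *: P.
    by rewrite /P mulmxA -(mulmxA w) trmx_mul_dot mul_mx_scalar -scalemxAl.
  rewrite /Q -/P mulmxBl mul1mx mulmxBr mulmx1 -scalemxAl -scalemxAr PP !scalerA.
  rewrite -addrA -opprD [X in 1%:M - X](_ : _ = 0) ?subr0//.
  rewrite addrA -scalerDl -scalerBl (_ : a + a - _ = 0) ?scale0r//.
  have -> : a * a * D = a * (a * D) by rewrite mulrA.
  by rewrite (_ : a * D = 2) ?/a ?divfK//; ring.
exists Q; rewrite QT; split => //.
by rewrite -Qp mulmxA QQ mul1mx.
Qed.

End reflections.

Section grids.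
Context {R : realType} {n : nat}.
Notation V := 'cV[R]_n.

Definition gridcell (N : nat) (z : 'cV[int]_n) : set V :=
  cube (N.+1%:R^-1 *: \col_i (z i ord0)%:~R) N.+1%:R^-1.

Lemma gridcellP N z v : gridcell N z v <-> forall i, Num.floor (N.+1%:R * v i ord0) = z i ord0.
Proof.
have N0 : 0 < N.+1%:R :> R by rewrite ltr0n.
have E i : ((N.+1%:R^-1 *: \col_i (z i ord0)%:~R : V) i ord0 <= v i ord0 <
   (N.+1%:R^-1 *: \col_i (z i ord0)%:~R : V) i ord0 + N.+1%:R^-1) =
   ((z i ord0)%:~R <= N.+1%:R * v i ord0 < (z i ord0 + 1)%:~R).
  rewrite !mxE -[X in _ < _ + X]mulr1 -mulrDr.
  by rewrite ler_pdivrMl// ltr_pdivlMl// intrD.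
split=> vz i; first by apply: floor_def; rewrite -E; exact: vz.
by rewrite E -vz floor_itv.
Qed.

Lemma gridcell_cover N (v : V) : exists z, gridcell N z v.
Proof.
by exists (\col_i Num.floor (N.+1%:R * v i ord0)); apply/gridcellP => i; rewrite mxE.
Qed.

Lemma gridcell_inj N z z' (v : V) : gridcell N z v -> gridcell N z' v -> z = z'.
Proof.
move=> /gridcellP vz /gridcellP vz'; apply/colP => i.
by rewrite -vz -vz'.
Qed.

Lemma measurable_gridcell N z : measurable (gridcell N z).
Proof. exact: measurable_cube. Qed.

End grids.

Section hulls.
Context {R : realType} {k : nat}.
Notation V := 'cV[R]_k.+1.

Lemma archi_inv (K e : R) : 0 < e -> exists N : nat, K * N.+1%:R^-1 <= e.
Proof.
move=> e0; exists (Num.truncn `|K / e|).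
have /andP[_ /ltW h] := truncn_itv (normr_ge0 (K / e)).
rewrite ler_pdivrMr ?ltr0n// mulrC -ler_pdivrMr//.
exact: le_trans (ler_norm _) h.
Qed.

(** A measurable set between [C] and its closure; it replaces the arbitrary sets
   of a cover by measurable ones of the same diameter. *)
Definition grid_hull (C : set V) : set V :=
  \bigcap_N \bigcup_(z in [set z | gridcell N z `&` C !=set0]) gridcell N z.

Lemma measurable_grid_hull C : measurable (grid_hull C).
Proof.
apply: bigcapT_measurable => N; rewrite bigcup_mkcond.
apply: countable_bigcupT_measurable => [|z]; first exact: countableP.
by case: ifP => _; [exact: measurable_gridcell|exact: measurable0].
Qed.

Lemma sub_grid_hull C : C `<=` grid_hull C.
Proof.
move=> v Cv N _; have [z vz] := gridcell_cover N v.
by exists z => //; exists v.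
Qed.

Lemma grid_hull_diam C d : 0 <= d ->
  (forall x y, C x -> C y -> enorm (x - y) <= d) ->
  forall x y, grid_hull C x -> grid_hull C y -> enorm (x - y) <= d.
Proof.
move=> d0 Cd x y Cx Cy; apply/ler_addgt0Pr => e e0.
have [N HN] := archi_inv (2 * Num.sqrt k.+1%:R) e0.
have [z [x' [zx' Cx']] zx] := Cx N Logic.I.
have [z' [y' [zy' Cy']] zy] := Cy N Logic.I.
have N0 : 0 <= N.+1%:R^-1 :> R by rewrite invr_ge0.
have h1 := cube_diam N0 zx zx'; have h2 := cube_diam N0 zy' zy.
rewrite (_ : x - y = (x - x') + ((x' - y') + (y' - y))); last first.
  by rewrite !addrA !subrK.
apply: (le_trans (ler_enormD _ _)).
apply: (le_trans (lerD (lexx _) (ler_enormD _ _))).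
move: (Cd _ _ Cx' Cy') HN h1 h2; rewrite -mulrA.
by move: (Num.sqrt _ * _) => c; lra.
Qed.

Lemma isodiametric_ge0 (E : set V) d : 0 <= d -> measurable E ->
  (forall x y, E x -> E y -> enorm (x - y) <= d) ->
  (lebesgue_cV k.+1 E <= ball_volume k.+1 * ((d / 2) ^+ k.+1)%:E)%E.
Proof.
rewrite le_eqVlt => /predU1P[<-|d0]; last exact: isodiametric.
move=> mE E0; rewrite mul0r expr0n/= mule0.
have [->|/set0P[x Ex]] := eqVneq E set0; first by rewrite measure0.
apply: (@le_trans _ _ (lebesgue_cV k.+1 [set v | E (v + x)])).
  by rewrite lebesgue_cV_shift.
rewrite -(@lebesgue_cV0 R k); apply: le_measure; rewrite ?inE.
- exact: (measurable_preimage (measurable_cV_addc x) mE).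
- by rewrite -eball0; exact: measurable_eball.
- move=> v /= Ev; apply/eqP; rewrite -enorm_eq0 eq_le enorm_ge0 andbT.
  by have := E0 _ _ Ev Ex; rewrite addrK.
Qed.

End hulls.

Section caps.
Context {R : realType} {k : nat}.
Local Open Scope ereal_scope.
Notation m := k.+1.
Notation n := k.+2.
Notation V := 'cV[R]_n.
Notation W := 'cV[R]_m.
Implicit Types (E : set V) (Q : 'M[R]_n).

Lemma sphere_measure_orth Q E : Q^T *m Q = 1%:M -> measurable E ->
  sphere_measure [set v | E (Q *m v)] = sphere_measure E.
Proof.
move=> QQ mE; rewrite !sphere_measureE; apply: (congr1 (fun z => n%:R%:E * z)).
have mC : measurable [set v : V | pball v /\ E (unitv v)].
  apply: measurableI; first exact: measurable_pball.
  exact: (measurable_preimage (@measurable_unitv R m) mE).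
rewrite -(lebesgue_cV_orth QQ mC); congr (lebesgue_cV n _).
by apply/seteqP; split=> v; rewrite /pball/= enorm_orth// /unitv enorm_orth// scalemxAr.
Qed.

Section cap0.
Variables (E : set V) (rho : R).
Hypotheses (mE : measurable E) (ES : E `<=` usphere).
Hypotheses (r01 : (0 <= rho < 1)%R) (Erho : forall e, E e -> (enorm (e - e0) <= rho)%R).

Let Y : set W := gnom @^-1` E.

Let mY : measurable Y. Proof. exact: (measurable_preimage (@measurable_gnom R m) mE). Qed.

Let q0 : (0 < 1 - rho)%R. Proof. by case/andP: r01; lra. Qed.

Let E0 e : E e -> (1 - rho <= e ord0 ord0)%R.
Proof.
move=> Ee; have := enorm_coord (e - e0)%R ord0; rewrite mxE [(- e0)%R _ _]mxE /e0 cons_cV0.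
move=> /le_trans/(_ (Erho Ee)); rewrite ler_norml => /andP[? ?]; lra.
Qed.

Let gnomK (e : V) : (0 < e ord0 ord0)%R -> gnom ((e ord0 ord0)^-1 *: (uncons_cV e).2)%R = unitv e.
Proof.
move=> e00; rewrite /gnom -(@unitvZ _ _ (e ord0 ord0) (cons_cV (1%R, _)))// consZ mulr1.
by rewrite scalerA mulfV ?gt_eqF// scale1r -[in RHS](uncons_cVK e).
Qed.

(** Normalizing a vector of the punctured ball keeps it in the cone over the
   chart, and its first coordinate is at most [1]. *)
Lemma sphere_le_chart : sphere_measure E <= lebesgue_cV m Y.
Proof.
rewrite sphere_measureE; have := cone_volume ltr01 mY; rewrite expr1n mul1e => <-.
apply: lee_wpmul2l; first by rewrite lee_fin ler0n.
apply: le_measure; rewrite ?inE.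
- apply: measurableI; first exact: measurable_pball.
  exact: (measurable_preimage (@measurable_unitv R m) mE).
- exact: measurable_cone.
move=> v [/andP[v0 v1] Ev].
have v00 : (0 < v ord0 ord0)%R.
  rewrite -(enorm_unitvK v0) mxE mulr_gt0//; exact: lt_le_trans q0 (E0 Ev).
split; first by rewrite v00 (le_trans _ v1)// (le_trans (ler_norm _))// enorm_coord.
by rewrite /Y /preimage /mkset gnomK.
Qed.

(** Conversely, the points of [E] have a first coordinate at least [1 - rho], so
   the cone of height [1 - rho] over the chart stays in the unit ball. *)
Lemma chart_le_sphere : ((1 - rho) ^+ n)%:E * lebesgue_cV m Y <= sphere_measure E.
Proof.
rewrite sphere_measureE -(cone_volume q0 mY).
apply: lee_wpmul2l; first by rewrite lee_fin ler0n.
apply: le_measure; rewrite ?inE.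
- exact: measurable_cone.
- apply: measurableI; first exact: measurable_pball.
  exact: (measurable_preimage (@measurable_unitv R m) mE).
move=> v [/andP[v0 v1]]; rewrite /Y /preimage /mkset gnomK// => Ev.
have vpos : (0 < enorm v)%R.
  by apply: lt_le_trans (enorm_coord v ord0); rewrite normr_gt0 gt_eqF.
split=> //; rewrite /pball/= vpos /=.
move: v1; rewrite -{1}(enorm_unitvK vpos) mxE => h.
have := le_trans (ler_wpM2l (ltW vpos) (E0 Ev)) h.
by rewrite -[leRHS]mul1r ler_pM2r.
Qed.

Lemma chart_diam d : (forall x y, E x -> E y -> (enorm (x - y) <= d)%R) ->
  forall y z, Y y -> Y z -> (enorm (y - z) <= d / (1 - rho) ^+ 2)%R.
Proof.
move=> Ed y z Yy Yz; apply: (le_trans (gnom_expand r01 (Erho Yy) (Erho Yz))).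
by rewrite ler_wpM2r ?invr_ge0 ?exprn_ge0 ?(ltW q0)//; exact: Ed.
Qed.

(** The isodiametric inequality in the chart, where diameters are almost those on
   the sphere. *)
Lemma sphere_le_diam0 d : (0 <= d)%R -> (forall x y, E x -> E y -> (enorm (x - y) <= d)%R) ->
  sphere_measure E <= ball_volume m * ((d / (1 - rho) ^+ 2 / 2) ^+ m)%:E.
Proof.
move=> d0 Ed; apply: (le_trans sphere_le_chart); apply: isodiametric_ge0 => //.
  by rewrite divr_ge0// exprn_ge0// ltW.
exact: chart_diam.
Qed.

(** The chart is mapped to [E] by a map of Lipschitz constant [1], which does not
   increase the Hausdorff measure, and in the chart the Hausdorff measure is at
   most the volume. *)
Lemma hausdorff_le_sphere0 : ((1 - rho) ^+ n)%:E * hausdorff m E <= sphere_measure E.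
Proof.
apply: le_trans chart_le_sphere; apply: lee_wpmul2l.
  by rewrite lee_fin exprn_ge0// ltW.
apply: (@le_trans _ _ (hausdorff m (gnom @` Y))).
  apply: le_outer_measure => e Ee.
  have e00 : (0 < e ord0 ord0)%R by exact: lt_le_trans q0 (E0 Ee).
  have gE := gnomK e00; rewrite (unitv_id (ES Ee)) in gE.
  by exists ((e ord0 ord0)^-1 *: (uncons_cV e).2)%R => //; rewrite /Y /preimage /mkset gE.
apply: (le_trans (hausdorff_lipschitz _ _ (@gnom_lipschitz R m))).
have [->|/set0P[y0 Yy0]] := eqVneq Y set0.
  by rewrite outer_measure0 measure_ge0.
pose M : R := (enorm y0 + 2 / (1 - rho) ^+ 2)%R.
have M0 : (0 <= M)%R by rewrite addr_ge0 ?enorm_ge0// divr_ge0// exprn_ge0// ltW.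
have M1 : (0 <= 2 * M + 1)%R by lra.
apply: (hausdorff_le_lebesgue M1 _ mY) => y Yy.
apply: (eball_sub_cube M0); rewrite /eball/=.
rewrite -(subrK y0 y) addrC; apply: (le_trans (ler_enormD _ _)); rewrite lerD2l.
apply: (chart_diam (d := 2%R) _ Yy Yy0) => e e' Ee Ee'.
apply: (le_trans (ler_enormD _ _)); rewrite enormN.
by have := ES Ee; have := ES Ee'; rewrite /usphere/= => -> ->.
Qed.

End cap0.

(** Both measures are invariant under isometries, so a cap around [p] can be moved
   to one around [e0]. *)
Lemma cap_rotate E (p : V) rho : (forall e, E e -> (enorm (e - p) <= rho)%R) ->
  enorm p = 1%R -> measurable E -> E `<=` usphere ->
  exists Q, let F := [set v | E (Q *m v)] in
   [/\ Q^T *m Q = 1%:M, measurable F, F `<=` usphere,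
     (forall e, F e -> (enorm (e - e0) <= rho)%R) & E = (fun v => Q *m v) @` F].
Proof.
move=> Erho p1 mE ES; have [Q [QQ Qe Qp]] := exists_reflection p1.
exists Q; split=> //.
- exact: (measurable_preimage (measurable_cV_mulmx Q) mE).
- by move=> v /ES; rewrite /usphere/= enorm_orth.
- by move=> e /Erho; rewrite -Qe -mulmxBr enorm_orth.
- have QQ' : Q *m Q^T = 1%:M by apply/mulmx1C.
  apply/seteqP; split=> [e Ee|_ [v Ev <-]//].
  by exists (Q^T *m e); rewrite /= mulmxA QQ' mul1mx.
Qed.

Lemma sphere_le_diam E (p : V) rho d : (0 <= rho < 1)%R ->
  (forall e, E e -> (enorm (e - p) <= rho)%R) ->
  enorm p = 1%R -> measurable E -> E `<=` usphere ->
  (0 <= d)%R -> (forall x y, E x -> E y -> (enorm (x - y) <= d)%R) ->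
  sphere_measure E <= ball_volume m * ((d / (1 - rho) ^+ 2 / 2) ^+ m)%:E.
Proof.
move=> r01 Erho p1 mE ES d0 Ed.
have [Q [QQ mF FS Frho _]] := cap_rotate Erho p1 mE ES.
rewrite -(sphere_measure_orth QQ mE); apply: (sphere_le_diam0 mF r01 Frho d0).
by move=> x y Fx Fy; rewrite -(enorm_orth _ QQ) mulmxBr; exact: Ed.
Qed.

Lemma hausdorff_le_sphere E (p : V) rho : (0 <= rho < 1)%R ->
  (forall e, E e -> (enorm (e - p) <= rho)%R) ->
  enorm p = 1%R -> measurable E -> E `<=` usphere ->
  ((1 - rho) ^+ n)%:E * hausdorff m E <= sphere_measure E.
Proof.
move=> r01 Erho p1 mE ES.
have [Q [QQ mF FS Frho EF]] := cap_rotate Erho p1 mE ES.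
rewrite -(sphere_measure_orth QQ mE).
apply: le_trans (hausdorff_le_sphere0 mF FS r01 Frho).
apply: lee_wpmul2l; first by case/andP: r01 => r0 r1; rewrite lee_fin exprn_ge0// subr_ge0 ltW.
rewrite {1}EF; apply: hausdorff_lipschitz => x y.
by rewrite -mulmxBr enorm_orth.
Qed.

End caps.

(** * The Hausdorff measure of the sphere is the cone measure *)

Section hausdorff_sphere.
Context {R : realType} {k : nat}.
Local Open Scope ereal_scope.
Notation m := k.+1.
Notation n := k.+2.
Notation V := 'cV[R]_n.
Implicit Types (E : set V).

(** Bernoulli's inequality. *)
Lemma expr_close1 (r : R) N : (0 < r < 1)%R ->
  exists2 d : R, (0 < d < 1)%R & (r <= (1 - d) ^+ N)%R.
Proof.
move=> /andP[r0 r1]; pose d : R := ((1 - r) / N.+1%:R)%R.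
have N0 : (0 < N.+1%:R :> R)%R by rewrite ltr0n.
have d0 : (0 < d)%R by rewrite divr_gt0// subr_gt0.
have dr : (d <= 1 - r)%R.
  by rewrite ler_pdivrMr// ler_peMr ?subr_ge0 ?(ltW r1)// ler1n.
exists d; first by rewrite d0/=; lra.
have bern i : (1 - i%:R * d <= (1 - d) ^+ i)%R.
  elim: i => [|i IH]; first by rewrite mul0r subr0 expr0.
  rewrite exprS -natr1 mulrDl mul1r.
  have q0 : (0 <= 1 - d)%R by lra.
  apply: le_trans (ler_wpM2l q0 IH).
  have id2 : (0 <= i%:R * d * d)%R := mulr_ge0 (mulr_ge0 (ler0n _ _) (ltW d0)) (ltW d0).
  rewrite mulrBr mulr1 mulrBl mul1r; lra.
apply: le_trans (bern N); rewrite lerBrDr addrC -lerBrDr.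
rewrite /d mulrCA ler_piMr ?subr_ge0 ?(ltW r1)//.
by rewrite ler_pdivrMr// mul1r ler_nat.
Qed.

(** In a cover by sets of diameter at most [d], each set meets the sphere inside a
   cap of radius [d], and [sphere_le_diam] bounds the cone measure of its trace by its
   cost up to a factor that tends to [1] with [d]. *)
Lemma sphere_le_hausdorff E : measurable E -> E `<=` usphere ->
  sphere_measure E <= hausdorff m E.
Proof.
move=> mE ES; apply/lee_mul01Pr; first exact: measure_ge0.
move=> r r01; have [d d01 rd] := expr_close1 (m * 2) r01.
have /andP[d0 d1] := d01.
have q0 : (0 < (1 - d) ^+ (m * 2))%R by rewrite exprn_gt0// subr_gt0.
apply: (le_trans _ (hpre_le_hausdorff k (PosNum d0) E)).
apply: (@le_trans _ _ (((1 - d) ^+ (m * 2))%:E * sphere_measure E)).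
  apply: lee_wpmul2r; first exact: measure_ge0.
  by rewrite lee_fin.
apply: le_ereal_inf_tmp => _ [C [EC Cd] <-].
pose K j := grid_hull (C j) `&` E.
have mK j : measurable (K j) by apply: measurableI => //; exact: measurable_grid_hull.
have EK : E `<=` \bigcup_j K j.
  by move=> e Ee; have [j _ Cje] := EC _ Ee; exists j => //; split=> //; exact: sub_grid_hull.
have KE : sphere_measure E <= \sum_(j <oo) sphere_measure (K j).
  exact: (measure_sigma_subadditive sphere_measure mK mE EK).
apply: (le_trans (lee_wpmul2l _ KE)); first by rewrite lee_fin ltW.
rewrite -nneseriesZl; last by move=> j _; exact: measure_ge0.
apply: lee_nneseries => [j _ _|j _].
  by rewrite mule_ge0 ?measure_ge0// lee_fin ltW.
have [->|/set0P[p [Cp Ep]]] := eqVneq (K j) set0.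
  by rewrite measure0 mule0; exact: hterm_ge0.
have Cfin : ediam (C j) \is a fin_num.
  by rewrite ge0_fin_numE ?ediam_ge0// (le_lt_trans (Cd j))// ltry.
pose dj : R := fine (ediam (C j)).
have dj0 : (0 <= dj)%R by rewrite fine_ge0// ediam_ge0.
have Cdj x y : C j x -> C j y -> (enorm (x - y) <= dj)%R.
  by apply: (ediam_le _ dj0).1; rewrite fineK.
have Kdj x y : K j x -> K j y -> (enorm (x - y) <= dj)%R.
  by move=> [Kx _] [Ky _]; exact: (grid_hull_diam dj0 Cdj Kx Ky).
have djd : (dj <= d)%R by rewrite -lee_fin fineK//; exact: Cd.
have Kp e : K j e -> (enorm (e - p) <= d)%R.
  by move=> Ke; apply: le_trans djd; apply: Kdj.
have d01' : (0 <= d < 1)%R by rewrite (ltW d0).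
have KS : K j `<=` usphere by move=> e [_ /ES].
have := sphere_le_diam d01' Kp (ES _ Ep) (mK j) KS dj0 Kdj.
move=> /(lee_wpmul2l (x := ((1 - d) ^+ (m * 2))%:E)) -/(_ _) h.
apply: (le_trans (h _)); first by rewrite lee_fin ltW.
rewrite muleCA -EFinM /hterm -(fineK Cfin) -/dj -EFinM -EFin_expe.
apply: lee_wpmul2l; first by rewrite ltW// ball_volume_gt0.
rewrite lee_fin mulnC exprM -exprMn le_eqVlt; apply/orP; left; apply/eqP.
by congr (_ ^+ _)%R; field; rewrite subr_eq0 gt_eqF.
Qed.

(** Cutting [E] along a fine grid gives countably many pieces contained in small
   caps, to which [hausdorff_le_sphere] applies; over these pieces the cone measure
   is additive and the Hausdorff measure subadditive. *)
Lemma hausdorff_le_sphere_measure E : measurable E -> E `<=` usphere ->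
  hausdorff m E <= sphere_measure E.
Proof.
move=> mE ES; apply/lee_mul01Pr; first exact: outer_measure_ge0.
move=> r r01; have [d d01 rd] := expr_close1 n r01.
have /andP[d0 d1] := d01.
have q0 : (0 < (1 - d) ^+ n)%R by rewrite exprn_gt0// subr_gt0.
apply: (@le_trans _ _ (((1 - d) ^+ n)%:E * hausdorff m E)).
  by apply: lee_wpmul2r; [exact: outer_measure_ge0|rewrite lee_fin].
have [N HN] := archi_inv (Num.sqrt n%:R) d0.
pose F (j : nat) : set V :=
  if pickle_inv j is Some z then E `&` gridcell N z else set0.
have mF j : measurable (F j).
  rewrite /F; case: (pickle_inv j) => [z|]; last exact: measurable0.
  by apply: measurableI => //; exact: measurable_gridcell.
have FE j : F j `<=` E by rewrite /F; case: (pickle_inv j) => [z|//] x [].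
have EF : E = \bigcup_j F j.
  apply/seteqP; split=> [e Ee|e [j _ /FE]//].
  have [z ez] := gridcell_cover N e.
  by exists (pickle z) => //; rewrite /F pickleK_inv.
have tF : trivIset setT F.
  apply/trivIsetP => i j _ _ ij; apply/seteqP; split=> // e [].
  have pz l z : pickle_inv l = Some z -> l = pickle (z : 'cV[int]_n).
    by move=> lz; have := @pickle_invK 'cV[int]_n l; rewrite lz.
  rewrite /F; case Ei : (pickle_inv i) => [z|//] [_ ez].
  case Ej : (pickle_inv j) => [z'|//] [_ ez'].
  by move/eqP: ij; apply; rewrite (pz _ _ Ei) (pz _ _ Ej) (gridcell_inj ez ez').
have -> : sphere_measure E = \sum_(j <oo) sphere_measure (F j).
  have mU : measurable (\bigcup_j F j) by exact: bigcupT_measurable.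
  rewrite {1}EF; apply/esym/cvg_lim => //.
  exact: (@measure_semi_sigma_additive _ _ _ sphere_measure F mF tF mU).
have HF : hausdorff m E <= \sum_(j <oo) hausdorff m (F j).
  by rewrite [in leLHS]EF; exact: outer_measure_sigma_subadditive.
apply: (le_trans (lee_wpmul2l _ HF)); first by rewrite lee_fin ltW.
rewrite -nneseriesZl; last by move=> j _; exact: outer_measure_ge0.
apply: lee_nneseries => [j _ _|j _].
  by rewrite mule_ge0 ?outer_measure_ge0// lee_fin ltW.
have [->|/set0P[p Fp]] := eqVneq (F j) set0.
  by rewrite outer_measure0 mule0 measure_ge0.
have Fd e : F j e -> (enorm (e - p) <= d)%R.
  move: Fp; rewrite /F; case: (pickle_inv j) => [z|//] [_ pz] [_ ez].
  have N0 : (0 <= N.+1%:R^-1 :> R)%R by rewrite invr_ge0.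
  exact: le_trans (cube_diam N0 ez pz) HN.
have d01' : (0 <= d < 1)%R by rewrite (ltW d0).
apply: (hausdorff_le_sphere d01' Fd _ (mF j)); first exact: ES (FE _ _ Fp).
exact: subset_trans (FE j) ES.
Qed.

Lemma hausdorff_sphere E : measurable E -> E `<=` usphere ->
  hausdorff m E = sphere_measure E.
Proof.
move=> mE ES; apply/eqP; rewrite eq_le hausdorff_le_sphere_measure//.
by rewrite sphere_le_hausdorff.
Qed.

End hausdorff_sphere.

(** * Integrals of extended differences *)

Section integral_set_function.
Local Open Scope ereal_scope.
Context d (T : measurableType d) (R : realType).
Import HBNNSimple.

(** A simple function below the restriction of [f] to [D] vanishes off [D], so its
   level sets at nonzero levels are subsets of [D]. The set functions need not be
   measures: [hausdorff] is only an outer measure on the whole space. *)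
Lemma eq_set_function_integral (m1 m2 : set T -> \bar R) (D : set T) (f : T -> \bar R) :
  (forall A, measurable A -> A `<=` D -> m1 A = m2 A) ->
  \int[m1]_(x in D) f x = \int[m2]_(x in D) f x.
Proof.
move=> m12.
have E g (h : {nnsfun T >-> R}) : (forall x, (h x)%:E <= (g \_ D) x) ->
    sintegral m1 h = sintegral m2 h.
  move=> hg; apply: eq_fsbigr => r _.
  have [->|r0] := eqVneq r 0%R; first by rewrite !mul0e.
  rewrite m12// => t /= htr; apply: contrapT => Dt; move: (hg t).
  have ht0 : (0 <= h t)%R by exact: fun_ge0.
  rewrite patchE memNset// lee_fin => ht0'.
  by move/eqP: r0; apply; rewrite -htr; apply/le_anti/andP.
rewrite /integral funepos_restrict funeneg_restrict.
congr (ereal_sup _ - ereal_sup _); apply/seteqP; split=> _ [h hg <-]; exists h => //.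
- by rewrite (E _ h hg).
- by rewrite (E _ h hg).
- by rewrite (E _ h hg).
- by rewrite (E _ h hg).
Qed.

End integral_set_function.

Section extended_differences.
Local Open Scope ereal_scope.
Context {R : realType}.

Lemma pmule_distrB (c : R) (a b : \bar R) : (0 < c)%R -> 0 <= a -> 0 <= b ->
  c%:E * (a - b) = c%:E * a - c%:E * b.
Proof.
move=> c0; case: a b => [a| |] [b| |]// _ _.
- by rewrite -EFinB -!EFinM -EFinB mulrBr.
- by rewrite [a%:E - +oo](_ : _ = -oo)// gt0_muleNy ?lte_fin// gt0_muley ?lte_fin//.
- by rewrite [+oo - b%:E](_ : _ = +oo)// gt0_muley ?lte_fin//.
- by rewrite [+oo - +oo](_ : _ = -oo)// gt0_muleNy ?lte_fin// gt0_muley ?lte_fin//.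
Qed.

(** For [h = a - b], integrate [a + h^- = b + h^+] and subtract the integrals of
   [a] and of [h^+ <= a], which are finite; those of [b] and [h^-] are then finite
   or infinite together. *)
Lemma ge0_integralB d (T : measurableType d) (mu : {measure set T -> \bar R})
    (D : set T) (a b : T -> \bar R) : measurable D ->
  measurable_fun D a -> measurable_fun D b ->
  (forall x, 0 <= a x) -> (forall x, 0 <= b x) ->
  \int[mu]_(x in D) a x < +oo ->
  \int[mu]_(x in D) (a x - b x) =
  \int[mu]_(x in D) a x - \int[mu]_(x in D) b x.
Proof.
move=> mD ma mb a0 b0 afin; pose h x := a x - b x.
have mh : measurable_fun D h by exact: emeasurable_funB.
have hpa x : h^\+ x <= a x.
  rewrite funeposE /h ge_max a0 andbT.
  case: (a x) (b x) (a0 x) (b0 x) => [p| |] [q| |]//=; rewrite ?leey ?leNye// !lee_fin; lra.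
have key x : a x + h^\- x = b x + h^\+ x.
  rewrite funeposE funenegE /h.
  case: (a x) (b x) (a0 x) (b0 x) => [p| |] [q| |]// p0 q0.
  - rewrite -EFinB -EFinN -!EFin_max -!EFinD; congr EFin.
    by rewrite !maxEle; case: ifP; case: ifP; lra.
  - by rewrite /= maxye maxNye adde0.
  - by rewrite /= maxye maxNye adde0.
  - by rewrite /= maxye maxNye adde0.
rewrite integralE -/h.
have hpfin : \int[mu]_(x in D) h^\+ x < +oo.
  apply: le_lt_trans afin; apply: ge0_le_integral => //.
  exact: measurable_funepos.
have := ge0_integralD mu mD (fun x _ => a0 x) ma (fun x _ => funeneg_ge0 h x) (measurable_funeneg mh).
under eq_integral do rewrite key.
rewrite (ge0_integralD mu mD (fun x _ => b0 x) mb (fun x _ => funepos_ge0 h x) (measurable_funepos mh)).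
have A0 : 0 <= \int[mu]_(x in D) a x by exact: integral_ge0.
have B0 : 0 <= \int[mu]_(x in D) b x by exact: integral_ge0.
have P0 : 0 <= \int[mu]_(x in D) h^\+ x by exact: integral_ge0.
have N0 : 0 <= \int[mu]_(x in D) h^\- x by exact: integral_ge0.
move: afin hpfin A0 B0 P0 N0.
move: (\int[mu]_(x in D) a x) (\int[mu]_(x in D) b x)
  (\int[mu]_(x in D) h^\+ x) (\int[mu]_(x in D) h^\- x).
move=> [p| |] [q| |] [r| |] [t| |]//= _ _ _ _ _ _.
by rewrite -!EFinD => -[?]; congr EFin; lra.
Qed.

End extended_differences.

(** * Second differences at a point touched from above *)

Section second_differences.
Context {R : realType} {n : nat}.
Notation V := 'cV[R]_n.
Implicit Types (f psi : V -> R).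

Definition box (x : V) (r : R) : set V := [set y | forall i, `|y i ord0 - x i ord0| <= r].

Lemma derive_line f (p v : V) (t : R) : derivable f (p + t *: v) v ->
  is_derive t 1 (fun t => f (p + t *: v)) ('D_v f (p + t *: v)).
Proof.
move=> df; pose g (t : R) := f (p + t *: v).
have E : (fun h : R => h^-1 *: ((g \o shift t) (h *: (1 : R)) - g t)) =
    (fun h : R => h^-1 *: ((f \o shift (p + t *: v)) (h *: v) - f (p + t *: v))).
  apply/funext => h; rewrite /g /=; congr (_ *: (f _ - _)).
  by rewrite scalerDl addrCA; congr (_ *: v + _); exact: mulr1.
by apply: DeriveDef; rewrite /derivable /derive E.
Qed.

Lemma MVT_line f (p v : V) (a b : R) :
  (forall t, Num.min a b <= t <= Num.max a b -> derivable f (p + t *: v) v) ->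
  exists2 c, Num.min a b <= c <= Num.max a b &
    f (p + b *: v) - f (p + a *: v) = (b - a) * 'D_v f (p + c *: v).
Proof.
wlog ab : a b / a <= b.
  move=> H df0; case/orP: (le_total a b) => [ab|ba]; first exact: H.
  move: df0; rewrite minC maxC => /(H _ _ ba)[c cb cE]; exists c => //.
  by rewrite -opprB cE -mulNr opprB.
rewrite (min_idPl ab) (max_idPr ab) => df.
have dg t : t \in `[a, b] ->
    is_derive t 1 (fun t => f (p + t *: v)) ('D_v f (p + t *: v)).
  by rewrite in_itv/= => tab; apply: derive_line; exact: df.
have cg : {within `[a, b], continuous (fun t => f (p + t *: v))}.
  apply: continuous_in_subspaceT => t; rewrite inE/= => /dg [dt _].
  by apply: differentiable_continuous; apply/derivable1_diffP.
have [c cab cE] := MVT_segment ab (fun t (tab : t \in `]a, b[) => dg t (subset_itv_oo_cc tab)) cg.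
by exists c; [rewrite in_itv/= in cab|rewrite cE mulrC].
Qed.

(** Going from [a] to [b] one coordinate at a time only uses derivatives along the
   axes, which are what the class C^2 is defined by. *)
Lemma coordinatewise_MVT f (x a b : V) (r : R) : box x r a -> box x r b ->
  (forall y i, box x r y -> derivable f y (delta_mx i ord0)) ->
  exists2 xi : 'I_n -> V, forall i, box x r (xi i) &
    f b - f a = \sum_i (b i ord0 - a i ord0) * partial i f (xi i).
Proof.
move=> xa xb df.
pose mix (j : nat) : V := \col_i (if (i < j)%N then b i ord0 else a i ord0).
pose q (i : 'I_n) (t : R) : V := mix i + t *: delta_mx i ord0.
have qE (i l : 'I_n) t : q i t l ord0 =
    if l == i then a i ord0 + t else mix i l ord0.
  rewrite !mxE eqxx andbT; case: eqP => [->|_].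
    by rewrite ltnn mulr1.
  by rewrite mulr0 addr0.
have q0 i : q i 0 = mix i by rewrite /q scale0r addr0.
have q1 (i : 'I_n) : q i (b i ord0 - a i ord0) = mix i.+1.
  apply/colP => l; rewrite qE [RHS]mxE ltnS leq_eqVlt -val_eqE/=.
  case: eqP => [/val_inj ->|_] /=; first by rewrite addrC subrK.
  by rewrite mxE.
have xq (i : 'I_n) t : Num.min 0 (b i ord0 - a i ord0) <= t <= Num.max 0 (b i ord0 - a i ord0) ->
    box x r (q i t).
  move=> tb l; rewrite qE; case: eqP => [->|_]; last first.
    by rewrite mxE; case: ifP => _; [exact: xb|exact: xa].
  have := xa i; have := xb i; rewrite !ler_norml => /andP[? ?] /andP[? ?].
  move: tb; case: (leP 0 (b i ord0 - a i ord0)) => _ /andP[? ?];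
    by apply/andP; split; lra.
have step (i : 'I_n) : exists y, box x r y /\
    f (mix i.+1) - f (mix i) = (b i ord0 - a i ord0) * partial i f y.
  have [t tb tE] := @MVT_line f (mix i) (delta_mx i ord0) 0 (b i ord0 - a i ord0)
    (fun t tb => df _ i (xq i t tb)).
  exists (q i t); split; first exact: xq.
  by rewrite subr0 in tE; rewrite -q1 -[X in _ - f X](q0 i); exact: tE.
have [xi xiP] := choice step.
exists xi => [i|]; first by have [] := xiP i.
transitivity (\sum_(i < n) (f (mix i.+1) - f (mix i))).
  rewrite -(big_mkord xpredT (fun i => f (mix i.+1) - f (mix i))) telescope_sumr//.
  by congr (f _ - f _); apply/colP => i; rewrite mxE ?ltn_ord.
by apply: eq_bigr => i _; have [] := xiP i.
Qed.

Lemma box_near (x : V) (P : set V) : (\forall y \near x, P y) ->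
  exists2 r, 0 < r & box x r `<=` P.
Proof.
move=> /nbhs_ballP[e /= e0 eP]; exists (e / 2); first by rewrite divr_gt0.
move=> y xy; apply: eP; split=> // i j; rewrite (ord1 j) /ball/=.
by rewrite distrC (le_lt_trans (xy i))// ltr_pdivrMr// ltr_pMr// ltr1n.
Qed.

Lemma continuous_bounded_near f x : {for x, continuous f} ->
  \forall y \near x, `|f y| <= `|f x| + 1.
Proof.
move=> /cvgrPdist_le/(_ 1 ltr01); apply: filterS => y h.
have -> : f y = f x + (f y - f x) by rewrite addrC subrK.
by rewrite (le_trans (ler_normD _ _))// lerD2l distrC.
Qed.

Lemma ler_sum2 (a : 'I_n -> 'I_n -> R) i j : (forall i j, 0 <= a i j) ->
  a i j <= \sum_i \sum_j a i j.
Proof.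
move=> a0; rewrite (bigD1 i)//= (bigD1 j)//= -addrA lerDl addr_ge0//.
  exact: sumr_ge0.
by apply: sumr_ge0 => ? _; exact: sumr_ge0.
Qed.

(** The second difference is a difference of two increments of [psi]; two mean
   values, of [psi] and then of its partial derivatives, leave second partial
   derivatives, which are bounded near [x] by continuity. *)
Lemma C2_delta_bound (N : set V) psi x : open N -> N x -> C2_on N psi ->
  exists r C : R, [/\ 0 < r, 0 <= C & box x r `<=` N /\
    forall v, enorm v <= r -> delta psi x v <= C * enorm v ^+ 2].
Proof.
move=> oN Nx [psi1 psi2].
pose M : R := \sum_i \sum_j (`|partial j (partial i psi) x| + 1).
have M0 : 0 <= M by apply: sumr_ge0 => i _; apply: sumr_ge0 => j _; rewrite addr_ge0.
have bounded i j : \forall y \near x, `|partial j (partial i psi) y| <= M.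
  have [_ /(_ j) [_ cij]] := psi2 i x Nx.
  apply: filterS (continuous_bounded_near cij) => y h; apply: (le_trans h).
  by apply: (@ler_sum2 (fun i j => `|partial j (partial i psi) x| + 1)) => ? ?; rewrite addr_ge0.
have [r r0 rP] : exists2 r, 0 < r & box x r `<=` [set y | N y /\
    forall i j, `|partial j (partial i psi) y| <= M].
  apply: box_near; apply: filterI; first exact: open_nbhs_nbhs.
  exact: (filter_forall _ (fun i => filter_forall _ (bounded i))).
exists r, (\sum_(i < n) \sum_(j < n) (2 * M)); split => //.
  by apply: sumr_ge0 => i _; apply: sumr_ge0 => j _; rewrite mulr_ge0.
split; first by move=> y /rP[].
move=> v vr; set h := enorm v; have h0 : 0 <= h := enorm_ge0 v.
have hr : box x h `<=` box x r by move=> y xy i; exact: le_trans (xy i) vr.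
have bx : box x h x by move=> i; rewrite subrr normr0.
have bp : box x h (x + v) by move=> i; rewrite mxE addrAC subrr add0r enorm_coord.
have bm : box x h (x - v).
  by move=> i; rewrite !mxE addrAC subrr add0r normrN enorm_coord.
have d1 y i : box x h y -> derivable psi y (delta_mx i ord0).
  by move=> /hr /rP [Ny _]; have [_ /(_ i) []] := psi1 y Ny.
have d2 l y i : box x h y -> derivable (partial l psi) y (delta_mx i ord0).
  by move=> /hr /rP [Ny _]; have [_ /(_ i) []] := psi2 l y Ny.
have [xi xiP xiE] := coordinatewise_MVT bx bp d1.
have [eta etaP etaE] := coordinatewise_MVT bm bx d1.
have -> : delta psi x v = \sum_i v i ord0 * (partial i psi (xi i) - partial i psi (eta i)).
  rewrite /delta (_ : _ - _ = (psi (x + v) - psi x) - (psi x - psi (x - v))); last by ring.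
  rewrite xiE etaE -sumrB; apply: eq_bigr => i _; rewrite !mxE; ring.
rewrite mulr_suml; apply: ler_sum => i _.
have [zeta zetaP ->] := coordinatewise_MVT (etaP i) (xiP i) (d2 i).
rewrite mulr_sumr mulr_suml; apply: ler_sum => j _.
apply: (le_trans (ler_norm _)); rewrite !normrM.
rewrite (_ : 2 * M * h ^+ 2 = h * ((2 * h) * M)); last by ring.
apply: ler_pM => //; first exact: enorm_coord.
apply: ler_pM => //; last first.
  by have [_] := rP _ (hr _ (zetaP j)); exact.
have := xiP i j; have := etaP i j; rewrite !ler_norml => /andP[? ?] /andP[? ?].
by apply/andP; split; lra.
Qed.

Lemma touched_above_delta_bound (u : V -> R) (x : V) : touched_above u x ->
  exists r C : R, [/\ 0 < r, 0 <= C &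
    forall v, enorm v <= r -> delta u x v <= C * enorm v ^+ 2].
Proof.
move=> [N [psi [oN Nx C2 psix upsi]]].
have [r [C [r0 C0 [bN bd]]]] := C2_delta_bound oN Nx C2.
exists r, C; split=> // v vr; apply: le_trans (bd v vr).
have le y : N y -> u y <= psi y.
  move=> Ny; have [->|/(upsi y Ny)/ltW//] := eqVneq y x.
  by rewrite psix.
rewrite /delta psix lerD2r; apply: lerD; apply: le; apply: bN => i; rewrite !mxE addrAC subrr add0r.
  by rewrite (le_trans (enorm_coord _ _)).
by rewrite normrN (le_trans (enorm_coord _ _)).
Qed.

End second_differences.

(** * Integrability of the positive part *)

Section polar_consequences.
Context {R : realType} {m : nat}.
Local Open Scope ereal_scope.
Notation n := m.+1.
Notation V := 'cV[R]_n.

Lemma ge0_integral_usphere (G : V -> \bar R) : measurable_fun setT G ->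
  (forall v, 0 <= G v) ->
  \int[sphere_measure]_e G e = \int[sphere_measure]_(e in usphere) G e.
Proof.
move=> mG G0.
have mS : measurable (~` (@usphere R n)) by apply: measurableC; exact: measurable_usphere.
rewrite (ge0_negligible_integral mS measurableT mG (fun v _ => G0 v)).
  by rewrite setTD setCK.
by apply: sphere_measure_usphere.
Qed.

Lemma polar_usphere (f : V -> \bar R) : measurable_fun setT f ->
  (forall v, 0 <= f v) ->
  \int[lebesgue_cV n]_v f v = \int[sphere_measure]_(e in usphere)
    \int[lebesgue_measure]_(r in `]0%R, +oo[) ((r ^+ m)%:E * f (r *: e)).
Proof.
move=> mf f0; rewrite (polar_coordinates mf f0).
have mscl := @measurable_cV_dilate R n.
pose F (p : V * R) := (\1_(`]0%R, +oo[%classic : set R) p.2)%:E * ((p.2 ^+ m)%:E * f (p.2 *: p.1)).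
have mF : measurable_fun setT F.
  apply: emeasurable_funM.
    apply/measurable_EFinP; apply: (measurableT_comp _ measurable_snd).
    by apply: measurable_indic; exact: measurable_itv.
  apply: emeasurable_funM; last exact: (measurableT_comp mf mscl).
  by apply/measurable_EFinP; apply: measurable_funX; exact: measurable_snd.
have F0 p : 0 <= F p.
  rewrite /F indicE; case: (boolP (_ \in _)); last by rewrite mul0e.
  rewrite inE/= in_itv/= andbT mul1e => /ltW p0.
  by rewrite mule_ge0// lee_fin exprn_ge0.
rewrite ge0_integral_usphere//.
- under eq_fun do rewrite integral_indicD.
  exact: (measurable_fun_fubini_tonelli_F (m2 := @lebesgue_measure R) F mF F0).
- move=> e; apply: integral_ge0 => r /=; rewrite in_itv/= andbT => /ltW r0.
  by rewrite mule_ge0// lee_fin exprn_ge0.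
Qed.

Lemma integral_radial (phi : R -> R) : measurable_fun setT phi ->
  (forall r, 0 <= phi r)%R ->
  \int[lebesgue_cV n]_v (phi (enorm v))%:E =
  \int[lebesgue_measure]_(r in `]0%R, +oo[) (r ^+ m * phi r)%:E * sphere_measure (@usphere R n).
Proof.
move=> mphi phi0; rewrite polar_usphere; last 2 first.
- by apply/measurable_EFinP; apply: (measurableT_comp mphi); exact: measurable_enorm.
- by move=> v; rewrite lee_fin.
rewrite -integral_cst; last exact: measurable_usphere.
apply: eq_integral => e; rewrite inE/= => e1; apply: eq_integral => r.
rewrite inE/= in_itv/= andbT => r0; rewrite -EFinM.
by rewrite enormZ gtr0_norm// e1 mulr1.
Qed.

Lemma sphere_usphere_lty : sphere_measure (@usphere R n) < +oo.
Proof.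
apply: le_lt_trans (@sphere_measure_lty R m).
by apply: le_measure; rewrite ?inE//; exact: measurable_usphere.
Qed.

Lemma integral_radial_lty (phi : R -> R) : measurable_fun setT phi ->
  (forall r, 0 <= phi r)%R ->
  \int[lebesgue_measure]_(r in `]0%R, +oo[) (r ^+ m * phi r)%:E < +oo ->
  \int[lebesgue_cV n]_v (phi (enorm v))%:E < +oo.
Proof.
move=> mphi phi0 h; rewrite integral_radial// lte_mul_pinfty//.
- apply: integral_ge0 => r /=; rewrite in_itv/= andbT => /ltW r0.
  by rewrite lee_fin mulr_ge0// exprn_ge0.
- rewrite ge0_fin_numE//.
  apply: integral_ge0 => r /=; rewrite in_itv/= andbT => /ltW r0.
  by rewrite lee_fin mulr_ge0// exprn_ge0.
- exact: sphere_usphere_lty.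
Qed.

Variables (s : R) (s0 : (0 < s)%R) (s1 : (s < 1)%R).
Let p : R := (n%:R + 2 * s)%R.

Lemma near_singularity_lty (r0 : R) : (0 < r0)%R ->
  \int[lebesgue_cV n]_v (\1_(`]0%R, r0]%classic : set R) (enorm v) * enorm v `^ (2 - p))%:E < +oo.
Proof.
move=> r00; apply: (integral_radial_lty (phi := fun r => (\1_(`]0%R, r0]%classic : set R) r * r `^ (2 - p))%R)).
- apply: measurable_funM; first by apply: measurable_indic; exact: measurable_itv.
  exact: measurable_powR.
- by move=> r; rewrite mulr_ge0// powR_ge0.
have q0 : (0 < 2 - 2 * s)%R by move: s1; lra.
have := integral_powR_head r00 q0; rewrite integral_indicD => h.
apply: (@le_lt_trans _ _ (((2 - 2 * s)^-1)%:E * (r0 `^ (2 - 2 * s))%:E)); last by rewrite -EFinM ltry.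
rewrite -h -ge0_integralZl; last 4 first.
- exact: measurableT.
- apply: emeasurable_funM; last exact: measurable_powR_fun.
  by apply/measurable_EFinP; apply: measurable_indic; exact: measurable_itv.
- by move=> t _; rewrite mule_ge0// lee_fin// mulr_ge0 ?powR_ge0// ltW.
- by rewrite lee_fin invr_ge0 ltW.
rewrite [leLHS]integral_indicD le_eqVlt; apply/orP; left; apply/eqP.
apply: eq_integral => r _; rewrite -!EFinM; congr EFin.
rewrite !indicE; case: (boolP (r \in (`]0%R, r0]%classic : set R))) => [|_]; last by rewrite !mul0r !mulr0.
rewrite inE/= in_itv/= => /andP[rpos rr0].
rewrite (_ : (r \in `]0%R, +oo[%classic) = true); last by apply/mem_set; rewrite /= in_itv/= rpos.
rewrite !mul1r mulKf ?gt_eqF// -(powR_mulrn m (ltW rpos)) -powRD; last by apply/implyP => _; rewrite gt_eqF.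
by congr (_ `^ _)%R; rewrite /p -natr1; ring.
Qed.

Lemma far_tail_lty (r0 : R) : (0 < r0)%R ->
  \int[lebesgue_cV n]_v (\1_(`[r0, +oo[%classic : set R) (enorm v) * enorm v `^ (- p))%:E < +oo.
Proof.
move=> r00; apply: (integral_radial_lty (phi := fun r => (\1_(`[r0, +oo[%classic : set R) r * r `^ (- p))%R)).
- apply: measurable_funM; first by apply: measurable_indic; exact: measurable_itv.
  exact: measurable_powR.
- by move=> r; rewrite mulr_ge0// powR_ge0.
have q0 : (0 < 2 * s)%R by rewrite mulr_gt0.
have := integral_powR_tail r00 q0; rewrite integral_indicD => h.
apply: (@le_lt_trans _ _ (((2 * s)^-1)%:E * (r0 `^ (- (2 * s)))%:E)); last by rewrite -EFinM ltry.
rewrite -h -ge0_integralZl; last 4 first.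
- exact: measurableT.
- apply: emeasurable_funM; last exact: measurable_powR_fun.
  by apply/measurable_EFinP; apply: measurable_indic; exact: measurable_itv.
- by move=> t _; rewrite mule_ge0// lee_fin// mulr_ge0 ?powR_ge0// ltW.
- by rewrite lee_fin invr_ge0 ltW.
rewrite [leLHS]integral_indicD le_eqVlt; apply/orP; left; apply/eqP.
apply: eq_integral => r _; rewrite -!EFinM; congr EFin.
rewrite !indicE; case: (boolP (r \in (`[r0, +oo[%classic : set R))) => [|_]; last by rewrite !mul0r !mulr0.
rewrite inE/= in_itv/= andbT => rr0.
have rpos : (0 < r)%R by exact: lt_le_trans rr0.
rewrite (_ : (r \in `]0%R, +oo[%classic) = true); last by apply/mem_set; rewrite /= in_itv/= rpos.
rewrite !mul1r mulKf ?gt_eqF// -(powR_mulrn m (ltW rpos)) -powRD; last by apply/implyP => _; rewrite gt_eqF.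
by congr (_ `^ _)%R; rewrite /p -natr1; ring.
Qed.

Lemma ge0_integral_linear (L : 'M[R]_n) : L \in unitmx ->
  exists2 a : R, (0 <= a)%R & forall g : V -> \bar R, measurable_fun setT g ->
   (forall v, 0 <= g v) ->
   \int[lebesgue_cV n]_v g (L *m v) = a%:E * \int[lebesgue_cV n]_v g v.
Proof.
move=> uL; have [a a0 aE] := lebesgue_cV_linear_scale uL; exists a => // g mg g0.
have mL := measurable_cV_mulmx L.
transitivity (\int[pushforward (lebesgue_cV n) (fun v : V => L *m v)]_v g v).
  by apply/esym; apply: (ge0_integral_pushforward mL) => //.
transitivity (\int[mscale (NngNum a0) (lebesgue_cV n)]_v g v).
  by apply: eq_measure_integral => A mA _; exact: aE.
by apply: ge0_integral_mscale => // v _; exact: g0.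
Qed.

Lemma mulmx_enorm_bound (A : 'M[R]_n) :
  exists2 M : R, (0 < M)%R & forall v : V, (enorm (A *m v) <= M * enorm v)%R.
Proof.
pose K := (\sum_i \sum_j `|A i j|)%R.
have K0 : (0 <= K)%R by apply: sumr_ge0 => i _; exact: sumr_ge0.
exists (Num.sqrt n%:R * K + 1)%R; first by rewrite ltr_wpDl// mulr_ge0// sqrtr_ge0.
move=> v; apply: (@le_trans _ _ (Num.sqrt n%:R * (K * enorm v))%R).
  apply: enorm_le_coord => [|i]; first by rewrite mulr_ge0// enorm_ge0.
  rewrite mxE (le_trans (ler_norm_sum _ _ _))// /K mulr_suml [leRHS](bigD1 i)//=.
  rewrite -[leLHS]addr0 lerD//; last first.
    by apply: sumr_ge0 => l _; rewrite mulr_ge0 ?enorm_ge0//; exact: sumr_ge0.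
  rewrite mulr_suml; apply: ler_sum => j _.
  by rewrite normrM ler_wpM2l// enorm_coord.
by rewrite mulrA ler_wpM2r ?enorm_ge0// lerDl.
Qed.

Definition posdelta (u : V -> R) (x y : V) : R := Num.max (delta u x y) 0%R.

(** Near the origin the positive part is bounded by [C |A y|^2], which is integrable
   against the kernel because [s < 1]. Away from it the kernel is at most a
   constant times the weight of the class of [u] at [x + A y] and at [x - A y], and
   an affine change of variables brings these back to [u] itself. The remaining
   term [u x] is integrable at infinity because [s > 0]. *)
Lemma posdelta_lty (u : V -> R) (x : V) (A : 'M[R]_n) : A \in unitmx ->
  L1_omega s u -> touched_above u x ->
  \int[lebesgue_cV n]_y (posdelta u x (A *m y) / enorm y `^ p)%:E < +oo.
Proof.
move=> uA [mu u1] /touched_above_delta_bound [rho [C [rho0 C0 Cdelta]]].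
have [M M0 AM] := mulmx_enorm_bound A.
pose r0 := (rho / M)%R; have r00 : (0 < r0)%R by rewrite divr_gt0.
have p0 : (0 < p)%R by rewrite addr_gt0 ?ltr0n// mulr_gt0.
pose w (z : V) : R := (`|u z| / (1 + enorm z `^ p))%R.
have w0 z : (0 <= w z)%R by rewrite divr_ge0// addr_ge0// powR_ge0.
have mw : measurable_fun setT w.
  apply: measurable_funM; first exact: measurableT_comp.
  under eq_fun do rewrite -powR_inv1 ?addr_ge0 ?powR_ge0//.
  apply: (measurableT_comp (measurable_powR (-1))).
  apply: measurable_funD => //.
  by apply: (measurableT_comp (measurable_powR p)); exact: measurable_enorm.
(* For [|y| >= r0], [|x + A y| <= B |y|] and [1 + |x + A y|^p <= D |y|^p]. *)
pose B : R := (enorm x / r0 + M)%R.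
have B0 : (0 < B)%R by rewrite ltr_wpDl// divr_ge0 ?enorm_ge0// ltW.
pose D : R := (r0 `^ (- p) + B `^ p)%R.
have D0 : (0 <= D)%R by rewrite addr_ge0// powR_ge0.
pose near (y : V) : R := (\1_(`]0%R, r0]%classic : set R) (enorm y) * enorm y `^ (2 - p))%R.
pose far (y : V) : R := (\1_(`[r0, +oo[%classic : set R) (enorm y) * enorm y `^ (- p))%R.
have near0 y : (0 <= near y)%R by rewrite mulr_ge0// powR_ge0.
have far0 y : (0 <= far y)%R by rewrite mulr_ge0// powR_ge0.
have mpw q : measurable_fun setT (fun y : V => (enorm y `^ q)%R).
  by apply: (measurableT_comp (measurable_powR q)); exact: measurable_enorm.
have mind (S : set R) : measurable S -> measurable_fun setT (fun y : V => \1_S (enorm y) : R).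
  move=> mS; apply: measurableT_comp; first exact: measurable_indic.
  exact: measurable_enorm.
have mnear : measurable_fun setT near.
  by apply: measurable_funM => //; apply: mind; exact: measurable_itv.
have mfar : measurable_fun setT far.
  by apply: measurable_funM => //; apply: mind; exact: measurable_itv.
have far_u (L : 'M[R]_n) y : (forall v : V, enorm (L *m v) <= M * enorm v)%R -> (r0 <= enorm y)%R ->
    (`|u (x + L *m y)| / enorm y `^ p <= D * w (L *m y + x))%R.
  move=> LM ry; have y0 : (0 < enorm y)%R by exact: lt_le_trans ry.
  rewrite (addrC (L *m y)) /w mulrCA; apply: ler_wpM2l => //.
  rewrite -[leLHS]mul1r ler_pdivrMr ?powR_gt0// mulrAC ler_pdivlMr ?ltr_pwDl ?powR_ge0//.
  rewrite mul1r /D mulrDl; apply: lerD.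
    rewrite -[leLHS](powRr0 r0) -(subrr p) addrC powRD; last by apply/implyP => _; rewrite gt_eqF.
    by rewrite ler_wpM2l ?powR_ge0// ge0_ler_powR ?nnegrE ?(ltW p0) ?(ltW r00) ?(ltW y0).
  rewrite -powRM ?(ltW B0) ?(ltW y0)//.
  apply: ge0_ler_powR; rewrite ?nnegrE ?enorm_ge0 ?(ltW p0)//.
    by rewrite mulr_ge0 ?(ltW B0) ?(ltW y0).
  apply: (le_trans (ler_enormD _ _)); rewrite /B mulrDl; apply: lerD => //.
  by rewrite -[leLHS]mulr1 -mulrA ler_wpM2l ?enorm_ge0// mulrC ler_pdivlMr// mul1r.
have nearE y : (0 < enorm y <= r0)%R -> near y = (enorm y `^ 2 / enorm y `^ p)%R.
  move=> /andP[y0 yr]; rewrite /near indicE (_ : (enorm y \in _) = true); last first.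
    by apply/mem_set; rewrite /= in_itv/= y0.
  by rewrite mul1r powRB//; apply/implyP => _; rewrite gt_eqF.
have farE y : (r0 <= enorm y)%R -> far y = (enorm y `^ p)^-1%R.
  move=> yr; rewrite /far indicE (_ : (enorm y \in _) = true); last first.
    by apply/mem_set; rewrite /= in_itv/= yr.
  by rewrite mul1r powRN.
have near_fin : \int[lebesgue_cV n]_v (near v)%:E < +oo by exact: near_singularity_lty.
have far_fin : \int[lebesgue_cV n]_v (far v)%:E < +oo by exact: far_tail_lty.
have w_fin : \int[lebesgue_cV n]_v (w v)%:E < +oo by exact: u1.
clearbody near far w D.
pose phi (y : V) : R :=
  ((C * M ^+ 2 * near y + D * w (A *m y + x)) +
   (D * w (- A *m y + x) + 2 * `|u x| * far y))%R.
pose Phi (y : V) : \bar R :=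
  ((C * M ^+ 2)%:E * (near y)%:E + D%:E * (w (A *m y + x))%:E) +
  (D%:E * (w (- A *m y + x))%:E + (2 * `|u x|)%:E * (far y)%:E).
have PhiE y : Phi y = (phi y)%:E by [].
have cM0 : (0 <= C * M ^+ 2)%R by rewrite mulr_ge0// exprn_ge0// ltW.
have t10 y : (0 <= C * M ^+ 2 * near y)%R by rewrite mulr_ge0.
have t20 y : (0 <= D * w y)%R by rewrite mulr_ge0.
have t40 y : (0 <= 2 * `|u x| * far y)%R by rewrite !mulr_ge0.
have bound y : (posdelta u x (A *m y) / enorm y `^ p)%:E <= Phi y.
  rewrite PhiE lee_fin /phi.
  have [y0|ypos] := eqVneq (enorm y) 0%R.
    by rewrite y0 powR0 ?gt_eqF// invr0 mulr0 !addr_ge0.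
  have {}ypos : (0 < enorm y)%R by rewrite lt_def ypos enorm_ge0.
  have [yr|ry] := leP (enorm y) r0.
    apply: (@le_trans _ _ (C * M ^+ 2 * near y)%R); last first.
      by rewrite -[leLHS]addr0 -addrA lerD// !addr_ge0.
    rewrite nearE ?ypos// mulrA ler_wpM2r ?invr_ge0 ?powR_ge0//.
    rewrite (powR_mulrn 2 (ltW ypos)) /posdelta ge_max; apply/andP; split; last first.
      by rewrite !mulr_ge0 ?exprn_ge0 ?enorm_ge0// ltW.
    have Ay : (enorm (A *m y) <= rho)%R.
      by rewrite (le_trans (AM y))// mulrC -ler_pdivlMr.
    apply: (le_trans (Cdelta _ Ay)); rewrite -mulrA ler_wpM2l// -exprMn.
    by rewrite lerXn2r ?nnegrE ?mulr_ge0 ?enorm_ge0// ltW.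
  have NAM v : (enorm (- A *m v) <= M * enorm v)%R by rewrite mulNmx enormN.
  have f1 := far_u A y AM (ltW ry); have f2 := far_u (- A)%R y NAM (ltW ry).
  apply: (@le_trans _ _ ((`|u (x + A *m y)| / enorm y `^ p +
      `|u (x + - A *m y)| / enorm y `^ p) + 2 * `|u x| * far y)%R); last first.
    by move: (t10 y) f1 f2; lra.
  rewrite farE ?(ltW ry)// -!mulrDl ler_wpM2r ?invr_ge0 ?powR_ge0//.
  rewrite /posdelta ge_max; apply/andP; split; last by rewrite !addr_ge0.
  rewrite /delta mulNmx; have := ler_norm (u (x + A *m y)%R); have := ler_norm (u (x - A *m y)%R).
  by have := ler_norm (- u x)%R; rewrite normrN; lra.
have mwL (L : 'M[R]_n) : measurable_fun setT (fun y : V => (w (L *m y + x))%:E).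
  apply/measurable_EFinP; apply: (measurableT_comp mw).
  apply: measurable_cV_add; [exact: measurable_cV_mulmx|exact: measurable_cst].
have intw (L : 'M[R]_n) : L \in unitmx -> \int[lebesgue_cV n]_y (w (L *m y + x))%:E < +oo.
  move=> uL; have [a a0 aE] := ge0_integral_linear uL.
  rewrite (aE (fun z => (w (z + x)%R)%:E)); last 2 first.
  - apply/measurable_EFinP; apply: (measurableT_comp mw); exact: measurable_cV_addc.
  - by move=> v; rewrite lee_fin.
  rewrite (ge0_integral_cV_shift x (f := fun z => (w z)%:E)); last 2 first.
  - exact/measurable_EFinP.
  - by move=> v; rewrite lee_fin.
  by rewrite lte_mul_pinfty// lee_fin.
apply: (@le_lt_trans _ _ (\int[lebesgue_cV n]_y Phi y)).
  apply: ge0_le_integral => //.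
  - by move=> y _; rewrite lee_fin divr_ge0 ?powR_ge0// le_max lexx orbT.
  - apply/measurable_EFinP; apply: measurable_funM; last first.
      under eq_fun do rewrite -powRN; exact: mpw.
    apply: measurable_maxr => //; rewrite /delta.
    have mAy : measurable_fun setT (fun y : V => A *m y) := measurable_cV_mulmx A.
    apply: measurable_funB; last exact: measurable_cst.
    apply: measurable_funD; apply: (measurableT_comp mu); apply: measurable_cV_add => //.
    apply: measurable_fun_mx => i j; under eq_fun do rewrite mxE.
    by apply: measurable_funN; exact: (measurableT_comp (measurable_mx_coord i j) mAy).
  - by apply: emeasurable_funD; apply: emeasurable_funD;
      apply: emeasurable_funM => //; apply/measurable_EFinP.
have uNA : (- A)%R \in unitmx by rewrite -scaleN1r unitmxZ// unitrN1.
have intZ (c : R) (g : V -> R) : (0 <= c)%R -> measurable_fun setT (EFin \o g) ->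
    (forall y, 0 <= g y)%R -> \int[lebesgue_cV n]_y (g y)%:E < +oo ->
    \int[lebesgue_cV n]_y (c%:E * (g y)%:E) < +oo.
  move=> c0 mg g0 gfin; rewrite ge0_integralZl//; last by move=> y _; rewrite lee_fin.
  by rewrite lte_mul_pinfty// lee_fin.
have mZ : forall (d : R) (g : V -> R), measurable_fun setT (EFin \o g) ->
   measurable_fun setT (fun y => d%:E * (g y)%:E).
  by move=> d g mg; apply: emeasurable_funM => //; exact: measurable_cst.
have mn : measurable_fun setT (EFin \o near) by exact/measurable_EFinP.
have mf : measurable_fun setT (EFin \o far) by exact/measurable_EFinP.
have Z0 : forall c g : R, (0 <= c)%R -> (0 <= g)%R -> 0 <= c%:E * g%:E by move=> c g c0 g0; rewrite mule_ge0.
rewrite /Phi ge0_integralD//; last 4 first.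
- by move=> y _; exact: adde_ge0 (Z0 _ _ _ _) (Z0 _ _ _ _).
- by apply: emeasurable_funD; apply: mZ => //; exact: mwL.
- by move=> y _; rewrite adde_ge0//; apply: Z0; rewrite ?mulr_ge0.
- by apply: emeasurable_funD; apply: mZ => //; exact: mwL.
rewrite ge0_integralD//; last 4 first.
- by move=> y _; exact: Z0.
- by apply: mZ => //; exact: mwL.
- by move=> y _; exact: Z0.
- by apply: mZ => //; exact: mwL.
rewrite ge0_integralD//; last 4 first.
- by move=> y _; exact: Z0.
- by apply: mZ => //; exact: mwL.
- by move=> y _; apply: Z0; rewrite ?mulr_ge0.
- by apply: mZ => //; exact: mwL.
have i1 := intZ _ _ cM0 mn near0 near_fin.
have i2 := intZ _ _ D0 (mwL A) (fun y => w0 _) (intw A uA).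
have i3 := intZ _ _ D0 (mwL (- A)%R) (fun y => w0 _) (intw _ uNA).
have c4 : (0 <= 2 * `|u x|)%R by rewrite mulr_ge0.
have i4 := intZ _ _ c4 mf far0 far_fin.
by apply: lte_add_pinfty; apply: lte_add_pinfty.
Qed.

End polar_consequences.

(** * The one-dimensional operators on rays *)

Section rays.
Context {R : realType} {m : nat}.
Local Open Scope ereal_scope.
Notation n := m.+1.
Notation V := 'cV[R]_n.
Implicit Types (h u : V -> R) (x y : V).

Lemma integral_evenE (g : R -> \bar R) : measurable_fun setT g ->
  (forall t, 0 <= g t) -> (forall t, g (- t)%R = g t) ->
  \int[lebesgue_measure]_t g t =
  2%:E * \int[lebesgue_measure]_(t in `]0%R, +oo[) g t.
Proof.
move=> mg g0 gN.
have mI : measurable (`]0%R, +oo[%classic : set R) by exact: measurable_itv.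
have -> : 2%:E * \int[lebesgue_measure]_(t in `]0%R, +oo[) g t =
    \int[lebesgue_measure]_(t in `]0%R, +oo[) g t +
    \int[lebesgue_measure]_(t in `]0%R, +oo[) g t.
  by rewrite mule_natl mule2n.
rewrite -[in LHS](setUv (`]0%R, +oo[%classic : set R)) ge0_integral_setU//; last 3 first.
- exact: measurableC.
- by apply: measurable_funTS.
- by apply/disj_setPS => t [].
congr (_ + _).
rewrite integral_indicD -ge0_integral_opp; last 2 first.
- apply: emeasurable_funM => //; apply/measurable_EFinP.
  by apply: measurable_indic; exact: measurableC.
- by move=> t; rewrite mule_ge0// lee_fin.
rewrite integral_itv_obnd_cbnd; last exact: measurable_funTS.
rewrite [RHS]integral_indicD; apply: eq_integral => t _; rewrite gN; congr (_%:E * _).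
rewrite !indicE; congr (_%:R)%R; congr nat_of_bool; apply/idP/idP; rewrite !inE /= !in_itv/= !andbT.
  by move/negP; rewrite -leNgt oppr_le0.
by move=> t0; apply/negP; rewrite -leNgt oppr_le0.
Qed.

Lemma integral_pos_neg d (T : measurableType d) (mu : {measure set T -> \bar R})
    (f w : T -> R) : (forall t, 0 <= w t)%R ->
  \int[mu]_t (f t * w t)%:E =
  \int[mu]_t (Num.max (f t) 0 * w t)%:E - \int[mu]_t (Num.max (- f t) 0 * w t)%:E.
Proof.
move=> w0; rewrite integralE; congr (_ - _); apply: eq_integral => t _.
  by rewrite funeposE maxr_pMl// mul0r EFin_max.
by rewrite funenegE maxr_pMl// mul0r EFin_max mulNr.
Qed.

Variables (s : R) (s0 : (0 < s)%R) (s1 : (s < 1)%R).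

Definition ray_integral h y : \bar R :=
  \int[lebesgue_measure]_r (h (r *: y) / `|r| `^ (1 + 2 * s))%:E.

Lemma measurable_ray_integrand h : measurable_fun setT h ->
  measurable_fun setT (fun q : V * R => (h (q.2 *: q.1) / `|q.2| `^ (1 + 2 * s))%:E).
Proof.
move=> mh; apply/measurable_EFinP; apply: measurable_funM.
  by apply: (measurableT_comp mh); exact: measurable_cV_dilate.
under eq_fun do rewrite -powRN.
apply: (measurableT_comp (measurable_powR _)).
by apply: measurableT_comp => //; exact: measurable_snd.
Qed.

Lemma measurable_ray h y : measurable_fun setT h ->
  measurable_fun setT (fun r : R => (h (r *: y) / `|r| `^ (1 + 2 * s))%:E).
Proof.
move=> /measurable_ray_integrand mh.
exact: (measurableT_comp mh (pair1_measurable y)).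
Qed.

Section nonneg.
Variable h : V -> R.
Hypotheses (mh : measurable_fun setT h) (h0 : forall v, (0 <= h v)%R).

Lemma ray_integral_ge0 y : 0 <= ray_integral h y.
Proof. by apply: integral_ge0 => r _; rewrite lee_fin divr_ge0// powR_ge0. Qed.

Lemma measurable_ray_integral : measurable_fun setT (ray_integral h).
Proof.
apply: (measurable_fun_fubini_tonelli_F (m2 := @lebesgue_measure R) _
  (measurable_ray_integrand mh)) => q.
by rewrite lee_fin divr_ge0// powR_ge0.
Qed.

(** The kernel is homogeneous of degree [-(1 + 2 s)] and the measure of degree
   [1]. *)
Lemma ray_integralZ c y : (0 < c)%R ->
  ray_integral h (c *: y) = (c `^ (2 * s))%:E * ray_integral h y.
Proof.
move=> c0; rewrite [in RHS]/ray_integral -(ge0_integral_affine 0 c0); last 2 first.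
- exact: measurable_ray.
- by move=> t; rewrite lee_fin divr_ge0// powR_ge0.
rewrite muleA -EFinM -ge0_integralZl//; last 3 first.
- apply: (measurableT_comp (measurable_ray y mh)).
  by apply: measurable_funD => //; apply: measurable_funM.
- by move=> t _; rewrite lee_fin divr_ge0// powR_ge0.
- by rewrite lee_fin mulr_ge0// ?powR_ge0// ltW.
apply: eq_integral => r _; rewrite -EFinM addr0 scalerA mulrC; congr EFin.
rewrite (mulrC c r) normrM (gtr0_norm c0) powRM ?normr_ge0 ?(ltW c0)// invfM.
have cp : (c `^ (1 + 2 * s) = c `^ (2 * s) * c)%R.
  rewrite powRD ?powRr1 ?(ltW c0) 1?mulrC//.
  by apply/implyP => _; rewrite gt_eqF.
have cn : (c `^ (1 + 2 * s) != 0)%R by rewrite gt_eqF// powR_gt0.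
by rewrite -cp mulrCA (mulrC (c `^ (1 + 2 * s))%R) mulfVK// mulrC.
Qed.

Hypothesis hN : forall v, h (- v)%R = h v.

(** Polar coordinates; a line through the origin meets the sphere twice, hence the
   factor [2]. *)
Lemma integral_ray : \int[sphere_measure]_(e in usphere) ray_integral h e =
  2%:E * \int[lebesgue_cV n]_y (h y / enorm y `^ (n%:R + 2 * s))%:E.
Proof.
have mk : measurable_fun setT (fun y : V => (h y / enorm y `^ (n%:R + 2 * s))%:E).
  apply/measurable_EFinP; apply: measurable_funM => //.
  under eq_fun do rewrite -powRN.
  by apply: (measurableT_comp (measurable_powR _)); exact: measurable_enorm.
have k0 (y : V) : 0 <= (h y / enorm y `^ (n%:R + 2 * s))%:E.
  by rewrite lee_fin divr_ge0// powR_ge0.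
rewrite -ge0_integralZl// polar_usphere; last 2 first.
- by apply: emeasurable_funM => //; exact: measurable_cst.
- by move=> y; rewrite mule_ge0.
apply: eq_integral => e; rewrite inE/= => e1.
rewrite /ray_integral integral_evenE; last 3 first.
- exact: measurable_ray.
- by move=> r; rewrite lee_fin divr_ge0// powR_ge0.
- by move=> r; rewrite normrN scaleNr hN.
rewrite -ge0_integralZl//; last 2 first.
- by apply: measurable_funTS; exact: measurable_ray.
- by move=> r _; rewrite lee_fin divr_ge0// powR_ge0.
apply: eq_integral => r; rewrite inE/= in_itv/= andbT => r0.
rewrite -!EFinM enormZ e1 mulr1; congr EFin.
rewrite (gtr0_norm r0).
have -> : (r `^ (n%:R + 2 * s) = r `^ (1 + 2 * s) * r ^+ m)%R.
  rewrite -(powR_mulrn m (ltW r0)) -powRD; last by apply/implyP => _; rewrite gt_eqF.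
  by congr (_ `^ _)%R; rewrite -natr1; ring.
by field; rewrite !gt_eqF ?exprn_gt0 ?powR_gt0.
Qed.

End nonneg.

Lemma measurable_posdelta u x : measurable_fun setT u ->
  measurable_fun setT (posdelta u x).
Proof.
move=> mu; apply: measurable_maxr => //; rewrite /delta.
apply: measurable_funB; last exact: measurable_cst.
apply: measurable_funD; apply: (measurableT_comp mu).
  by apply: measurable_cV_add => //; exact: measurable_cst.
apply: measurable_cV_add; first exact: measurable_cst.
by apply: measurable_fun_mx => i j; under eq_fun do rewrite mxE;
  apply: measurable_funN; exact: measurable_mx_coord.
Qed.

Lemma posdelta_ge0 u x y : (0 <= posdelta u x y)%R.
Proof. by rewrite /posdelta le_max lexx orbT. Qed.

Lemma posdeltaN u x y : posdelta u x (- y)%R = posdelta u x y.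
Proof. by rewrite /posdelta /delta opprK (addrC (u (x - y)%R)). Qed.

Lemma IsE u x y : Is s u x y = (1 - s)%:E *
  (ray_integral (posdelta u x) y - ray_integral (posdelta (\- u)%R x) y).
Proof.
rewrite /Is integral_pos_neg; last by move=> r; rewrite invr_ge0 powR_ge0.
congr (_ * (_ - _)); apply: eq_integral => r _.
by rewrite /posdelta /delta /=; congr (Num.max _ _ / _)%:E; ring.
Qed.

Lemma IsZ u x y c : measurable_fun setT u -> (0 < c)%R ->
  Is s u x (c *: y) = (c `^ (2 * s))%:E * Is s u x y.
Proof.
move=> mu c0; have mv : measurable_fun setT (\- u)%R by exact: measurableT_comp.
rewrite !IsE !ray_integralZ//; try exact: measurable_posdelta; try by move=> v; exact: posdelta_ge0.
rewrite -pmule_distrB ?powR_gt0//; first by rewrite muleCA.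
- by apply: ray_integral_ge0 => v; exact: posdelta_ge0.
- by apply: ray_integral_ge0 => v; exact: posdelta_ge0.
Qed.

Lemma ge0_integralZB d (T : measurableType d) (mu : {measure set T -> \bar R})
    (D : set T) (a b : T -> \bar R) (c : R) : measurable D ->
  measurable_fun D a -> measurable_fun D b ->
  (forall t, 0 <= a t) -> (forall t, 0 <= b t) -> (0 < c)%R ->
  \int[mu]_(t in D) a t < +oo ->
  \int[mu]_(t in D) (c%:E * (a t - b t)) =
  c%:E * (\int[mu]_(t in D) a t - \int[mu]_(t in D) b t).
Proof.
move=> mD ma mb a0 b0 c0 afin.
under eq_integral do rewrite pmule_distrB//.
have c0' : 0 <= c%:E by rewrite lee_fin ltW.
rewrite ge0_integralB//.
- by rewrite !ge0_integralZl// -pmule_distrB//; apply: integral_ge0.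
- by apply: emeasurable_funM => //; exact: measurable_cst.
- by apply: emeasurable_funM => //; exact: measurable_cst.
- by move=> t; rewrite mule_ge0.
- by move=> t; rewrite mule_ge0.
- by rewrite ge0_integralZl// lte_mul_pinfty.
Qed.

(** The positive and negative parts of [delta u x (A y)] are even in [y], so the
   integral of each is half of that of its ray integrals over the sphere. The
   difference of the two identities is meaningful because the positive part is
   integrable. *)
Lemma Ls_sphere (A : 'M[R]_n) u x : A \in unitmx -> L1_omega s u ->
  touched_above u x ->
  Ls s A u x = (Cns n s / (4 * (1 - s)))%:E *
    \int[sphere_measure]_(e in usphere) Is s u x (A *m e).
Proof.
move=> uA u1 xt; have mu := u1.1.
have mv : measurable_fun setT (\- u)%R by exact: measurableT_comp.
pose h w := fun y : V => posdelta w x (A *m y).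
have mh w : measurable_fun setT w -> measurable_fun setT (h w).
  move=> mw; apply: (measurableT_comp (measurable_posdelta x mw)).
  exact: measurable_cV_mulmx.
have h0 w y : (0 <= h w y)%R by exact: posdelta_ge0.
have hN w y : h w (- y)%R = h w y by rewrite /h mulmxN posdeltaN.
pose I w := \int[lebesgue_cV n]_y (h w y / enorm y `^ (n%:R + 2 * s))%:E.
have IE w : measurable_fun setT w ->
    \int[sphere_measure]_(e in usphere) ray_integral (h w) e = 2%:E * I w.
  by move=> mw; rewrite integral_ray//; exact: mh.
have I0 w : 0 <= I w.
  by apply: integral_ge0 => y _; rewrite lee_fin divr_ge0// powR_ge0.
have IsAE e : Is s u x (A *m e) = (1 - s)%:E *
    (ray_integral (h u) e - ray_integral (h (\- u)%R) e).
  have rayA w : ray_integral (posdelta w x) (A *m e) = ray_integral (h w) e.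
    by apply: eq_integral => r _; rewrite /h -scalemxAr.
  by rewrite IsE !rayA.
under eq_integral do rewrite IsAE.
rewrite ge0_integralZB; last 7 first.
- exact: measurable_usphere.
- by apply: measurable_funTS; apply: measurable_ray_integral => //; exact: mh.
- by apply: measurable_funTS; apply: measurable_ray_integral => //; exact: mh.
- by move=> e; exact: ray_integral_ge0.
- by move=> e; exact: ray_integral_ge0.
- by rewrite subr_gt0.
- by rewrite IE// lte_mul_pinfty// (posdelta_lty s0 s1).
rewrite !IE// -pmule_distrB// !muleA -!EFinM /Ls.
rewrite integral_pos_neg; last by move=> y; rewrite invr_ge0 powR_ge0.
congr (_%:E * (_ - _)).
- by field; rewrite subr_eq0 gt_eqF.
- apply: eq_integral => y _; rewrite /h /posdelta /delta /=.
  by congr (Num.max _ _ / _)%:E; ring.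
Qed.

End rays.

(** * Positive definite matrices and the constants *)

Section matrices_lemmas.
Context {R : realType} {n : nat}.

Lemma posdef_unitmx (A : 'M[R]_n) : sym_posdef A -> A \in unitmx.
Proof.
move=> [_ Apos]; rewrite -unitmx_tr -row_free_unit; apply/inj_row_free => v vA.
apply/eqP; apply: contraTT isT => v0.
have vT0 : v^T != 0 by apply: contra v0 => /eqP/(congr1 trmx); rewrite trmxK trmx0 => ->.
have := Apos _ vT0; rewrite trmxK -mulmxA.
by rewrite -[A]trmxK -trmx_mul vA trmx0 mulmx0 mxE ltxx.
Qed.

Lemma posdef_mul_neq0 (A : 'M[R]_n) (v : 'cV[R]_n) : sym_posdef A ->
  v != 0 -> A *m v != 0.
Proof.
move=> [_ Apos] v0; apply: contraTN (Apos _ v0) => /eqP Av.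
by rewrite -mulmxA Av mulmx0 mxE ltxx.
Qed.

(** A multiple of the identity, for a constant vector [z]. The infimum over the
   empty set is [+oo], which could not be multiplied by a vanishing constant. *)
Lemma A2_neq0 : (1 < n)%N -> @A2 R n !=set0.
Proof.
move=> n1.
pose N : R := \sum_(i < n) \sum_(j < n | (i < j)%N) 1.
have N0 : 0 < N.
  rewrite /N (bigD1 (Ordinal (ltnW n1)))//= (bigD1 (Ordinal n1))//= -addrA ltr_pwDl//.
  by rewrite addr_ge0//; [exact: sumr_ge0|apply: sumr_ge0 => i _; exact: sumr_ge0].
pose c := (Num.sqrt N)^-1.
have c0 : 0 < c by rewrite invr_gt0 sqrtr_gt0.
have n0 : 0 < n%:R :> R by rewrite ltr0n ltnW.
pose l := Num.sqrt (n.-1%:R * c).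
have nm0 : 0 < n.-1%:R * c by rewrite mulr_gt0// ltr0n -subn1 subn_gt0.
have l0 : 0 < l by rewrite sqrtr_gt0.
have sig2 : sigma2 (fun _ : 'I_n => c) = 1.
  rewrite /sigma2; transitivity (N * c ^+ 2).
    rewrite /N mulr_suml; apply: eq_bigr => i _; rewrite mulr_suml.
    by apply: eq_bigr => j _; rewrite mul1r expr2.
  by rewrite exprVn sqr_sqrtr ?(ltW N0)// divff// gt_eqF.
exists l%:M; split.
  split; first by rewrite tr_scalar_mx.
  move=> v v0; rewrite -mulmxA mul_scalar_mx -scalemxAr mxE mulr_gt0// mxE.
  have [i vi] : exists i, v i ord0 != 0.
    apply: contrapT => h; move/negP: v0; apply; apply/eqP/colP => i; rewrite mxE.
    by apply/eqP; apply: contrapT => vi; apply: h; exists i; exact/negP.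
  rewrite (bigD1 i)//= ltr_pwDl//.
    by rewrite mxE -expr2 exprn_even_gt0.
  by apply: sumr_ge0 => j _; rewrite mxE -expr2 sqr_ge0.
exists (fun=> l), (fun=> c); split => //.
- rewrite /eigenvalues char_poly_trig; last first.
    by apply: is_diag_mx_is_trig; exact: scalar_mx_is_diag.
  by apply: eq_bigr => i _; rewrite mxE eqxx.
- split; last by rewrite sig2.
  by rewrite /sigma1 sumr_const card_ord pmulrn_lgt0// ltnW.
- move=> i; rewrite sqr_sqrtr ?(ltW nm0)// (eq_bigl (fun j => j \in [set~ i]%SET)); last first.
    by move=> j; rewrite !inE.
  by rewrite sumr_const cardsC1 card_ord mulr_natl.
Qed.

End matrices_lemmas.

Lemma Cns_ge0 (R : realType) (n : nat) (s : R) : 0 <= s -> 0 <= Cns n s.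
Proof.
move=> s0.
have G z : 0 <= GammaE z :> R.
  by apply: Rintegral_ge0 => t _; rewrite mulr_ge0 ?powR_ge0 ?expR_ge0.
by rewrite /Cns divr_ge0 ?mulr_ge0 ?powR_ge0.
Qed.

(** * The representation formula *)

Theorem lemma2p5 (R : realType) (n : nat) (hn : (3 <= n)%N)
    (s : R) (hs0 : 0 < s) (hs1 : s < 1)
    (u : 'cV[R]_n -> R) (hu : continuous u) (hu1 : L1_omega s u)
    (x : 'cV[R]_n) (hx : touched_above u x) :
  (forall A : 'M[R]_n, sym_posdef A ->
     Ls s A u x =
       ((Cns n s / (4 * (1 - s)))%:E *
        \int[hausdorff n.-1]_(e in usphere) Is s u x (A *m e))%E
     /\
     ((Cns n s / (4 * (1 - s)))%:E *
        \int[hausdorff n.-1]_(e in usphere) Is s u x (A *m e))%E =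
       ((Cns n s / (4 * (1 - s)))%:E *
        \int[hausdorff n.-1]_(e in usphere)
          ((enorm (A *m e) `^ (2 * s))%:E *
           Thetas s u x ((enorm (A *m e))^-1 *: (A *m e))))%E)
  /\
  Ks s u x =
    ((Cns n s / (4 * (1 - s)))%:E *
     ereal_inf [set \int[hausdorff n.-1]_(e in usphere) Is s u x (A *m e)
               | A in @A2 R n])%E.
Proof.
case: n => [|[|k]]// in hn u hu hu1 x hx *.
set K := Cns k.+2 s / (4 * (1 - s)).
have hausdorffE (f : 'cV[R]_k.+2 -> \bar R) :
    (\int[hausdorff k.+1]_(e in usphere) f e =
     \int[sphere_measure]_(e in usphere) f e)%E.
  by apply: eq_set_function_integral => E mE ES; exact: hausdorff_sphere.
have LsE A : sym_posdef A -> Ls s A u x =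
    (K%:E * \int[hausdorff k.+1]_(e in usphere) Is s u x (A *m e))%E.
  move=> Apos; rewrite (Ls_sphere hs0 hs1 (posdef_unitmx Apos) hu1 hx).
  by rewrite hausdorffE.
split.
  move=> A Apos; split; first exact: LsE.
  rewrite !hausdorffE; congr (_ * _)%E.
  apply: eq_integral => e; rewrite inE/= => e1.
  have Ae0 : 0 < enorm (A *m e).
    rewrite enorm_gt0 posdef_mul_neq0//; apply: contra_eqN e1 => /eqP ->.
    by rewrite enorm0 eq_sym oner_eq0.
  rewrite -(IsZ s x _ hu1.1 Ae0) scalerA mulfV ?scale1r//.
  by rewrite gt_eqF.
have K0 : 0 <= K.
  by rewrite divr_ge0 ?Cns_ge0 ?(ltW hs0)// mulr_ge0// subr_ge0 ltW.
have [A0 A0in] := @A2_neq0 R k.+2 isT.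
rewrite /Ks.
have -> : [set Ls s A u x | A in A2] = [set (K%:E * y)%E | y in
    [set \int[hausdorff k.+1]_(e in usphere) Is s u x (A *m e) | A in @A2 R k.+2]]%E.
  by rewrite image_comp; apply: eq_imagel => A [Apos _]; exact: LsE.
move: K0; rewrite le_eqVlt => /predU1P[<-|K0]; last exact: ereal_inf_pZl.
rewrite mul0e; under eq_imagel do rewrite mul0e.
rewrite [X in ereal_inf X](_ : _ = [set 0%E]); first exact: ereal_inf1.
apply/seteqP; split => [_ [y _ <-]//|_ ->].
by exists (\int[hausdorff k.+1]_(e in usphere) Is s u x (A0 *m e))%E => //; exists A0.
Qed.
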